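(* Let $k$ and $l$ be even integers with $k > l \geq 10$. Then every zero of $E_k(\tau)E_l(\tau) + E_{k+l}(\tau)$ in the fundamental domain $\mathcal{F}$ lies on the arc $\mathcal{A} = \{e^{i\theta} : \pi/2 \leq \theta \leq 2\pi/3\}$.
   Context: For an even integer $k \geq 4$ and $\tau$ in the upper half plane $\mathbb{H}=\{\tau\in\mathbb{C}: \operatorname{Im}(\tau)>0\}$, the normalized Eisenstein series of weight $k$ for $\mathrm{SL}_2(\mathbb{Z})$ is $$E_k(\tau) = \frac12 \sum_{\substack{c,d\in\mathbb{Z}\\ \gcd(c,d)=1}} (c\tau+d)^{-k}.$$ The standard fundamental domain is $$\mathcal{F}=\left\{\tau\in\mathbb{H}: |\tau|>1,\ 0<\operatorname{Re}(\tau)<\tfrac12\right\}\cup\left\{\tau\in\mathbb{H}: |\tau|\geq 1,\ -\tfrac12\leq\operatorname{Re}(\tau)\leq 0\right\}.$$ *)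

(* Defs.v *)
From mathcomp Require Import all_boot all_order all_algebra.
From mathcomp Require Import all_classical all_reals all_analysis.
From mathcomp Require Import complex.
From mathcomp.analysis.showcase Require Import summability.

Set Implicit Arguments.
Unset Strict Implicit.
Unset Printing Implicit Defensive.

Import Order.TTheory GRing.Theory Num.Theory numFieldNormedType.Exports.

Local Open Scope classical_set_scope.
Local Open Scope ring_scope.
Local Open Scope complex_scope.

Definition upper_half_plane (R : realType) : set R[i] :=
  [set tau | 0 < complex.Im tau].

(* Pairs (c, d); coprimez 0 0 is false, as required. *)
Definition coprime_pair : choiceType :=
  {p : int * int | coprimez p.1 p.2}.

(* [summability.sum] is the unordered sum, i.e. the limit of the finite partial
   sums along the finite subsets of the index type directed by inclusion. It is
   total, and meaningful here when the family is summable, i.e. for k >= 3 and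
   tau in the upper half plane. [R[i]^o] is R[i] as a normed module over itself,
   so the limit is for the usual topology of the complex plane. *)
Definition eisenstein (R : realType) (k : nat) (tau : R[i]) : R[i] :=
  2^-1 * summability.sum (fun p : coprime_pair =>
    (((val p).1%:~R * tau + (val p).2%:~R) ^- k : R[i]^o)).

(* The order of R[i] compares real parts of numbers with equal imaginary parts,
   so on the norm, which is real, [1 < `|tau|] is the order of R. *)
Definition fundamental_domain (R : realType) : set R[i] :=
  [set tau | upper_half_plane tau /\
             1 < `|tau| /\ 0 < complex.Re tau < 2^-1] `|`
  [set tau | upper_half_plane tau /\
             1 <= `|tau| /\ - 2^-1 <= complex.Re tau <= 0].

Definition expi (R : realType) (theta : R) : R[i] := cos theta +i* sin theta.

Definition unit_circle_arc (R : realType) : set R[i] :=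
  [set expi theta | theta in [set t : R | pi / 2 <= t <= 2 * pi / 3]].

(* Main.v *)
(* Write [k + l = 2M], [f = E_k E_l + E_(k+l)], [sig = 1 - tau^(-2M)] and
   [u = Re (f / sig)]. Since [tau^M f] is real on the unit circle, [f / sig]
   stays under control there, and it suffices to show [u > 0] on
   [|tau| > 1], [|Re tau| < 1/2].

   The real part of a function with second-order expansions obeys a minimum
   principle: average over [h, ih, -h, -ih], where the square terms cancel. It is
   applied to [u - eta v] on [|tau| >= 1 + eps], where the barrier
   [v = Im (lam z - z^3)], [z = tau + 1/tau], vanishes on the circle, is
   nonpositive on the lines [Re tau = +-1/2] near [rho] and is positive at a given
   point, for some [lam < 3].

   On the lines [E_k], [E_l] and [E_(k+l)] are real and positive. Away from [rho]
   the constant term dominates. Near [rho] the leading terms have nonnegative real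
   part if [k = 0 mod 3]; otherwise [E_k(rho) = 0], and also [E_k'(rho) = 0] if
   [k = 2 mod 3], so that only the variation of the leading terms from [rho] has to
   be estimated. Near the circle, [u >= - o(1)]: where [Im tau^M] is small,
   [tau^M f] has the sign of [Re tau^M]; elsewhere [sig] is bounded away from 0 and
   [u] tends to 0. For [Im tau >= 2] the series are close to 1. *)

From HB Require Import structures.
Require Import Defs.
From mathcomp Require Import all_boot all_order all_algebra.
From mathcomp Require Import finmap.
From mathcomp Require Import all_classical all_reals all_analysis.
From mathcomp Require Import complex.
From mathcomp.analysis.showcase Require Import summability.
From mathcomp Require Import ring lra zify.

Import Order.TTheory GRing.Theory Num.Theory numFieldNormedType.Exports.
Import Normc.

Local Open Scope classical_set_scope.
Local Open Scope ring_scope.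
Local Open Scope complex_scope.

Set Implicit Arguments.
Unset Strict Implicit.
Unset Printing Implicit Defensive.

(** On the circle [F = tau^M f] is real and [tau^M sig = 2 'i Im (tau^M)], so [f / sig] is purely
    imaginary away from the zeros of [sig]. Just outside the circle its real part acts at these
    zeros like a Poisson kernel weighted by [F Re (tau^M)]. This is why the sign of [F] matters only
    where [tau^M] is near 1 or -1, and why [u], unlike [Re f], is nonnegative in the limit. The
    corner [rho] is the obstacle. There [f] vanishes whenever [k + l] is not divisible by 3, so
    positivity on the lines has no uniform lower bound, and the boundary estimates alone give only
    [u >= 0]. The barrier replaces a strong minimum principle: near the corner only its sign on the
    lines is used, and on the rest of the lines and at the top a small multiple of it fits under a
    positive lower bound of [u]. The map [tau + 1/tau] sends [rho] to -1, a critical point of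
    [3 z - z^3]; hence the threshold 3 for [lam]. *)

(** * Norm, real part and imaginary part of complex numbers *)

Lemma normc_ge0 (R : realType) (z : R[i]) : 0 <= normc z.
Proof. by case: z => a b; exact: sqrtr_ge0. Qed.

Lemma normc_sqr (R : realType) (z : R[i]) :
  normc z ^+ 2 = complex.Re z ^+ 2 + complex.Im z ^+ 2.
Proof. by case: z => a b; rewrite sqr_sqrtr // addr_ge0 ?sqr_ge0. Qed.

Lemma normrcE (R : realType) (z : R[i]) : `|z| = (normc z)%:C.
Proof. by []. Qed.

Lemma normc_eq0 (R : realType) (z : R[i]) : (normc z == 0) = (z == 0).
Proof. by apply/eqP/eqP => [/eq0_normc//|->]; rewrite normc0. Qed.

Lemma normc_gt0 (R : realType) (z : R[i]) : (0 < normc z) = (z != 0).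
Proof. by rewrite lt_neqAle normc_ge0 andbT eq_sym normc_eq0. Qed.

Lemma normcX (R : realType) (z : R[i]) n : normc (z ^+ n) = normc z ^+ n.
Proof. by elim: n => [|n IH]; rewrite ?expr0 ?normc1 // !exprS normcM IH. Qed.

Lemma normcXV (R : realType) (z : R[i]) n : normc (z ^- n) = normc z ^- n.
Proof. by rewrite normcV normcX. Qed.

Lemma normc_conj (R : realType) (z : R[i]) : normc (conjc z) = normc z.
Proof. by case: z => a b /=; rewrite sqrrN. Qed.

Lemma normc_real (R : realType) (x : R) : normc x%:C = `|x|.
Proof. by rewrite /= expr0n addr0 sqrtr_sqr. Qed.

Lemma normc_nat (R : realType) (n : nat) : normc (n%:R : R[i]) = n%:R.
Proof. by rewrite -(rmorph_nat (real_complex R)) normc_real ger0_norm. Qed.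

Lemma normcB (R : realType) (x y : R[i]) : normc (x - y) = normc (y - x).
Proof. by rewrite -normcN opprB. Qed.

Lemma Re_normc (R : realType) (z : R[i]) : `|complex.Re z| <= normc z.
Proof. by case: z => a b /=; rewrite -sqrtr_sqr ler_wsqrtr // lerDl sqr_ge0. Qed.

Lemma Im_normc (R : realType) (z : R[i]) : `|complex.Im z| <= normc z.
Proof. by case: z => a b /=; rewrite -sqrtr_sqr ler_wsqrtr // lerDr sqr_ge0. Qed.

Lemma normc_le (R : realType) (z : R[i]) (e : R) : 0 <= e ->
  complex.Re z ^+ 2 + complex.Im z ^+ 2 <= e ^+ 2 -> normc z <= e.
Proof. by move=> e0; rewrite -normc_sqr ler_sqr ?nnegrE ?normc_ge0. Qed.

Lemma normc_sum (R : realType) (I : Type) (r : seq I) (P : pred I) (F : I -> R[i]) :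
  normc (\sum_(i <- r | P i) F i) <= \sum_(i <- r | P i) normc (F i).
Proof.
elim/big_ind2 : _ => [|x a y b xa yb|//]; first by rewrite normc0.
by rewrite (le_trans (le_normcD _ _)) ?lerD.
Qed.

Lemma ler_normcB (R : realType) (x y : R[i]) : normc x - normc y <= normc (x - y).
Proof. by rewrite lerBlDr -{1}(subrK y x) le_normcD. Qed.

Lemma cReD (R : realType) (x y : R[i]) :
  complex.Re (x + y) = complex.Re x + complex.Re y.
Proof. by case: x y => a b [c d]. Qed.
Lemma cImD (R : realType) (x y : R[i]) :
  complex.Im (x + y) = complex.Im x + complex.Im y.
Proof. by case: x y => a b [c d]. Qed.
Lemma cReN (R : realType) (x : R[i]) : complex.Re (- x) = - complex.Re x.
Proof. by case: x. Qed.
Lemma cImN (R : realType) (x : R[i]) : complex.Im (- x) = - complex.Im x.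
Proof. by case: x. Qed.
Lemma cReM (R : realType) (x y : R[i]) : complex.Re (x * y) =
  complex.Re x * complex.Re y - complex.Im x * complex.Im y.
Proof. by case: x y => a b [c d]. Qed.
Lemma cImM (R : realType) (x y : R[i]) : complex.Im (x * y) =
  complex.Re x * complex.Im y + complex.Im x * complex.Re y.
Proof. by case: x y => a b [c d]. Qed.
Lemma cReC (R : realType) (x : R) : complex.Re x%:C = x. Proof. by []. Qed.
Lemma cImC (R : realType) (x : R) : complex.Im x%:C = 0. Proof. by []. Qed.
Lemma cReJ (R : realType) (x : R[i]) : complex.Re (conjc x) = complex.Re x.
Proof. by case: x. Qed.
Lemma cImJ (R : realType) (x : R[i]) : complex.Im (conjc x) = - complex.Im x.
Proof. by case: x. Qed.

Lemma eq_ReIm (R : realType) (x y : R[i]) :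
  complex.Re x = complex.Re y -> complex.Im x = complex.Im y -> x = y.
Proof. by case: x y => a b [c d] /= -> ->. Qed.

(** * Unordered sums *)

(** Convergence along finite subsets in epsilon form, with a real-valued norm. The algebra of sums
    is done here; [has_sum_sum] identifies the limit with [summability.sum]. *)
Definition has_sum (R : realType) (I : choiceType) (f : I -> R[i]) (l : R[i]) :=
  forall e : R, 0 < e -> exists A : {fset I}, forall B : {fset I},
    (A `<=` B)%fset -> normc (\sum_(i <- B) f i - l) <= e.

Lemma has_sum_sum (R : realType) (I : choiceType) (f : I -> R[i]) l :
  has_sum f l -> summability.sum (f : I -> R[i]^o) = l.
Proof.
move=> fl; have tF := @totally_filter I.
apply: norm_cvg_lim; apply/cvgrPdist_le => e e0.
have Ie : complex.Im e = 0 by apply: ger0_Im; exact: ltW.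
have Re0 : 0 < complex.Re e by move: e0; rewrite ltcE => /andP[].
have [A hA] := fl _ Re0.
exists A => // B /= AB.
rewrite lecE normrcE /= Ie eqxx /= /partial_sum -normcN opprB.
have := hA B AB.
by rewrite big_seq_fsetE.
Qed.

Lemma has_sum_ext (R : realType) (I : choiceType) (f g : I -> R[i]) l :
  f =1 g -> has_sum f l -> has_sum g l.
Proof.
by move=> fg fl e /fl[A hA]; exists A => B /hA; under eq_bigr do rewrite fg.
Qed.

Lemma has_sum_unique (R : realType) (I : choiceType) (f : I -> R[i]) l l' :
  has_sum f l -> has_sum f l' -> l = l'.
Proof.
move=> fl fl'; apply/eqP; rewrite -subr_eq0 -normc_eq0 eq_le normc_ge0 andbT.
rewrite leNgt; apply/negP => d0.
have e0 : 0 < normc (l - l') / 3 by rewrite divr_gt0.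
have [A hA] := fl _ e0; have [B hB] := fl' _ e0.
have := hA _ (fsubsetUl A B); have := hB _ (fsubsetUr A B).
set S := \sum_(i <- _) _ => h1 h2.
have : normc (l - l') <= normc (S - l) + normc (S - l').
  by rewrite (normcB S l) (le_trans _ (le_normcD _ _)) // (_ : l - S + (S - l') = l - l') //; ring.
lra.
Qed.

Lemma has_sum_add (R : realType) (I : choiceType) (f g : I -> R[i]) l l' :
  has_sum f l -> has_sum g l' -> has_sum (fun i => f i + g i) (l + l').
Proof.
move=> fl gl e e0; have e2 : 0 < e / 2 by lra.
have [A hA] := fl _ e2; have [B hB] := gl _ e2.
exists (A `|` B)%fset => D; rewrite fsubUset => /andP[/hA h1 /hB h2].
rewrite big_split /= opprD addrACA (le_trans (le_normcD _ _)) //; lra.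
Qed.

Lemma has_sum_scale (R : realType) (I : choiceType) (f : I -> R[i]) l a :
  has_sum f l -> has_sum (fun i => a * f i) (a * l).
Proof.
move=> fl e e0.
have c0 : 0 < e / (normc a + 1) by rewrite divr_gt0 // ltr_wpDl ?normc_ge0.
have [A hA] := fl _ c0.
exists A => D /hA h; rewrite -mulr_sumr -mulrBr normcM.
have := normc_ge0 a => a0.
rewrite (le_trans (ler_wpM2l a0 h)) // mulrCA ler_piMr ?(ltW e0) //.
rewrite ler_pdivrMr ?mul1r; lra.
Qed.

Lemma has_sum_conj (R : realType) (I : choiceType) (f : I -> R[i]) l :
  has_sum f l -> has_sum (fun i => conjc (f i)) (conjc l).
Proof.
move=> fl e /fl[A hA]; exists A => B /hA.
by rewrite -(rmorph_sum (@conjc R)) -rmorphB normc_conj.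
Qed.

Lemma has_sum_reindex (R : realType) (I J : choiceType) (f : I -> R[i]) l
    (p : J -> I) (q : I -> J) :
  cancel p q -> cancel q p -> has_sum f l -> has_sum (fun j => f (p j)) l.
Proof.
move=> pq qp fl e /fl[A hA]; exists [fset q i | i in A]%fset => B AB.
have <- : \sum_(i <- [fset p j | j in B]%fset) f i = \sum_(j <- B) f (p j).
  by rewrite big_imfset //= => x y _ _; exact: (can_inj pq).
apply: hA; apply/fsubsetP => i iA; rewrite -(qp i) in_imfset //=.
by apply: (fsubsetP AB); rewrite in_imfset.
Qed.

Definition abs_bounded (R : realType) (I : choiceType) (f : I -> R[i]) (M : R) :=
  forall A : {fset I}, \sum_(i <- A) normc (f i) <= M.

(** Used with [A] the eight pairs of height 1: the error of the dominant terms is bounded through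
    finite sums that avoid [A]. *)
Lemma has_sum_le (R : realType) (I : choiceType) (f : I -> R[i]) l (M : R)
    (A : {fset I}) : has_sum f l ->
  (forall B : {fset I}, [disjoint A & B]%fset -> \sum_(i <- B) normc (f i) <= M) ->
  normc (l - \sum_(i <- A) f i) <= M.
Proof.
move=> fl h; apply/ler_addgt0Pr => e e0.
have [D hD] := fl _ e0; have := hD _ (fsubsetUr A D).
rewrite (big_fsetID _ (mem A)) /=.
have -> : [fset x | x in (A `|` D) & x \in A]%fset = A.
  apply/fsetP => x; rewrite !inE; case: (x \in A) => //=; by rewrite andbF.
set S := \sum_(i <- A) _; set T := \sum_(i <- _) _ => h1.
have h2 : normc T <= M.
  rewrite (le_trans (normc_sum _ _ _)) // h //.
  apply/fdisjointP => x xA; rewrite !inE xA /= ?andbF //.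
have -> : l - S = T - (S + T - l) by ring.
by rewrite (le_trans (le_normcD _ _)) // normcN lerD.
Qed.

Lemma has_sum_norm (R : realType) (I : choiceType) (f : I -> R[i]) l (M : R) :
  has_sum f l -> abs_bounded f M -> normc l <= M.
Proof.
move=> fl fM; have := @has_sum_le _ _ _ _ M fset0 fl.
by rewrite big_seq_fset0 subr0; apply => B _; exact: fM.
Qed.

Lemma nneg_sum_sup (R : realType) (I : choiceType) (f : I -> R) (M : R) :
  (forall i, 0 <= f i) -> (forall A : {fset I}, \sum_(i <- A) f i <= M) ->
  exists l, forall e, 0 < e -> exists A : {fset I}, forall B : {fset I},
    (A `<=` B)%fset -> `|\sum_(i <- B) f i - l| <= e.
Proof.
move=> f0 fM; pose S := [set \sum_(i <- A) f i | A in [set: {fset I}]].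
have hS : has_sup S.
  split; first by exists (\sum_(i <- fset0) f i), fset0.
  by exists M => _ [A _ <-].
exists (sup S) => e e0.
have [_ [A _ <-] hA] := sup_adherent e0 hS.
exists A => B AB.
have h1 : \sum_(i <- A) f i <= \sum_(i <- B) f i.
  rewrite [leRHS](big_fsetID _ (mem A)) /=.
  have -> : [fset x | x in B & x \in A]%fset = A.
    apply/fsetP => x; rewrite !inE andbC; case: (boolP (x \in A)) => //= xA.
    exact: (fsubsetP AB).
  by rewrite lerDl sumr_ge0.
have h2 : \sum_(i <- B) f i <= sup S by apply: (ub_le_sup hS.2); exists B.
rewrite ler_norml; lra.
Qed.

Lemma has_sum_ex (R : realType) (I : choiceType) (f : I -> R[i]) (M : R) :
  abs_bounded f M -> exists l, has_sum f l.
Proof.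
move=> fM.
have real_case (g : I -> R) : (forall i, `|g i| <= normc (f i)) ->
    exists l : R, has_sum (fun i => (g i)%:C) l%:C.
  move=> gf.
  (* [g] is the difference of the nonnegative families [|g| + g] and [|g|], whose sums are
     suprema. *)
  have [||l1 h1] := @nneg_sum_sup R I (fun i => `|g i| + g i) (2 * M).
  - by move=> i; have := ler_norm (- g i); rewrite normrN; lra.
  - move=> A; rewrite (le_trans _ (_ : 2 * \sum_(i <- A) normc (f i) <= _)) //.
      rewrite mulr_sumr ler_sum // => i _.
      by have := gf i; have := ler_norm (g i); lra.
    by rewrite ler_pM2l.
  have [||l2 h2] := @nneg_sum_sup R I (fun i => `|g i|) M.
  - by move=> i; exact: normr_ge0.
  - move=> A; rewrite (le_trans _ (fM A)) // ler_sum // => i _.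
  exists (l1 - l2) => e e0; have e2 : 0 < e / 2 by lra.
  have [A hA] := h1 _ e2; have [B hB] := h2 _ e2.
  exists (A `|` B)%fset => D; rewrite fsubUset => /andP[/hA h3 /hB h4].
  rewrite -(rmorph_sum (real_complex R)) -rmorphB normc_real.
  move: h3 h4; rewrite big_split /= !ler_norml; lra.
have [a ha] := real_case (fun i => complex.Re (f i)) (fun i => Re_normc (f i)).
have [b hb] := real_case (fun i => complex.Im (f i)) (fun i => Im_normc (f i)).
exists (a%:C + 'i%C * b%:C).
apply: has_sum_ext (has_sum_add ha (has_sum_scale 'i%C hb)) => i /=.
by rewrite [RHS]complexE.
Qed.

(** * Tails of lattice sums *)

Definition height (p : coprime_pair) : nat := maxn `|(val p).1| `|(val p).2|.

Lemma height_gt0 p : (0 < height p)%N.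
Proof.
case: p => [[c d] /= cd]; rewrite /height /= lt0n; apply/eqP => h.
have /andP[/eqP c0 /eqP d0] : (`|c| == 0)%N && (`|d| == 0)%N by lia.
by move: cd; rewrite /coprimez /gcdz c0 d0.
Qed.

(** At most four sign choices share given absolute values. Coprimality is kept on the right because
    [w10_sum] uses it to discard the diagonal and the pairs [(0, b)], [(a, 0)] of its first
    shell. *)
Lemma sum_abs_le (R : realType) (w : nat -> nat -> R) (B : {fset coprime_pair}) :
  (forall a b, 0 <= w a b) ->
  exists K, \sum_(p <- B) w `|(val p).1|%N `|(val p).2|%N <=
    4 * \sum_(a < K) \sum_(b < K) (if coprime a b then w a b else 0).
Proof.
move=> w0; pose K := (\max_(p <- B) height p).+1; exists K.
have ltK p : p \in B -> (`|(val p).1| < K)%N /\ (`|(val p).2| < K)%N.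
  move=> pB; have : (height p < K)%N.
    by rewrite ltnS; apply: (leq_bigmax_seq (P := xpredT) (F := height)).
  by rewrite /height; lia.
have -> : \sum_(p <- B) w `|(val p).1|%N `|(val p).2|%N =
  \sum_(p <- B) \sum_(a < K) \sum_(b < K)
    (if (`|(val p).1| == a)%N && (`|(val p).2| == b)%N then w a b else 0).
  rewrite big_seq [RHS]big_seq; apply: eq_bigr => p /ltK [h1 h2].
  rewrite (bigD1 (Ordinal h1)) //= (bigD1 (Ordinal h2)) //= !eqxx /=.
  rewrite big1 => [|b /eqP bn]; last first.
    by case: eqP => // e; case: bn; apply: val_inj.
  rewrite big1 => [|a /eqP an]; first by rewrite !addr0.
  rewrite big1 // => b _.
  by case: eqP => //= e; case: an; apply: val_inj.
rewrite exchange_big mulr_sumr; apply: ler_sum => a _.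
rewrite exchange_big mulr_sumr; apply: ler_sum => b _ /=.
rewrite -big_mkcond /= big_const_seq iter_addr_0.
set q := fun p : coprime_pair => _.
case: (boolP (coprime a b)) => [_|nab]; last first.
  rewrite (_ : count q B = 0)%N ?mulr0n ?mulr0 //.
  apply/eqP; rewrite -leqn0 leqNgt -has_count; apply/hasPn => p _.
  rewrite /q; apply: contra nab => /andP[/eqP <- /eqP <-].
  by case: p => [[c d] /=].
rewrite -[leLHS]mulr_natl; apply: ler_wpM2r => //; rewrite ler_nat -size_filter.
set s := [seq val p | p <- [seq p <- B | q p]].
rewrite -(size_map val) -/s.
have us : uniq s by rewrite map_inj_uniq ?filter_uniq ?fset_uniq //; exact: val_inj.
apply: (leq_trans (uniq_leq_size us (s2 :=
  [:: (a%:Z, b%:Z); (- a%:Z, b%:Z); (a%:Z, - b%:Z); (- a%:Z, - b%:Z)]) _)) => //.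
move=> x /mapP[p]; rewrite mem_filter /q => /andP[/andP[/eqP h1 /eqP h2] _] ->.
case: p h1 h2 => [[c d] cd] /= h1 h2; rewrite !inE !xpair_eqE.
lia.
Qed.

(** The exponent is the least weight in the theorem. The pairs of height 1 are cut off since they
    are summed exactly elsewhere. *)
Definition w10 (R : realType) (a b : nat) : R :=
  if (2 <= maxn a b)%N then (maxn a b)%:R ^- 10 else 0.

Lemma w10_ge0 (R : realType) a b : 0 <= w10 R a b.
Proof. by rewrite /w10; case: ifP => // _; rewrite invr_ge0 exprn_ge0. Qed.

Lemma w10_shell (R : realType) (K : nat) : (2 <= K)%N ->
  \sum_(b < K) (if coprime K b then w10 R K b else 0) <= K%:R ^- 9 /\
  \sum_(a < K) (if coprime a K then w10 R a K else 0) <= K%:R ^- 9.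
Proof.
move=> K2.
have K0 : 0 < K%:R :> R by rewrite ltr0n; lia.
have kk : K%:R ^- 9 = \sum_(b < K) K%:R ^- 10 :> R.
  rewrite sumr_const card_ord -[RHS]mulr_natl.
  by field; rewrite gt_eqF.
have hw (a b : nat) : maxn a b = K -> w10 R a b <= K%:R ^- 10.
  by move=> h; rewrite /w10 h K2.
split; rewrite kk; apply: ler_sum => b _; case: ifP => _; rewrite ?invr_ge0 ?exprn_ge0 //;
  apply: hw; have := ltn_ord b; lia.
Qed.

Lemma w10_sum (R : realType) (K : nat) :
  \sum_(a < K) \sum_(b < K) (if coprime a b then w10 R a b else 0) <= 400^-1.
Proof.
(* The shell [max(a, b) = m] adds at most [2 m^-9], its corner [(m, m)] not being coprime. The shell
   [m = 2] contains only [(1, 2)] and [(2, 1)], which give [512^-1]; for [m >= 3] the sum telescopes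
   through [m^-9 <= 3^-7 (1/(m-1) - 1/m)]. *)
have key n : \sum_(a < n.+3) \sum_(b < n.+3) (if coprime a b then w10 R a b else 0)
    <= 512^-1 + 2 * 3^- 7 * (2^-1 - (n.+2)%:R^-1).
  have step m : (2 <= m)%N ->
    \sum_(a < m.+1) \sum_(b < m.+1) (if coprime a b then w10 R a b else 0) <=
    \sum_(a < m) \sum_(b < m) (if coprime a b then w10 R a b else 0) + 2 * m%:R ^- 9.
    move=> m2; rewrite big_ord_recr /=.
    under eq_bigr do rewrite big_ord_recr /=.
    rewrite big_split /= big_ord_recr /= /coprime gcdnn.
    rewrite (_ : (m == 1)%N = false) /=; last by lia.
    have [h1 h2] := w10_shell R m2; rewrite /coprime in h1 h2 *.
    by rewrite addr0 -addrA lerD2l [leRHS]mulr_natl mulr2n lerD.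
  elim: n => [|n IH].
    rewrite !big_ord_recr !big_ord0 /= /w10 /= (_ : maxn 1 2 = 2%N) // (_ : maxn 2 1 = 2%N) //; lra.
  rewrite (le_trans (step n.+3 _)) //.
  suff : 2 * n.+3%:R ^- 9 <= 2 * 3 ^- 7 * (n.+2%:R^-1 - n.+3%:R^-1) :> R.
    by move: IH; set a := _ ^- 9; set b := n.+2%:R^-1; set c := n.+3%:R^-1; lra.
  have n0 : 0 < n.+2%:R :> R by [].
  have -> : n.+3%:R = n.+2%:R + 1 :> R by rewrite -natr1.
  have n2 : 2 <= n.+2%:R :> R by rewrite ler_nat.
  move: n0 n2; set x : R := n.+2%:R => x0 x2.
  have -> : x^-1 - (x + 1)^-1 = (x * (x + 1))^-1 by field; rewrite !gt_eqF //; lra.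
  rewrite -mulrA ler_pM2l // -invfM lef_pV2 ?posrE ?mulr_gt0 ?exprn_gt0 //; try lra.
  rewrite (exprD _ 7 2) expr2; apply: ler_pM.
  - by [].
  - by rewrite mulr_ge0 //; lra.
  - by apply: lerXn2r; rewrite ?nnegrE; lra.
  - by rewrite ler_pM //; lra.
case: K => [|[|[|n]]].
- rewrite big_ord0; lra.
- by rewrite !big_ord_recr !big_ord0 /= /w10 /maxn /=; lra.
- by rewrite !big_ord_recr !big_ord0 /= /w10 /maxn /=; lra.
apply: (le_trans (key n)).
have : 0 <= n.+2%:R^-1 :> R by rewrite invr_ge0.
by set a := n.+2%:R^-1; lra.
Qed.

Lemma tail_sum (R : realType) (B : {fset coprime_pair}) :
  (forall p, p \in B -> (2 <= height p)%N) ->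
  \sum_(p <- B) (height p)%:R ^- 10 <= 100^-1 :> R.
Proof.
move=> hB; have [K] := sum_abs_le B (@w10_ge0 R).
have -> : \sum_(p <- B) w10 R `|(val p).1|%N `|(val p).2|%N =
    \sum_(p <- B) (height p)%:R ^- 10.
  by rewrite big_seq [RHS]big_seq; apply: eq_bigr => p /hB; rewrite /w10 -/(height p) => ->.
have := w10_sum R K; lra.
Qed.

Definition cpair (c d : int) (cd : coprimez c d) : coprime_pair :=
  exist (fun p => coprimez p.1 p.2) (c, d) cd.

Definition small_pairs : seq coprime_pair :=
  [:: @cpair 0 1 isT; @cpair 0 (-1) isT; @cpair 1 0 isT; @cpair (-1) 0 isT;
      @cpair 1 1 isT; @cpair (-1) (-1) isT; @cpair 1 (-1) isT; @cpair (-1) 1 isT].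

Definition small_fset : {fset coprime_pair} := seq_fset tt small_pairs.

Lemma small_fsetE (R : realType) (V : nmodType) (F : coprime_pair -> V) :
  \sum_(p <- small_fset) F p = \sum_(p <- small_pairs) F p.
Proof.
apply: perm_big; rewrite -[X in perm_eq _ X]undup_id ?seq_fset_perm //.
Qed.

Lemma notin_small p : p \notin small_fset -> (2 <= height p)%N.
Proof.
rewrite seq_fsetE => h; rewrite leqNgt; apply: contra h => h.
case: p h => [[c d] cd]; rewrite /height /= => h.
rewrite !inE -!val_eqE /= !xpair_eqE.
have nz : ~ (c = 0 /\ d = 0) by case=> c0 d0; move: cd; rewrite c0 d0.
lia.
Qed.

(** Eight pairs of height 1 contribute at most 1 each, and all the others together at most
    [100^-1]. *)
Lemma total_sum (R : realType) (B : {fset coprime_pair}) :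
  \sum_(p <- B) (height p)%:R ^- 10 <= 9 :> R.
Proof.
rewrite (big_fsetID _ (mem small_fset)) /=.
have h1 : \sum_(p <- [fset x | x in B & x \notin small_fset]%fset) (height p)%:R ^- 10
    <= 100^-1 :> R.
  by apply: tail_sum => p; rewrite !inE => /andP[_ /notin_small].
have h2 : \sum_(p <- [fset x | x in B & x \in small_fset]%fset) (height p)%:R ^- 10
    <= \sum_(p <- small_fset) 1 :> R.
  set B1 := [fset _ | _ in _ & _]%fset.
  rewrite [leRHS](big_fsetID _ (mem B1)) /=.
  have -> : [fset x | x in small_fset & x \in B1]%fset = B1.
    by apply/fsetP => x; rewrite !inE; case: (x \in small_fset); rewrite ?andbF ?andbT.
  rewrite -[leLHS]addr0 lerD ?sumr_ge0 //.
  apply: ler_sum => p _; rewrite invf_le1 ?exprn_gt0 ?ltr0n ?height_gt0 //.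
  by rewrite exprn_ege1 // ler1n height_gt0.
move: h2; rewrite (small_fsetE R) !big_cons big_nil; lra.
Qed.

(** * Lower bounds for [c tau + d] and the dominant terms of the series *)

(** Closed and symmetric, with both vertical sides and the whole arc, so that the reflection
    [- conjc tau] preserves it and boundary points can be treated like interior ones. *)
Definition in_dom (R : realType) (tau : R[i]) : Prop :=
  [/\ - 2^-1 <= complex.Re tau <= 2^-1, 0 < complex.Im tau &
      1 <= complex.Re tau ^+ 2 + complex.Im tau ^+ 2].

Definition lin (R : realType) (tau : R[i]) (p : coprime_pair) : R[i] :=
  (val p).1%:~R * tau + (val p).2%:~R.

(* Just below [sqrt 3 / 2], the infimum of [|c tau + d| / max(|c|, |d|)] over the
   domain. Locked to be an atom for [lra]. *)
HB.lock Definition kap (R : realType) : R := 433 / 500.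

Lemma kap_gt0 (R : realType) : 0 < kap R.
Proof. by rewrite kap.unlock; lra. Qed.

Lemma intr_complex (R : realType) (z : int) : (z%:~R : R[i]) = (z%:~R : R)%:C.
Proof. by rewrite (rmorph_int (real_complex R)). Qed.

Lemma normc_int (R : realType) (z : int) : normc (z%:~R : R[i]) = `|z|%N%:R.
Proof.
by rewrite intr_complex normc_real -intr_norm -abszE.
Qed.

Lemma normc_lin_sqr (R : realType) (tau : R[i]) (p : coprime_pair) :
  normc (lin tau p) ^+ 2 =
    ((val p).1%:~R * complex.Re tau + (val p).2%:~R) ^+ 2 +
    ((val p).1%:~R * complex.Im tau) ^+ 2.
Proof.
rewrite normc_sqr /lin !intr_complex cReD cImD cReM cImM !cReC !cImC.
by rewrite !mul0r !addr0 subr0.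
Qed.

(** From [|tau| >= 1] and [|2 Re tau| <= 1] follows [|c tau + d|^2 >= c^2 - |c d| + d^2], which is
    at least 3/4 of both [c^2] and [d^2]. *)
Lemma lin_lower (R : realType) (tau : R[i]) (p : coprime_pair) : in_dom tau ->
  kap R * (height p)%:R <= normc (lin tau p).
Proof.
move=> [hx hy hr].
have kn0 : 0 <= kap R * (height p)%:R by rewrite mulr_ge0 ?ler0n // ltW // kap_gt0.
rewrite -ler_sqr ?nnegrE ?normc_ge0 // normc_lin_sqr.
have : (height p)%:R ^+ 2 = ((val p).1%:~R : R) ^+ 2 \/ (height p)%:R ^+ 2 = ((val p).2%:~R : R) ^+ 2.
  have e z : (`|z|%N%:R : R) ^+ 2 = z%:~R ^+ 2.
    by rewrite -normc_int intr_complex normc_real real_normK ?num_real.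
  by rewrite /height -!e; case: leqP; [right|left].
rewrite exprMn; set c := (val p).1%:~R; set d := (val p).2%:~R.
have k2 : kap R ^+ 2 <= 3 / 4 by rewrite kap.unlock; lra.
move: hx hy hr; set x := complex.Re tau; set y := complex.Im tau => hx hy hr.
have -> : (c * x + d) ^+ 2 + (c * y) ^+ 2 =
   c ^+ 2 * (x ^+ 2 + y ^+ 2) + 2 * x * (c * d) + d ^+ 2 by ring.
have h1 : c ^+ 2 <= c ^+ 2 * (x ^+ 2 + y ^+ 2) by rewrite ler_peMr ?sqr_ge0.
have h2 : - `|c * d| <= 2 * x * (c * d).
  rewrite lerNl (le_trans (ler_norm _)) // normrN normrM ler_piMl //.
  by rewrite ler_norml; lra.
have : `|c * d| <= c ^+ 2 + d ^+ 2 / 4 /\ `|c * d| <= c ^+ 2 / 4 + d ^+ 2.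
  rewrite normrM -[c ^+ 2]real_normK ?num_real // -[d ^+ 2]real_normK ?num_real //.
  have := sqr_ge0 (`|c| - `|d| / 2); have := sqr_ge0 (`|d| - `|c| / 2).
  by move: `|c| `|d| => u v; split; nra.
case=> h3 h4 [->|->].
  by have := ler_wpM2r (sqr_ge0 c) k2; lra.
by have := ler_wpM2r (sqr_ge0 d) k2; lra.
Qed.

Lemma lin_gt0 (R : realType) (tau : R[i]) (p : coprime_pair) : in_dom tau ->
  0 < normc (lin tau p).
Proof.
move=> /(lin_lower p); apply: lt_le_trans.
by rewrite mulr_gt0 ?kap_gt0 // ltr0n height_gt0.
Qed.

Lemma c_le_height (R : realType) (p : coprime_pair) :
  normc ((val p).1%:~R : R[i]) <= (height p)%:R.
Proof. by rewrite normc_int ler_nat leq_maxl. Qed.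

(** Each derivative in [tau] brings out a factor [c], bounded by the height; [10 + j <= k] leaves
    ten powers for summability. *)
Lemma weight_le (R : realType) (p : coprime_pair) (j k : nat) : (10 + j <= k)%N ->
  (height p)%:R ^+ j * (kap R * (height p)%:R) ^- k <= kap R ^- k * (height p)%:R ^- 10.
Proof.
move=> jk; have n1 : 1 <= (height p)%:R :> R by rewrite ler1n height_gt0.
move: n1; set n : R := (height p)%:R => n1; have n0 : 0 < n by lra.
rewrite exprMn invfM mulrCA ler_pM2l ?invr_gt0 ?exprn_gt0 ?kap_gt0 //.
rewrite ler_pdivrMr ?exprn_gt0 // mulrC ler_pdivlMr ?exprn_gt0 // -exprD.
by rewrite ler_weXn2l // addnC.
Qed.

Lemma inv_pow_le (R : realType) (x y : R) k : 0 < x -> x <= y -> y ^- k <= x ^- k.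
Proof.
move=> x0 xy; have y0 : 0 < y by exact: lt_le_trans xy.
rewrite lef_pV2 ?posrE ?exprn_gt0 //; apply: lerXn2r => //.
  by rewrite nnegrE ltW.
by rewrite nnegrE ltW.
Qed.

(** Up to a constant factor, the term of the [j]-th derivative of the series of weight [k - j]. *)
Definition eis_term (R : realType) (j k : nat) (tau : R[i]) (p : coprime_pair) : R[i] :=
  (val p).1%:~R ^+ j * lin tau p ^- k.

Lemma cterm_le (R : realType) (j k : nat) (tau : R[i]) (p : coprime_pair) :
  in_dom tau -> (10 + j <= k)%N ->
  normc (eis_term j k tau p) <= kap R ^- k * (height p)%:R ^- 10.
Proof.
move=> hd jk; rewrite (le_trans _ (weight_le R p jk)) //.
rewrite normcM normcX normcXV; apply: ler_pM; rewrite ?invr_ge0 ?exprn_ge0 ?normc_ge0 //.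
  by apply: lerXn2r; rewrite ?nnegrE ?normc_ge0 ?c_le_height.
by rewrite inv_pow_le ?lin_lower // mulr_gt0 ?kap_gt0 // ltr0n height_gt0.
Qed.

(** Unlike in [cterm_le], the bound is independent of [k]: for height at least 2 the norm of
    [c tau + d] is at least 1, so the powers beyond the tenth may be dropped, while
    [|c| / |c tau + d|] is at most [1 / kap]. *)
Lemma cterm_tail (R : realType) (j k : nat) (tau : R[i]) (p : coprime_pair) :
  in_dom tau -> (10 <= k)%N -> (2 <= height p)%N ->
  normc (eis_term j (k + j) tau p) <= kap R ^- (10 + j) * (height p)%:R ^- 10.
Proof.
move=> hd k10 h2; have n2 : 2 <= (height p)%:R :> R by rewrite ler_nat.
have k0 := kap_gt0 R; have l0 := lin_gt0 p hd; have ll := lin_lower p hd.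
have kn1 : 1 <= kap R * (height p)%:R by rewrite kap.unlock; lra.
have -> : normc (eis_term j (k + j) tau p) =
    normc (lin tau p) ^- k * (normc ((val p).1%:~R : R[i]) / normc (lin tau p)) ^+ j.
  by rewrite normcM normcX normcXV exprMn exprVn exprD invfM mulrCA.
have -> : kap R ^- (10 + j) * (height p)%:R ^- 10 =
    (kap R * (height p)%:R) ^- 10 * (kap R)^-1 ^+ j.
  by move: (kap R) => u; rewrite exprD exprMn exprVn !invfM mulrAC.
apply: ler_pM; rewrite ?exprn_ge0 ?invr_ge0 ?exprn_ge0 ?divr_ge0 ?normc_ge0 //.
  rewrite (@le_trans _ _ ((kap R * (height p)%:R) ^- k)) ?inv_pow_le ?mulr_gt0 //; try lra.
  rewrite lef_pV2 ?posrE ?exprn_gt0 ?mulr_gt0 //; try lra.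
  by rewrite ler_weXn2l.
apply: lerXn2r; rewrite ?nnegrE ?divr_ge0 ?invr_ge0 ?normc_ge0 ?(ltW k0) //.
rewrite ler_pdivrMr // ler_pdivlMl //.
rewrite (le_trans _ ll) //; apply: ler_wpM2l; [exact: ltW | exact: c_le_height].
Qed.

Lemma abs_bounded_height (R : realType) (f : coprime_pair -> R[i]) (A : R) : 0 <= A ->
  (forall p, normc (f p) <= A * (height p)%:R ^- 10) -> abs_bounded f (A * 9).
Proof.
move=> A0 fA B; rewrite (@le_trans _ _ (\sum_(p <- B) (A * (height p)%:R ^- 10))) //.
  by apply: ler_sum => p _; exact: fA.
by rewrite -mulr_sumr ler_wpM2l ?total_sum.
Qed.

Lemma tail_height (R : realType) (f : coprime_pair -> R[i]) (A : R) l : 0 <= A ->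
  has_sum f l ->
  (forall p, (2 <= height p)%N -> normc (f p) <= A * (height p)%:R ^- 10) ->
  normc (l - \sum_(p <- small_pairs) f p) <= A / 100.
Proof.
move=> A0 fl fA; rewrite -(small_fsetE R); apply: (has_sum_le fl) => B hB.
have B2 p : p \in B -> (2 <= height p)%N.
  by move=> pB; apply: notin_small; apply: contraL pB => pS; move/fdisjointP: hB; apply.
rewrite (@le_trans _ _ (\sum_(p <- B) (A * (height p)%:R ^- 10))) //.
  by rewrite big_seq [leRHS]big_seq; apply: ler_sum => p /B2; exact: fA.
by rewrite -mulr_sumr ler_wpM2l ?tail_sum.
Qed.

Lemma kapV_ge0 (R : realType) k : 0 <= kap R ^- k.
Proof. by rewrite invr_ge0 exprn_ge0 // ltW ?kap_gt0. Qed.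

Lemma cterm_sum (R : realType) (j k : nat) (tau : R[i]) :
  in_dom tau -> (10 + j <= k)%N -> exists l, has_sum (eis_term j k tau) l.
Proof.
move=> hd jk; apply: has_sum_ex; apply: (abs_bounded_height (kapV_ge0 R k)) => p.
exact: cterm_le.
Qed.

Lemma eis_sum (R : realType) (k : nat) (tau : R[i]) :
  in_dom tau -> (10 <= k)%N ->
  has_sum (fun p => lin tau p ^- k) (2 * eisenstein k tau).
Proof.
move=> hd k10; have [|l hl] := @cterm_sum R 0 k tau hd; first by rewrite addn0.
have hl' : has_sum (fun p => lin tau p ^- k) l.
  by apply: has_sum_ext hl => p; rewrite /eis_term expr0 mul1r.
by rewrite /eisenstein (has_sum_sum hl') mulVKf ?pnatr_eq0.
Qed.

Lemma even_powN (V : fieldType) (k : nat) (z : V) : ~~ odd k -> (- z) ^- k = z ^- k.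
Proof. by move=> hk; rewrite exprNn -signr_odd (negbTE hk) expr0 mul1r. Qed.

(* Half of the sum of the eight terms with [|c|, |d| <= 1], for even [k]. *)
Definition main_terms (R : realType) (k : nat) (t : R[i]) : R[i] :=
  1 + t ^- k + (t + 1) ^- k + (t - 1) ^- k.

Lemma small_sum_lin (R : realType) (k : nat) (tau : R[i]) : ~~ odd k ->
  \sum_(p <- small_pairs) lin tau p ^- k =
  2 * main_terms k tau.
Proof.
move=> hk; rewrite /main_terms !big_cons big_nil /lin /= !mul0r !add0r !addr0.
rewrite !rmorphN1 !rmorph1 !mul1r !mulN1r.
rewrite (even_powN 1) // (even_powN tau) // -opprD (even_powN (tau + 1)) //.
rewrite [- tau + 1]addrC -(opprB tau) (even_powN (tau - 1)) // expr1n invr1.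
by move: (tau ^- k) ((tau + 1) ^- k) ((tau - 1) ^- k) => a b c; ring.
Qed.

(** The constant bounds half of [kap^-10 / 100], as the tail estimate concerns twice the series. *)
Lemma eis_approx (R : realType) (k : nat) (tau : R[i]) :
  in_dom tau -> (10 <= k)%N -> ~~ odd k ->
  normc (eisenstein k tau - main_terms k tau) <= 22 / 1000.
Proof.
move=> hd k10 hk; have := eis_sum hd k10 => hs.
have := @tail_height R _ (kap R ^- 10) _ (kapV_ge0 R 10) hs.
rewrite small_sum_lin // -mulrBr normcM (normc_nat R 2).
have h p : (2 <= height p)%N -> normc (lin tau p ^- k) <= kap R ^- 10 / (height p)%:R ^+ 10.
  move=> p2; have := @cterm_tail R 0 k tau p hd k10 p2.
  by rewrite /eis_term expr0 mul1r !addn0.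
move=> /(_ h); have : kap R ^- 10 / 100 <= 44 / 1000 by rewrite kap.unlock; lra.
lra.
Qed.

(** * Taylor estimates for negative powers *)

Section power_taylor.
Context (R : realType) (x y : R[i]) (m : R).
Hypotheses (m0 : 0 < m) (mx : m <= normc x) (my : m <= normc y).

Let x0 : x != 0. Proof. by rewrite -normc_gt0; exact: lt_le_trans mx. Qed.
Let y0 : y != 0. Proof. by rewrite -normc_gt0; exact: lt_le_trans my. Qed.
Let nx : normc x^-1 <= m^-1.
Proof. by rewrite normcV lef_pV2 ?posrE // (lt_le_trans m0). Qed.
Let nyX n : normc (y ^- n) <= m ^- n.
Proof. by rewrite normcXV inv_pow_le. Qed.

(** Here and in the next two lemmas, induction on [n] through an exact identity: only lower bounds
    for the two norms enter, not the segment between the points, and the binomial constants add up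
    by Pascal's rule. *)
Lemma inv_pow_taylor1 n :
  normc (x ^- n - y ^- n) <= n%:R * normc (x - y) * m ^- n.+1.
Proof.
elim: n => [|n IH]; first by rewrite !expr0 subrr normc0 !mul0r.
have -> : x ^- n.+1 - y ^- n.+1 =
    x^-1 * ((x ^- n - y ^- n) - (x - y) * y ^- n.+1).
  by rewrite !exprS; field; rewrite x0 y0 ?expf_neq0.
have em : m ^- n.+2 = m ^- n.+1 * m^-1 by rewrite exprSr invfM.
rewrite normcM em [leLHS]mulrC [leRHS]mulrA.
apply: ler_pM; rewrite ?normc_ge0 //.
rewrite (le_trans (le_normcD _ _)) // normcN normcM.
have := ler_wpM2l (normc_ge0 (x - y)) (nyX n.+1).
have -> : n.+1%:R = n%:R + 1 :> R by rewrite natr1.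
by move: IH; set a := m ^- _; set b := n%:R; lra.
Qed.

Lemma inv_pow_taylor2 n :
  normc (x ^- n - y ^- n + n%:R * (x - y) * y ^- n.+1) <=
    'C(n.+1, 2)%:R * normc (x - y) ^+ 2 * m ^- n.+2.
Proof.
elim: n => [|n IH].
  by rewrite !expr0 subrr !mul0r addr0 normc0.
have -> : x ^- n.+1 - y ^- n.+1 + n.+1%:R * (x - y) * y ^- n.+2 =
    x^-1 * ((x ^- n - y ^- n + n%:R * (x - y) * y ^- n.+1)
            + n.+1%:R * ((x - y) ^+ 2 * y ^- n.+2)).
  by rewrite -natr1 !exprS; field; rewrite x0 y0 ?expf_neq0.
have em : m ^- n.+3 = m ^- n.+2 * m^-1 by rewrite exprSr invfM.
rewrite normcM em [leLHS]mulrC [leRHS]mulrA.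
apply: ler_pM; rewrite ?normc_ge0 //.
rewrite (le_trans (le_normcD _ _)) // normcM normc_nat normcM normcX.
have := ler_wpM2l (sqr_ge0 (normc (x - y))) (nyX n.+2).
move=> /(ler_wpM2l (ler0n R n.+1)).
have -> : 'C(n.+2, 2)%:R = 'C(n.+1, 2)%:R + n.+1%:R :> R by rewrite binS bin1 natrD.
move: IH; set a := m ^- _; set b := n.+1%:R; lra.
Qed.

Lemma inv_pow_taylor3 n :
  normc (x ^- n - y ^- n + n%:R * (x - y) * y ^- n.+1
         - 'C(n.+1, 2)%:R * (x - y) ^+ 2 * y ^- n.+2) <=
    'C(n.+2, 3)%:R * normc (x - y) ^+ 3 * m ^- n.+3.
Proof.
elim: n => [|n IH].
  by rewrite !expr0 subrr !mul0r ?(addr0, subr0, subrr) normc0.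
have -> : x ^- n.+1 - y ^- n.+1 + n.+1%:R * (x - y) * y ^- n.+2
         - 'C(n.+2, 2)%:R * (x - y) ^+ 2 * y ^- n.+3 =
    x^-1 * ((x ^- n - y ^- n + n%:R * (x - y) * y ^- n.+1
         - 'C(n.+1, 2)%:R * (x - y) ^+ 2 * y ^- n.+2)
            - 'C(n.+2, 2)%:R * ((x - y) ^+ 3 * y ^- n.+3)).
  by rewrite binS bin1 natrD -!natr1 !exprS; field; rewrite x0 y0 ?expf_neq0.
have em : m ^- n.+4 = m ^- n.+3 * m^-1 by rewrite exprSr invfM.
rewrite normcM em [leLHS]mulrC [leRHS]mulrA.
apply: ler_pM; rewrite ?normc_ge0 //.
rewrite (le_trans (le_normcD _ _)) // normcN normcM normc_nat normcM normcX.
have := ler_wpM2l (exprn_ge0 3 (normc_ge0 (x - y))) (nyX n.+3).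
move=> /(ler_wpM2l (ler0n R 'C(n.+2, 2))).
have -> : 'C(n.+3, 3)%:R = 'C(n.+2, 3)%:R + 'C(n.+2, 2)%:R :> R by rewrite binS natrD.
  move: IH; set a := m ^- _.
set b := 'C(n.+2, 2)%:R; set c := 'C(n.+2, 3)%:R; lra.
Qed.

End power_taylor.

(** * Symmetries of the Eisenstein series *)

Definition cmap (g : int * int -> int * int)
  (hg : forall p, coprimez p.1 p.2 -> coprimez (g p).1 (g p).2)
  (p : coprime_pair) : coprime_pair :=
  exist (fun p => coprimez p.1 p.2) (g (val p)) (hg _ (valP p)).

Lemma cmapK g hg g' hg' : cancel g g' -> cancel (@cmap g hg) (@cmap g' hg').
Proof. by move=> gK p; apply: val_inj; rewrite /= gK. Qed.

Lemma coprime_neg p : coprimez p.1 p.2 -> coprimez (- p.1, p.2).1 (- p.1, p.2).2.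
Proof. by rewrite /= /coprimez gcdNz. Qed.

Lemma coprime_swap p : coprimez p.1 p.2 -> coprimez (p.2, p.1).1 (p.2, p.1).2.
Proof. by rewrite /= coprimez_sym. Qed.

Lemma coprime_refl_half p : coprimez p.1 p.2 ->
  coprimez (- p.1, p.2 - p.1).1 (- p.1, p.2 - p.1).2.
Proof.
rewrite /= /coprimez gcdNz; have -> : p.2 - p.1 = (-1) * p.1 + p.2 by ring.
by rewrite gcdzMDl.
Qed.

(** The action on pairs of the order-three stabilizer of [rho]: by [lin_rot] it multiplies
    [c rho + d] by [rho]. *)
Lemma coprime_rot p : coprimez p.1 p.2 ->
  coprimez (p.2 - p.1, - p.1).1 (p.2 - p.1, - p.1).2.
Proof.
rewrite /= /coprimez gcdzN [gcdz (_ - _) _]gcdzC; have -> : p.2 - p.1 = (-1) * p.1 + p.2 by ring.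
by rewrite gcdzMDl.
Qed.

Lemma coprime_rot' p : coprimez p.1 p.2 ->
  coprimez (- p.2, p.1 - p.2).1 (- p.2, p.1 - p.2).2.
Proof.
rewrite /= /coprimez gcdNz; have -> : p.1 - p.2 = (-1) * p.2 + p.1 by ring.
by rewrite gcdzMDl gcdzC.
Qed.

Lemma conjc_int (R : realType) (z : int) : conjc (z%:~R : R[i]) = z%:~R.
Proof. by rewrite intr_complex conjc_real. Qed.

Lemma conjc_two (R : realType) (z : R[i]) : conjc (2 * z) = 2 * conjc z.
Proof. by rewrite rmorphM (rmorph_nat (@conjc R) 2). Qed.

Lemma conjc_lin (R : realType) (tau : R[i]) p :
  conjc (lin tau p) = (val p).1%:~R * conjc tau + (val p).2%:~R.
Proof. by rewrite /lin rmorphD rmorphM /= !conjc_int. Qed.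

Lemma in_dom_reflect (R : realType) (tau : R[i]) : in_dom tau -> in_dom (- conjc tau).
Proof.
move=> [/andP[h1 h2] h3 h4]; split; rewrite ?cReN ?cReJ ?cImN ?cImJ ?opprK ?sqrrN //.
by rewrite lerN2 h2 lerNl h1.
Qed.

Lemma eis_reflect (R : realType) (k : nat) (tau : R[i]) : in_dom tau -> (10 <= k)%N ->
  eisenstein k (- conjc tau) = conjc (eisenstein k tau).
Proof.
move=> hd k10; apply: (@mulfI _ 2); first by rewrite pnatr_eq0.
have hs := eis_sum (in_dom_reflect hd) k10.
apply: (has_sum_unique hs).
have gK : cancel (fun p : int * int => (- p.1, p.2)) (fun p : int * int => (- p.1, p.2)).
  by case=> c d /=; rewrite opprK.
have hr := has_sum_reindex (cmapK coprime_neg coprime_neg gK)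
  (cmapK coprime_neg coprime_neg gK) (has_sum_conj (eis_sum hd k10)).
rewrite conjc_two in hr; apply: has_sum_ext hr => p.
rewrite fmorphV rmorphXn /= conjc_lin /=; congr ((_ ^+ _)^-1).
by rewrite /lin rmorphN /= mulNr mulrN.
Qed.

(** Since [conjc tau = tau^-1], exchanging [c] and [d] turns the conjugate linear form into [tau^-1]
    times the original one. *)
Lemma eis_circle (R : realType) (k : nat) (tau : R[i]) : in_dom tau -> (10 <= k)%N ->
  conjc tau * tau = 1 -> conjc (eisenstein k tau) = tau ^+ k * eisenstein k tau.
Proof.
move=> hd k10 tE; apply: (@mulfI _ 2); first by rewrite pnatr_eq0.
have gK : cancel (fun p : int * int => (p.2, p.1)) (fun p : int * int => (p.2, p.1)).
  by case.
have hr := has_sum_reindex (cmapK coprime_swap coprime_swap gK)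
  (cmapK coprime_swap coprime_swap gK) (has_sum_conj (eis_sum hd k10)).
have hs := has_sum_scale (tau ^+ k) (eis_sum hd k10).
rewrite conjc_two in hr; apply: (has_sum_unique hr).
rewrite mulrCA; apply: has_sum_ext hs => p.
rewrite fmorphV rmorphXn /= conjc_lin /=.
have t0 : tau != 0 by apply: contra_eq_neq tE => ->; rewrite mulr0 eq_sym oner_neq0.
have -> : (val p).2%:~R * conjc tau + (val p).1%:~R = tau^-1 * lin tau p.
  have -> : conjc tau = tau^-1 by apply: (mulIf t0); rewrite tE mulVf.
  by rewrite /lin; field.
by rewrite exprMn exprVn invfM invrK.
Qed.

Lemma eis_line (R : realType) (k : nat) (tau : R[i]) : in_dom tau -> (10 <= k)%N ->
  conjc tau = -1 - tau -> complex.Im (eisenstein k tau) = 0.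
Proof.
move=> hd k10 tE.
suff : conjc (eisenstein k tau) = eisenstein k tau.
  by move/(congr1 (@complex.Im R)); rewrite cImJ; lra.
apply: (@mulfI _ 2); first by rewrite pnatr_eq0.
have gK : cancel (fun p : int * int => (- p.1, p.2 - p.1))
                 (fun p : int * int => (- p.1, p.2 - p.1)).
  by case=> c d /=; rewrite opprK subrK.
have hr := has_sum_reindex (cmapK coprime_refl_half coprime_refl_half gK)
  (cmapK coprime_refl_half coprime_refl_half gK) (has_sum_conj (eis_sum hd k10)).
rewrite conjc_two in hr; apply: (has_sum_unique hr).
apply: has_sum_ext (eis_sum hd k10) => p.
rewrite fmorphV rmorphXn /= conjc_lin /= tE; congr ((_ ^+ _)^-1).
by rewrite /lin rmorphN rmorphB /=; ring.
Qed.

Lemma has_sum_rot0 (R : realType) (f : coprime_pair -> R[i]) l w :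
  has_sum f l -> (forall p, f (cmap coprime_rot p) = w * f p) -> w != 1 -> l = 0.
Proof.
move=> fl fw w1.
have gK : cancel (fun p : int * int => (p.2 - p.1, - p.1))
                 (fun p : int * int => (- p.2, p.1 - p.2)).
  by case=> c d /=; rewrite opprK subrK.
have gK' : cancel (fun p : int * int => (- p.2, p.1 - p.2))
                  (fun p : int * int => (p.2 - p.1, - p.1)).
  by case=> c d /=; rewrite opprK subrK.
have hr := has_sum_reindex (cmapK coprime_rot coprime_rot' gK)
  (cmapK coprime_rot' coprime_rot gK') fl.
have := has_sum_unique (has_sum_ext fw hr) (has_sum_scale w fl) => e.
have /eqP : (1 - w) * l = 0 by rewrite mulrBl mul1r -e subrr.
by rewrite mulf_eq0 subr_eq0 eq_sym (negbTE w1) => /eqP.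
Qed.

(** The constant depends on [k], which is harmless: it serves only for continuity and for limits at
    fixed weights. *)
Lemma eis_lipschitz (R : realType) (k : nat) : (10 <= k)%N ->
  exists2 L : R, 0 <= L & forall t t' : R[i], in_dom t -> in_dom t' ->
    normc (eisenstein k t - eisenstein k t') <= L * normc (t - t').
Proof.
move=> k10; pose A (x : R) := k%:R * kap R ^- k.+1 * x.
have A0 x : 0 <= x -> 0 <= A x by move=> x0; rewrite !mulr_ge0 ?kapV_ge0.
exists (A 9) => [|t t' dt dt']; first exact: A0.
have hs := has_sum_add (eis_sum dt k10) (has_sum_scale (-1) (eis_sum dt' k10)).
have hb : forall p, normc (lin t p ^- k + -1 * lin t' p ^- k) <=
   A (normc (t - t')) * (height p)%:R ^- 10.
  move=> p; rewrite mulN1r.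
  have m0 : 0 < kap R * (height p)%:R by rewrite mulr_gt0 ?kap_gt0 // ltr0n height_gt0.
  rewrite (le_trans (inv_pow_taylor1 m0 (lin_lower p dt) (lin_lower p dt') k)) //.
  have -> : lin t p - lin t' p = (val p).1%:~R * (t - t') by rewrite /lin; ring.
  rewrite normcM /A.
  have := @weight_le R p 1 k.+1; rewrite addn1 ltnS expr1 => /(_ k10) hw.
  have h1 : normc ((val p).1%:~R : R[i]) * (kap R * (height p)%:R) ^- k.+1 <=
      kap R ^- k.+1 * (height p)%:R ^- 10.
    by rewrite (le_trans _ hw) // ler_wpM2r ?c_le_height // invr_ge0 exprn_ge0 // ltW.
  have h2 : 0 <= k%:R * normc (t - t') by rewrite mulr_ge0 ?normc_ge0.
  by have := ler_wpM2l h2 h1; set a := _ ^- k.+1; set b := _ ^- k.+1; set c := _ ^- 10; lra.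
have := has_sum_norm hs (abs_bounded_height (A0 _ (normc_ge0 _)) hb).
rewrite mulN1r -mulrBr normcM (normc_nat R 2) /A.
by set c := k%:R * _; move: (A0 _ (normc_ge0 (t - t'))); rewrite /A -/c; nra.
Qed.

Lemma eis_bounded (R : realType) (k : nat) : (10 <= k)%N ->
  exists2 L : R, 0 <= L & forall t : R[i], in_dom t -> normc (eisenstein k t) <= L.
Proof.
move=> k10; exists (kap R ^- k * 9) => [|t dt]; first by rewrite mulr_ge0 ?kapV_ge0.
have hb p : normc (lin t p ^- k) <= kap R ^- k * (height p)%:R ^- 10.
  by have := @cterm_le R 0 k t p dt; rewrite /eis_term expr0 mul1r addn0; apply.
have := has_sum_norm (eis_sum dt k10) (abs_bounded_height (kapV_ge0 R k) hb).
rewrite normcM (normc_nat R 2); have := normc_ge0 (eisenstein k t); lra.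
Qed.

(** * Second-order expansions and the minimum principle *)

(* Second-order Taylor expansions relative to the closed domain [in_dom], so that
   they make sense at its boundary points too. *)
Definition jet (R : realType) (f : R[i] -> R[i]) (z : R[i]) : Prop :=
  exists (a b : R[i]) (C d : R), [/\ 0 <= C, 0 < d, d <= 1 &
   forall h, normc h <= d -> in_dom (z + h) ->
     normc (f (z + h) - (f z + a * h + b * h ^+ 2)) <= C * normc h ^+ 3].

Lemma eis_jet (R : realType) (k : nat) (z : R[i]) : (10 <= k)%N -> in_dom z ->
  jet (eisenstein k) z.
Proof.
move=> k10 hz.
have [|S1 hS1] := @cterm_sum R 1 k.+1 z hz; first by rewrite addn1.
have [|S2 hS2] := @cterm_sum R 2 k.+2 z hz; first by rewrite addn2 !ltnS.
pose A (x : R) := 'C(k.+2, 3)%:R * kap R ^- k.+3 * x.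
have A0 x : 0 <= x -> 0 <= A x by move=> x0; rewrite !mulr_ge0 ?kapV_ge0.
(* The termwise Taylor coefficients, halved because the series sums to twice [eisenstein]. *)
exists (- (2^-1 * k%:R * S1)), (2^-1 * 'C(k.+1, 2)%:R * S2), (A 9), 1.
split => //; first exact: A0.
move=> h _ hzh.
have hs := has_sum_add (has_sum_add (has_sum_add (eis_sum hzh k10)
  (has_sum_scale (-1) (eis_sum hz k10))) (has_sum_scale (k%:R * h) hS1))
  (has_sum_scale (- ('C(k.+1, 2)%:R * h ^+ 2)) hS2).
have hb p : normc (lin (z + h) p ^- k + -1 * lin z p ^- k +
   k%:R * h * eis_term 1 k.+1 z p + - ('C(k.+1, 2)%:R * h ^+ 2) * eis_term 2 k.+2 z p) <=
   A (normc h ^+ 3) * (height p)%:R ^- 10.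
  have m0 : 0 < kap R * (height p)%:R by rewrite mulr_gt0 ?kap_gt0 // ltr0n height_gt0.
  have := inv_pow_taylor3 m0 (lin_lower p hzh) (lin_lower p hz) k.
  have -> : lin (z + h) p - lin z p = (val p).1%:~R * h by rewrite /lin; ring.
  have -> : lin (z + h) p ^- k + -1 * lin z p ^- k + k%:R * h * eis_term 1 k.+1 z p +
      - ('C(k.+1, 2)%:R * h ^+ 2) * eis_term 2 k.+2 z p =
      lin (z + h) p ^- k - lin z p ^- k + k%:R * ((val p).1%:~R * h) * lin z p ^- k.+1 -
      'C(k.+1, 2)%:R * ((val p).1%:~R * h) ^+ 2 * lin z p ^- k.+2.
    rewrite /eis_term; move: (lin _ _ ^- k) (lin _ _ ^- k) => u v.
    by move: (lin _ _ ^- k.+1) (lin _ _ ^- k.+2) => u1 v1; ring.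
  move=> h1; apply: (le_trans h1); rewrite normcM /A.
  have := @weight_le R p 3 k.+3; rewrite addn3 !ltnS => /(_ k10) hw.
  have h2 : normc ((val p).1%:~R : R[i]) ^+ 3 * (kap R * (height p)%:R) ^- k.+3 <=
      kap R ^- k.+3 * (height p)%:R ^- 10.
    rewrite (le_trans _ hw) // ler_wpM2r ?invr_ge0 ?exprn_ge0 ?(ltW m0) //.
    by apply: lerXn2r; rewrite ?nnegrE ?normc_ge0 ?c_le_height.
  have h3 : 0 <= 'C(k.+2, 3)%:R * normc h ^+ 3 by rewrite mulr_ge0 ?exprn_ge0 ?normc_ge0.
  have := ler_wpM2l h3 h2; rewrite [(normc _ * normc h) ^+ 3]exprMn; set a := _ ^- k.+3; set b := _ ^- k.+3.
  by set c := _ ^- 10; set e := normc h ^+ 3; set n := normc _ ^+ 3; lra.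
have := has_sum_norm hs (abs_bounded_height (A0 _ (exprn_ge0 3 (normc_ge0 h))) hb).
have -> : 2 * eisenstein k (z + h) + -1 * (2 * eisenstein k z) + k%:R * h * S1 +
    - ('C(k.+1, 2)%:R * h ^+ 2) * S2 =
  2 * (eisenstein k (z + h) - (eisenstein k z + - (2^-1 * k%:R * S1) * h +
     2^-1 * 'C(k.+1, 2)%:R * S2 * h ^+ 2)).
  move: (eisenstein k (z + h)) (eisenstein k z) ('C(k.+1, 2)%:R : R[i]) => e1 e2 c2.
  by move: (k%:R : R[i]) => k1; field.
rewrite normcM (normc_nat R 2) /A.
set c := _ * kap R ^- _; have : 0 <= c by rewrite mulr_ge0 ?kapV_ge0.
have := exprn_ge0 3 (normc_ge0 h); set e := normc h ^+ 3; set n := normc _.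
by move=> e0 c0 h1; have := mulr_ge0 c0 e0; lra.
Qed.

Lemma normc_poly2 (R : realType) (a0 a1 a2 h : R[i]) : normc h <= 1 ->
  normc (a0 + a1 * h + a2 * h ^+ 2) <= normc a0 + normc a1 + normc a2.
Proof.
move=> h1; have h0 := normc_ge0 h.
rewrite (le_trans (le_normcD _ _)) // normcM normcX lerD //.
  rewrite (le_trans (le_normcD _ _)) // normcM lerD //.
  by rewrite ler_piMr ?normc_ge0.
by rewrite ler_piMr ?normc_ge0 // exprn_ile1.
Qed.

Lemma jet_ext (R : realType) (f g : R[i] -> R[i]) z :
  (forall w, in_dom w -> f w = g w) -> in_dom z -> jet f z -> jet g z.
Proof.
move=> fg hz [a [b [C [d [C0 d0 d1 H]]]]]; exists a, b, C, d; split => // h hd hzh.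
by rewrite -!fg //; exact: H.
Qed.

Lemma jet_cst (R : realType) (c : R[i]) z : jet (fun _ => c) z.
Proof.
exists 0, 0, 0, 1; split => // h _ _.
by rewrite !mul0r !addr0 subrr normc0.
Qed.

Lemma jet_id (R : realType) (z : R[i]) : jet (fun w => w) z.
Proof.
exists 1, 0, 0, 1; split => // h _ _.
by rewrite mul1r !mul0r addr0 subrr normc0.
Qed.

Lemma jet_add (R : realType) (f g : R[i] -> R[i]) z :
  jet f z -> jet g z -> jet (fun w => f w + g w) z.
Proof.
move=> [a [b [C [d [C0 d0 d1 H]]]]] [a' [b' [C' [d' [C'0 d'0 d'1 H']]]]].
exists (a + a'), (b + b'), (C + C'), (Order.min d d'); split; rewrite ?addr_ge0 //.
- by rewrite lt_min d0.
- by rewrite ge_min d1.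
move=> h; rewrite le_min => /andP[hd hd'] hzh.
have -> : f (z + h) + g (z + h) - (f z + g z + (a + a') * h + (b + b') * h ^+ 2) =
  (f (z + h) - (f z + a * h + b * h ^+ 2)) + (g (z + h) - (g z + a' * h + b' * h ^+ 2)).
  by ring.
by rewrite [leRHS]mulrDl (le_trans (le_normcD _ _)) // lerD ?H ?H'.
Qed.

Lemma jet_mul (R : realType) (f g : R[i] -> R[i]) z :
  jet f z -> jet g z -> jet (fun w => f w * g w) z.
Proof.
move=> [a [b [C [d [C0 d0 d1 H]]]]] [a' [b' [C' [d' [C'0 d'0 d'1 H']]]]].
pose P := normc (f z) + normc a + normc b.
pose Q := normc (g z) + normc a' + normc b' + C'.
have P0 : 0 <= P by rewrite !addr_ge0 ?normc_ge0.
have Q0 : 0 <= Q by rewrite !addr_ge0 ?normc_ge0.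
pose S := normc (a * b' + b * a') + normc (b * b') + normc (0 : R[i]).
have S0 : 0 <= S by rewrite !addr_ge0 ?normc_ge0.
exists (f z * a' + a * g z), (f z * b' + a * a' + b * g z), (S + C * Q + P * C'),
  (Order.min d d'); split.
- by apply: addr_ge0; [apply: addr_ge0 => //|]; apply: mulr_ge0.
- by rewrite lt_min d0.
- by rewrite ge_min d1.
move=> h; rewrite le_min => /andP[hd hd'] hzh.
have h0 := normc_ge0 h; have h1 : normc h <= 1 by exact: le_trans hd d1.
have hr := H h hd hzh; have hs := H' h hd' hzh.
have -> : f (z + h) * g (z + h) - (f z * g z + (f z * a' + a * g z) * h +
    (f z * b' + a * a' + b * g z) * h ^+ 2) =
  (a * b' + b * a' + b * b' * h + 0 * h ^+ 2) * h ^+ 3 +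
  (f (z + h) - (f z + a * h + b * h ^+ 2)) * g (z + h) +
  (f z + a * h + b * h ^+ 2) * (g (z + h) - (g z + a' * h + b' * h ^+ 2)).
  by move: (f (z + h)) (g (z + h)) (f z) (g z) => *; ring.
have gQ : normc (g (z + h)) <= Q.
  rewrite -[g (z + h)](subrK (g z + a' * h + b' * h ^+ 2)) addrC.
  rewrite (le_trans (le_normcD _ _)) // lerD ?normc_poly2 // (le_trans hs) //.
  by rewrite ler_piMr // exprn_ile1.
have h30 : 0 <= normc h ^+ 3 by exact: exprn_ge0.
rewrite [leRHS]mulrDl (le_trans (le_normcD _ _)) // lerD //; last first.
  rewrite normcM -mulrA ler_pM ?normc_ge0 //; exact: normc_poly2.
rewrite [leRHS]mulrDl (le_trans (le_normcD _ _)) // lerD //.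
  by rewrite normcM normcX ler_wpM2r // normc_poly2.
by rewrite normcM mulrAC ler_pM ?normc_ge0.
Qed.

Lemma jet_exp (R : realType) (f : R[i] -> R[i]) z n :
  jet f z -> jet (fun w => f w ^+ n) z.
Proof.
move=> jf; elim: n => [|n IH]; first exact: jet_cst.
by under [X in jet X]funext => w do rewrite exprS; exact: jet_mul.
Qed.

Lemma jet_cont (R : realType) (f : R[i] -> R[i]) z : jet f z ->
  exists (A d : R), [/\ 0 < A, 0 < d, d <= 1 &
   forall h, normc h <= d -> in_dom (z + h) ->
     normc (f (z + h) - f z) <= A * normc h].
Proof.
move=> [a [b [C [d [C0 d0 d1 H]]]]].
exists (normc a + normc b + normc (0 : R[i]) + C + 1), d; split => //.
  by rewrite ltr_wpDl // !addr_ge0 ?normc_ge0.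
move=> h hd hzh; have h0 := normc_ge0 h.
have h1 : normc h <= 1 by exact: le_trans hd d1.
have -> : f (z + h) - f z = (a + b * h + 0 * h ^+ 2) * h +
   (f (z + h) - (f z + a * h + b * h ^+ 2)) by ring.
rewrite (le_trans (le_normcD _ _)) // normcM.
have p2 := normc_poly2 a b 0 h1.
have h3 : C * normc h ^+ 3 <= C * normc h.
  by rewrite ler_wpM2l // ler_iXnr // h0.
have := ler_wpM2r h0 p2; have := H h hd hzh.
by move: h3; set n3 := normc h ^+ 3; set u := _ + _ + normc 0; lra.
Qed.

Lemma jet_inv (R : realType) (f : R[i] -> R[i]) z :
  f z != 0 -> jet f z -> jet (fun w => (f w)^-1) z.
Proof.
move=> fz jf; have [A [e [A0 e0 e1 HA]]] := jet_cont jf.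
move: jf => [a [b [C [d [C0 d0 d1 H]]]]].
have N0 : 0 < normc (f z) by rewrite normc_gt0.
have A20 : 0 < 2 * A by rewrite mulr_gt0.
pose p0 := (f z)^-1; pose p1 := - a / f z ^+ 2.
pose p2 := a ^+ 2 / f z ^+ 3 - b / f z ^+ 2.
pose S := normc (a * p2 + b * p1) + normc (b * p2) + normc (0 : R[i]).
have S0 : 0 <= S by rewrite !addr_ge0 ?normc_ge0.
pose T := normc p0 + normc p1 + normc p2.
have T0 : 0 <= T by rewrite !addr_ge0 ?normc_ge0.
(* [p1] and [p2] are the coefficients of the inverse power series. The last radius keeps
   [|f (z + h)|] above half of [|f z|]. *)
exists p1, p2, ((S + C * T) * (2 / normc (f z))),
  (Order.min d (Order.min e (normc (f z) / (2 * A)))); split.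
- apply: mulr_ge0; last by rewrite divr_ge0 // ltW.
  by apply: addr_ge0 => //; apply: mulr_ge0.
- by rewrite !lt_min d0 e0 divr_gt0.
- by rewrite ge_min d1.
move=> h; rewrite !le_min => /and3P[hd he hN] hzh.
have h0 := normc_ge0 h; have h1 : normc h <= 1 by exact: le_trans hd d1.
have fh : normc (f z) / 2 <= normc (f (z + h)).
  have := HA h he hzh; move: hN; rewrite ler_pdivlMr // => hN.
  have := ler_normcB (f z) (f z - f (z + h)).
  have -> : f z - (f z - f (z + h)) = f (z + h) by ring.
  rewrite (normcB (f z)); nra.
have fh0 : f (z + h) != 0.
  by rewrite -normc_gt0 (lt_le_trans _ fh) // divr_gt0.
have -> : (f (z + h))^-1 - ((f z)^-1 + p1 * h + p2 * h ^+ 2) =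
  - ((a * p2 + b * p1 + b * p2 * h + 0 * h ^+ 2) * h ^+ 3 +
     (f (z + h) - (f z + a * h + b * h ^+ 2)) * (p0 + p1 * h + p2 * h ^+ 2)) *
  (f (z + h))^-1.
  rewrite /p0 /p1 /p2; move: (f (z + h)) (f z) fz fh0 => u v *; field.
  by apply/andP; split.
rewrite normcM normcN normcV [leRHS]mulrAC.
have h30 : 0 <= normc h ^+ 3 by exact: exprn_ge0.
apply: ler_pM; rewrite ?invr_ge0 ?normc_ge0 //; last first.
  by rewrite -(invf_div (normc (f z)) 2) lef_pV2 ?posrE ?divr_gt0 // normc_gt0.
rewrite [leRHS]mulrDl (le_trans (le_normcD _ _)) // lerD //.
  by rewrite normcM normcX ler_wpM2r // normc_poly2.
rewrite normcM [leRHS]mulrAC; apply: ler_pM; rewrite ?normc_ge0 ?H //.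
exact: normc_poly2.
Qed.

Definition pt (R : realType) (p : R * R) : R[i] := p.1 +i* p.2.

Lemma jet_continuous (R : realType) (f : R[i] -> R[i]) (c : R) (K : set (R * R)) :
  (forall p, K p -> in_dom (pt p)) -> (forall p, K p -> jet f (pt p)) ->
  {within K, continuous (fun p : R * R =>
     complex.Re (f (pt p)) - c * (p.1 ^+ 2 + p.2 ^+ 2))}.
Proof.
move=> hK hf; apply/subspace_continuousP => p Kp.
have cf : (fun q : R * R => complex.Re (f (pt q))) @ within K (nbhs p) -->
    complex.Re (f (pt p)).
  have [A [d [A0 d0 d1 HA]]] := jet_cont (hf p Kp).
  apply/cvgrPdist_le => e e0; rewrite near_withinE.
  pose r := Order.min d (e / A) / 2.
  have r0 : 0 < r by rewrite divr_gt0 // lt_min d0 divr_gt0.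
  exists (ball p.1 r, ball p.2 r) => /=; first by split; exact: nbhsx_ballx.
  move=> [x y] [/= bx by_] Kq.
  pose h := pt (x, y) - pt p.
  have hr : normc h <= Order.min d (e / A).
    apply: normc_le; first by rewrite le_min (ltW d0) divr_ge0 // ltW.
    rewrite /h /pt /=; move: bx by_; rewrite /ball /= !ltr_norml.
    have : 2 * r = Order.min d (e / A) by rewrite /r; field.
    move: r0; move: r (Order.min _ _) => r m r0 <- /andP[b1 b2] /andP[b3 b4].
    have q1 : (x - p.1) ^+ 2 <= r ^+ 2 by nra.
    have q2 : (y - p.2) ^+ 2 <= r ^+ 2 by nra.
    nra.
  move: hr; rewrite le_min => /andP[h1 h2].
  have := HA h h1; rewrite /h addrC subrK => /(_ (hK _ Kq)) hh.
  rewrite -normrN opprB -cReN -cReD (le_trans (Re_normc _)) //.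
  apply: (le_trans hh); move: h2; rewrite ler_pdivlMr // mulrC; exact.
apply: cvgB => //; apply: cvg_within_filter; apply: cvgM; first exact: cvg_cst.
apply: cvgD.
  apply: (@cvg_comp _ _ _ (@fst R R) (fun x => x ^+ 2) _ (nbhs p.1)).
    exact: cvg_fst.
  exact: exprn_continuous.
apply: (@cvg_comp _ _ _ (@snd R R) (fun x => x ^+ 2) _ (nbhs p.2)).
  exact: cvg_snd.
exact: exprn_continuous.
Qed.

Lemma min_principle (R : realType) (f : R[i] -> R[i]) (b B : R) (K : set (R * R)) :
  compact K -> (forall p, K p -> in_dom (pt p)) ->
  (forall p, K p -> p.1 ^+ 2 + p.2 ^+ 2 <= B) ->
  (forall p, K p -> jet f (pt p)) ->
  (forall p, K p -> b <= complex.Re (f (pt p)) \/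
     exists2 d, 0 < d & forall h, normc h <= d -> in_dom (pt p + h)
       /\ K (complex.Re (pt p + h), complex.Im (pt p + h))) ->
  forall p, K p -> b <= complex.Re (f (pt p)).
Proof.
move=> cK hK hB hf hb p1 Kp1; rewrite leNgt; apply/negP => lt1.
have B0 : 0 <= B by apply: le_trans (hB _ Kp1); rewrite addr_ge0 ?sqr_ge0.
(* Subtracting [c |p|^2] makes the real part strictly superharmonic, which excludes an interior
   minimum. As [c * B] is less than the gap at [p1], a minimizer cannot have real part at least [b]
   either. *)
pose c := (b - complex.Re (f (pt p1))) / (2 * (B + 1)).
have c0 : 0 < c by rewrite divr_gt0 ?mulr_gt0 ?subr_gt0 //; lra.
have cB : c * B < b - complex.Re (f (pt p1)).
  have : c * (2 * (B + 1)) = b - complex.Re (f (pt p1)).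
    by rewrite /c divfK // gt_eqF //; lra.
  by nra.
have [|p0] := compact_EVT_min _ cK (@jet_continuous _ _ c _ hK hf); first by exists p1.
rewrite inE => Kp0 hmin.
have hmin' q : K q -> complex.Re (f (pt p0)) - c * (p0.1 ^+ 2 + p0.2 ^+ 2) <=
   complex.Re (f (pt q)) - c * (q.1 ^+ 2 + q.2 ^+ 2).
  by move=> Kq; apply: hmin; rewrite inE.
have [hge|[e e0 he]] := hb _ Kp0.
  have := hmin' _ Kp1; have := hB _ Kp0; have := hB _ Kp1.
  have := sqr_ge0 p1.1; have := sqr_ge0 p1.2.
  move: (p1.1 ^+ 2) (p1.2 ^+ 2) (p0.1 ^+ 2) (p0.2 ^+ 2) => u1 u2 v1 v2; nra.
have [a [a2 [C [d [C0 d0 d1 H]]]]] := hf _ Kp0.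
(* The last bound makes the cubic error [C t^3] smaller than the gain [c t^2]. *)
pose t := Order.min e (Order.min d (c / (C + 1) / 2)).
have t0 : 0 < t by rewrite !lt_min e0 d0 !divr_gt0 //; lra.
have [te td tc] : [/\ t <= e, t <= d & t <= c / (C + 1) / 2].
  by rewrite /t !ge_min !lexx !orbT.
have step (h : R[i]) : normc h = t ->
  c * (2 * (p0.1 * complex.Re h + p0.2 * complex.Im h)
     + (complex.Re h ^+ 2 + complex.Im h ^+ 2)) <=
  complex.Re (a * h + a2 * h ^+ 2) + C * t ^+ 3.
  move=> nh; have he1 : normc h <= e by rewrite nh.
  have [hd Kh] := he h he1.
  have := H h; rewrite nh => /(_ td hd) hj.
  have := hmin' _ Kh; rewrite /=.
  have -> : pt (complex.Re (pt p0 + h), complex.Im (pt p0 + h)) = pt p0 + h.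
    by case: (pt p0 + h).
  have := le_trans (Re_normc _) hj; rewrite ler_norml => /andP[_].
  rewrite cReD cReN !cReD cImD /=; nra.
have s1 := step t%:C; have s2 := step (- t)%:C.
have s3 := step ('i%C * t%:C); have s4 := step ('i%C * (- t)%:C).
move: s1 s2 s3 s4; rewrite !normcM !normc_real normrN (gtr0_norm t0).
have -> : normc ('i%C : R[i]) = 1 by rewrite /= expr0n add0r expr1n sqrtr1.
rewrite mul1r => /(_ erefl) s1 /(_ erefl) s2 /(_ erefl) s3 /(_ erefl) s4.
have : 4 * c * t ^+ 2 <= 4 * C * t ^+ 3.
  move: s1 s2 s3 s4; clear step H; case: a => ar ai; case: a2 => br bi.
  rewrite !expr2 /= !mul0r !mul1r ?subr0 ?addr0 ?add0r ?mulr0 ?subr0 ?addr0.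
  by lra.
have tC : t * (2 * (C + 1)) <= c.
  have : 0 < 2 * (C + 1) by lra.
  move=> C2; have := ler_wpM2r (ltW C2) tc.
  have -> : c / (C + 1) / 2 * (2 * (C + 1)) = c; last exact.
  by move: (c) => u; field; rewrite gt_eqF //; lra.
have : 0 < t ^+ 2 by rewrite exprn_gt0.
have -> : t ^+ 3 = t * t ^+ 2 by rewrite exprS.
by move: (t ^+ 2) => t2; nra.
Qed.

Lemma bernoulli2 (R : realType) (d : R) n : 0 <= d ->
  1 + n%:R * d + 'C(n, 2)%:R * d ^+ 2 <= (1 + d) ^+ n.
Proof.
move=> d0; elim: n => [|n IH]; first by rewrite bin_small // !mul0r expr0 !addr0.
rewrite [(1 + d) ^+ n.+1]exprS binS bin1 natrD -natr1.
have : (1 + d) * (1 + n%:R * d + 'C(n, 2)%:R * d ^+ 2) <= (1 + d) * (1 + d) ^+ n.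
  by rewrite ler_wpM2l //; lra.
have : 0 <= 'C(n, 2)%:R * d ^+ 3 by rewrite mulr_ge0 ?exprn_ge0.
move: ('C(n, 2)%:R : R) (n%:R : R) => u v h1 h2; apply: (le_trans _ h2); rewrite -subr_ge0.
by have -> : (1 + d) * (1 + v * d + u * d ^+ 2) -
  (1 + (v + 1) * d + (u + v) * d ^+ 2) = u * d ^+ 3 by ring.
Qed.

Lemma bernoulli1 (R : realType) (d : R) n : 0 <= d -> 1 + n%:R * d <= (1 + d) ^+ n.
Proof.
move=> d0; apply: le_trans (bernoulli2 n d0).
by rewrite lerDl mulr_ge0 ?exprn_ge0.
Qed.

Lemma unit_pow_dist (R : realType) (w z : R[i]) n : normc w = 1 -> normc z = 1 ->
  normc (w ^+ n - z ^+ n) <= n%:R * normc (w - z).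
Proof.
move=> w1 z1; elim: n => [|n IH]; first by rewrite !expr0 subrr normc0 mul0r.
have -> : w ^+ n.+1 - z ^+ n.+1 = w * (w ^+ n - z ^+ n) + (w - z) * z ^+ n.
  by rewrite !exprS; ring.
rewrite (le_trans (le_normcD _ _)) // !normcM normcX w1 z1 expr1n mul1r mulr1.
by rewrite -natr1 mulrDl mul1r lerD2r.
Qed.

(** * Positivity on the vertical lines *)

Definition rho (R : realType) : R[i] := (- 2^-1) +i* (Num.sqrt 3 / 2).

Lemma sqrt3_bounds (R : realType) :
  173 / 100 <= Num.sqrt (3 : R) <= 1733 / 1000.
Proof.
have h : Num.sqrt 3 ^+ 2 = 3 :> R by rewrite sqr_sqrtr.
have h0 : 0 <= Num.sqrt 3 :> R by exact: sqrtr_ge0.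
by apply/andP; split; nra.
Qed.

Lemma rho_sqr (R : realType) : rho R ^+ 2 = - 1 - rho R.
Proof.
have h : Num.sqrt 3 ^+ 2 = 3 :> R by rewrite sqr_sqrtr.
by apply: eq_ReIm; rewrite expr2 ?cReM ?cImM ?cReD ?cImD ?cReN ?cImN /=; nra.
Qed.

Lemma rho3 (R : realType) : rho R ^+ 3 = 1.
Proof.
rewrite exprS rho_sqr; have := rho_sqr R; move: (rho R) => r h.
have -> : r * (-1 - r) = - r - r ^+ 2 by ring.
by rewrite h; ring.
Qed.

Lemma rho_norm (R : realType) : normc (rho R) = 1.
Proof.
have h : Num.sqrt 3 ^+ 2 = 3 :> R by rewrite sqr_sqrtr.
rewrite /= exprMn h (_ : _ + _ = 1) ?sqrtr1 //; lra.
Qed.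

Lemma rho_neq0 (R : realType) : rho R != 0.
Proof. by rewrite -normc_gt0 rho_norm. Qed.

Lemma rho_in_dom (R : realType) : in_dom (rho R).
Proof.
have h : Num.sqrt 3 ^+ 2 = 3 :> R by rewrite sqr_sqrtr.
have /andP[h1 _] := sqrt3_bounds R.
by split => /=; [lra | lra | rewrite exprMn h; lra].
Qed.

Lemma rho_exp (R : realType) k : rho R ^- k = rho R ^- (k %% 3).
Proof.
by rewrite {1}(divn_eq k 3) exprD mulnC exprM rho3 expr1n mul1r.
Qed.

Lemma rhoV (R : realType) : (rho R)^-1 = - 1 - rho R.
Proof.
apply: (mulfI (rho_neq0 R)); rewrite mulfV ?rho_neq0 // -rho_sqr.
by rewrite -exprS rho3.
Qed.

Lemma rho_neq1 (R : realType) : rho R != 1.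
Proof. by rewrite eq_complex /= negb_and; apply/orP; left; apply/eqP; lra. Qed.

Lemma rhoV_neq1 (R : realType) k : (k %% 3 != 0)%N -> rho R ^- k != 1.
Proof.
rewrite rho_exp; have : (k %% 3 < 3)%N by rewrite ltn_mod.
case: (k %% 3)%N => [|[|[|//]]] // _ _.
  by rewrite expr1 invr_eq1 rho_neq1.
rewrite rho_sqr -rhoV invrK rho_neq1 //.
Qed.

Lemma lin_rot (R : realType) p : lin (rho R) (cmap coprime_rot p) = rho R * lin (rho R) p.
Proof.
rewrite /lin /= rmorphN rmorphB /=; have := rho_sqr R.
move: (rho R) ((val p).1%:~R : R[i]) ((val p).2%:~R : R[i]) => r c d h.
have -> : r * (c * r + d) = c * r ^+ 2 + d * r by ring.
by rewrite h; ring.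
Qed.

Lemma eis_rho0 (R : realType) k : (10 <= k)%N -> (k %% 3 != 0)%N ->
  eisenstein k (rho R) = 0.
Proof.
move=> k10 k3; apply: (@mulfI _ 2); first by rewrite pnatr_eq0.
rewrite mulr0; apply: (has_sum_rot0 (eis_sum (rho_in_dom R) k10) _ (rhoV_neq1 R k3)) => p.
by rewrite lin_rot exprMn invfM.
Qed.

(* [2 'i Im rho = rho - conjc rho], so that [c] is a combination of
   [lin rho p] and [conjc (lin rho p)], two eigenvectors of the rotation. *)
Lemma eis_deriv_rho0 (R : realType) k : (10 <= k)%N -> (k %% 3 = 2)%N ->
  has_sum (eis_term 1 k.+1 (rho R)) 0.
Proof.
move=> k10 k3; have hd := rho_in_dom R.
have [|l hl] := @cterm_sum R 1 k.+1 _ hd; first by rewrite addn1.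
have hs := eis_sum hd k10; rewrite eis_rho0 // ?k3 // mulr0 in hs.
pose D := rho R - (-1 - rho R).
have hU := has_sum_add hs (has_sum_scale (- D) hl).
have e p : lin (rho R) p ^- k + - D * eis_term 1 k.+1 (rho R) p =
    ((val p).1%:~R * (-1 - rho R) + (val p).2%:~R) * lin (rho R) p ^- k.+1.
  have v0 : lin (rho R) p != 0 by rewrite -normc_gt0 lin_gt0.
  have -> : lin (rho R) p ^- k = lin (rho R) p * lin (rho R) p ^- k.+1.
    by rewrite exprS invfM mulVKf.
  rewrite /eis_term expr1 /D; move: (_ ^- k.+1) => u; rewrite /lin.
  by move: (rho R) ((val p).1%:~R : R[i]) ((val p).2%:~R : R[i]) => *; ring.
have hU' := has_sum_ext e hU.
have U0 : 0 + - D * l = 0.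
  apply: (has_sum_rot0 (w := rho R ^- k.+2) hU' _ _).
    move=> p; rewrite lin_rot exprMn invfM /=.
    have -> : (((val p).2 - (val p).1)%:~R * (-1 - rho R) + (- (val p).1)%:~R) =
       (rho R)^-1 * ((val p).1%:~R * (-1 - rho R) + (val p).2%:~R).
      rewrite rhoV rmorphN rmorphB /=; have := rho_sqr R.
      move: (rho R) ((val p).1%:~R : R[i]) ((val p).2%:~R : R[i]) => r c d h.
      have -> : (- 1 - r) * (c * (- 1 - r) + d) = c * (1 + 2 * r + r ^+ 2) + d * (-1 - r) by ring.
      by rewrite h; ring.
    rewrite [rho R ^+ k.+2]exprS invfM.
    by move: (_ ^- k.+1) (_ ^- k.+1) (_^-1) => u v w; ring.
  by apply: rhoV_neq1; rewrite -addn2 -modnDml k3.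
have D0 : D != 0.
  rewrite /D; have := sqrt3_bounds R => /andP[h _].
  rewrite eq_complex /= negb_and; apply/orP; right; apply/eqP; lra.
by move/eqP: U0; rewrite add0r mulf_eq0 oppr_eq0 (negbTE D0) /= => /eqP <-.
Qed.

Lemma small_sum_deriv (R : realType) (k : nat) (tau : R[i]) : ~~ odd k ->
  \sum_(p <- small_pairs) eis_term 1 k.+1 tau p =
  2 * (tau ^- k.+1 + (tau + 1) ^- k.+1 + (tau - 1) ^- k.+1).
Proof.
move=> hk; rewrite !big_cons big_nil /eis_term /lin /= !expr1 !mul0r !add0r !addr0.
rewrite !rmorphN1 !rmorph1 !mul1r !mulN1r.
have oddp (z : R[i]) : (- z) ^- k.+1 = - z ^- k.+1.
  by rewrite exprNn -signr_odd /= hk expr1 mulN1r invrN.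
rewrite (oddp tau) -opprD (oddp (tau + 1)).
rewrite [- tau + 1]addrC -(opprB tau) (oddp (tau - 1)) !opprK.
by move: (tau ^- _) ((tau + 1) ^- _) ((tau - 1) ^- _) => a b c; ring.
Qed.

Definition line_pt (R : realType) (s : R) : R[i] := rho R + s *i.

Lemma line_pt_in_dom (R : realType) (s : R) : 0 <= s -> in_dom (line_pt s).
Proof.
move=> s0; have h : Num.sqrt 3 ^+ 2 = 3 :> R by rewrite sqr_sqrtr.
have /andP[h1 _] := sqrt3_bounds R.
have h2 : 0 <= Num.sqrt 3 * s :> R by rewrite mulr_ge0 // sqrtr_ge0.
split => /=; [lra | lra |].
rewrite addr0; have -> : (Num.sqrt 3 / 2 + s) ^+ 2 = Num.sqrt 3 ^+ 2 / 4 + Num.sqrt 3 * s + s ^+ 2 by field.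
by rewrite h; nra.
Qed.

Lemma conj_quot (R : realType) (z : R[i]) (N : R) : z != 0 -> z * conjc z = N%:C ->
  conjc z / z = conjc z * conjc z * (N^-1)%:C /\ z ^- 2 = conjc z / z * (N^-1)%:C.
Proof.
move=> z0 zz; have c0 : conjc z != 0 by rewrite conjc_eq0.
have -> : (N^-1)%:C = (z * conjc z)^-1 by rewrite zz fmorphV.
by move: (conjc z) c0 => c c0; split; field; rewrite ?z0 ?c0.
Qed.

(** Polar form relative to the corner: [line_pt s = rho z] with [|z|^2 = N = 1 + sqrt 3 s + s^2],
    and [z^-2 = (conjc z / z) / N]. So [Om] is the phase [(conjc z / z)^n] and [P = N^n]. The sign
    of [Im Om] serves the case [k = 1 mod 3], the quadratic term of [P] the case [k = 2 mod 3]. *)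
Lemma line_pow (R : realType) (s : R) (n : nat) : 0 < s -> n%:R * s < 1 ->
  exists (Om : R[i]) (P : R), [/\
    line_pt s ^- (2 * n) = rho R ^- (2 * n) * Om * (P^-1)%:C,
    normc Om = 1, normc (Om - 1) <= n%:R * s, 0 <= complex.Im Om &
    1 + Num.sqrt 3 * (n%:R * s) + 3 * 'C(n, 2)%:R * s ^+ 2 <= P].
Proof.
move=> s0 ns1; have h : Num.sqrt 3 ^+ 2 = 3 :> R by rewrite sqr_sqrtr.
have /andP[h1 _] := sqrt3_bounds R; have r0 := rho_neq0 R.
pose q3 : R := Num.sqrt 3; pose z : R[i] := (1 + q3 * s / 2) -i* (s / 2).
pose N := 1 + q3 * s + s ^+ 2.
have hp : 0 <= q3 * s by rewrite mulr_ge0 ?sqrtr_ge0 // ltW.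
have N0 : 0 < N by rewrite /N; nra.
have tz : line_pt s = rho R * z.
  by apply: eq_ReIm; rewrite ?cReM ?cImM /= -/q3; move: h; rewrite -/q3; nra.
have zz : z * conjc z = N%:C.
  by apply: eq_ReIm; rewrite ?cReM ?cImM /=; move: h; rewrite -/q3 /N; nra.
have z1 : 1 <= normc z.
  rewrite -(@ler_sqr _ 1) ?nnegrE ?normc_ge0 // normc_sqr /=; nra.
have z0 : z != 0 by rewrite -normc_gt0; lra.
have NC0 : (N%:C : R[i]) != 0 by rewrite (eq_complex N%:C 0) /= eqxx andbT gt_eqF.
pose om := conjc z / z.
have om1 : normc om = 1.
  by rewrite /om normcM normcV normc_conj divff // gt_eqF //; lra.
have omd : normc (om - 1) <= s.
  have -> : om - 1 = (conjc z - z) / z by rewrite /om mulrBl divff.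
  rewrite normcM normcV ler_pdivrMr; last by lra.
  have -> : conjc z - z = s *i by apply: eq_ReIm; rewrite /=; field.
  by rewrite /= expr0n add0r sqrtr_sqr gtr0_norm // ler_peMr // ltW.
have omI : 0 <= complex.Im om.
  have -> : om = (conjc z * conjc z) * (N^-1)%:C.
    exact: (conj_quot z0 zz).1.
  rewrite cImM cReC cImC mulr0 add0r cImM /= mulr_ge0 ?invr_ge0 ?(ltW N0) //; nra.
have omj j : normc (om ^+ j - 1) <= j%:R * s.
  have := unit_pow_dist j om1 (normc1 R); rewrite expr1n => h2; apply: (le_trans h2).
  by rewrite ler_wpM2l.
exists (om ^+ n), (N ^+ n); split => //.
- have e2 : z ^- 2 = om * (N^-1)%:C.
    exact: (conj_quot z0 zz).2.
  have ez : z ^- (2 * n) = om ^+ n * ((N ^+ n)^-1)%:C.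
    by rewrite exprM -exprVn e2 exprMn -rmorphXn /= exprVn.
  by rewrite tz exprMn invfM ez mulrA.
- by rewrite normcX om1 expr1n.
(* As long as [j * s < 1], the power [om^j] is within 1 of 1, hence has nonnegative real part, and
   one more factor [om] keeps the imaginary part nonnegative. *)
- have : forall j, (j <= n)%N -> 0 <= complex.Im (om ^+ j).
    elim=> [|j IH] jn; first by rewrite expr0.
    have js : j%:R * s < 1.
      by apply: le_lt_trans ns1; rewrite ler_wpM2r ?ler_nat ?(ltnW jn) // ltW.
    have : 0 <= complex.Re (om ^+ j).
      have := le_trans (Re_normc _) (omj j); rewrite cReD cReN /= ler_norml; lra.
    rewrite exprS cImM => hr; have hi := IH (ltnW jn).
    have : 0 <= complex.Re om.
      have := le_trans (Re_normc _) omd; rewrite cReD cReN /= ler_norml.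
      have : 1%:R * s <= n%:R * s.
        by rewrite ler_wpM2r ?(ltW s0) // ler_nat (leq_ltn_trans (leq0n j) jn).
      lra.
    by move=> hr1; rewrite addr_ge0 ?mulr_ge0.
  exact.
have d0 : 0 <= q3 * s by [].
have := @bernoulli2 R (q3 * s) n d0.
have : (1 + q3 * s) ^+ n <= N ^+ n.
  by apply: lerXn2r; rewrite ?nnegrE /N; nra.
rewrite exprMn -[in (Num.sqrt 3)]/q3 [q3 ^+ 2]h.
by move: (_ ^+ n) (_ ^+ n) => a b; lra.
Qed.

(** This allows [|c rho + d|] as the lower bound [m] of the Taylor estimates along the line. *)
Lemma line_lin_mono (R : realType) (s : R) p : 0 <= s ->
  normc (lin (rho R) p) <= normc (lin (line_pt s) p).
Proof.
move=> s0; have /andP[h1 _] := sqrt3_bounds R.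
rewrite -ler_sqr ?nnegrE ?normc_ge0 // !normc_lin_sqr /= addr0 lerD2l
  ![((val p).1%:~R * _) ^+ 2]exprMn.
apply: ler_wpM2l; first exact: sqr_ge0.
by apply: lerXn2r; rewrite ?nnegrE; lra.
Qed.

Lemma inv_pow_le10 (R : realType) (x y : R) (j k : nat) : 1 <= x -> x <= y ->
  (j <= k)%N -> y ^- k <= x ^- j.
Proof.
move=> x1 xy jk; have x0 : 0 < x by lra.
rewrite (le_trans (inv_pow_le k x0 xy)) // lef_pV2 ?posrE ?exprn_gt0 //.
by rewrite ler_weXn2l.
Qed.

Lemma line_conj (R : realType) (s : R) : conjc (line_pt s) = -1 - line_pt s.
Proof. by apply: eq_ReIm; rewrite /=; lra. Qed.

Lemma conjc_invX (R : realType) (z : R[i]) k : conjc (z ^- k) = conjc z ^- k.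
Proof. by rewrite fmorphV rmorphXn. Qed.

(** On the line [t + 1 = - conjc t], so for even [k] two of the terms are conjugate. *)
Lemma line_main (R : realType) (t : R[i]) k : ~~ odd k -> conjc t = -1 - t ->
  complex.Re (main_terms k t) = 1 + 2 * complex.Re (t ^- k) + complex.Re ((t - 1) ^- k).
Proof.
move=> hk tE; rewrite /main_terms.
have e : t + 1 = - conjc t by rewrite tE; ring.
rewrite e even_powN // -conjc_invX.
move: (t ^- k) ((t - 1) ^- k) => a b.
by rewrite !cReD cReJ (_ : complex.Re 1 = 1) //; ring.
Qed.

Lemma normc_lower (R : realType) (z : R[i]) (e : R) : 0 <= e ->
  e ^+ 2 <= complex.Re z ^+ 2 + complex.Im z ^+ 2 -> e <= normc z.
Proof. by move=> e0; rewrite -normc_sqr ler_sqr ?nnegrE ?normc_ge0. Qed.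

Lemma line_m1 (R : realType) (s : R) : 0 <= s -> 173 / 100 <= normc (line_pt s - 1).
Proof.
move=> s0; have /andP[h1 _] := sqrt3_bounds R.
by apply: normc_lower => /=; nra.
Qed.

(** [27 / 1000] covers the tail [22 / 1000] and the term in [t - 1], at most [(173 / 100)^-10]. *)
Lemma eis_line_approx (R : realType) (s : R) k : 0 <= s -> (10 <= k)%N -> ~~ odd k ->
  1 + 2 * complex.Re (line_pt s ^- k) - 27 / 1000 <=
  complex.Re (eisenstein k (line_pt s)).
Proof.
move=> s0 k10 hk; have := eis_approx (line_pt_in_dom s0) k10 hk.
move: (eisenstein _ _) => E h; have := le_trans (Re_normc _) h.
rewrite cReD cReN line_main ?line_conj // ler_norml.
have : `|complex.Re ((line_pt s - 1) ^- k)| <= (173 / 100) ^- 10.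
  rewrite (le_trans (Re_normc _)) // normcXV inv_pow_le10 ?line_m1 //; lra.
rewrite ler_norml; have : (173 / 100 : R) ^- 10 <= 42 / 10000 by lra.
move: (complex.Re E) (complex.Re (line_pt s ^- k)) (complex.Re ((line_pt s - 1) ^- k)).
by clear h; move: (_ ^- 10) => u a b c; lra.
Qed.

Lemma small_pairs_scale (R : realType) (c : R[i]) (F : coprime_pair -> R[i]) :
  \sum_(p <- small_pairs) c * F p = c * \sum_(p <- small_pairs) F p.
Proof. by rewrite mulr_sumr. Qed.

(** Near the corner a constant tail error would exceed the value of the series. Subtracting the
    vanishing series at [rho] makes the error proportional to [k s]. *)
Lemma eis_line_diff1 (R : realType) (s : R) k : 0 <= s -> (10 <= k)%N -> ~~ odd k ->
  eisenstein k (rho R) = 0 ->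
  normc (2 * eisenstein k (line_pt s) - 2 * (main_terms k (line_pt s) - main_terms k (rho R)))
    <= k%:R * s * kap R ^- 11 / 100.
Proof.
move=> s0 k10 hk e0; have hd := line_pt_in_dom s0; have hr := rho_in_dom R.
have hs := has_sum_add (eis_sum hd k10) (has_sum_scale (-1) (eis_sum hr k10)).
rewrite e0 !mulr0 addr0 in hs.
have ks0 : 0 <= k%:R * s by rewrite mulr_ge0.
have A0 : 0 <= k%:R * s * kap R ^- 11 by rewrite mulr_ge0 ?kapV_ge0.
have hb p : (2 <= height p)%N -> normc (lin (line_pt s) p ^- k + -1 * lin (rho R) p ^- k) <=
    k%:R * s * kap R ^- 11 * (height p)%:R ^- 10.
  move=> p2; rewrite mulN1r.
  apply: (le_trans (inv_pow_taylor1 (lin_gt0 p hr) (line_lin_mono p s0) (lexx _) k)).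
  have -> : lin (line_pt s) p - lin (rho R) p = (val p).1%:~R * s *i.
    by rewrite /lin /line_pt; ring.
  have ns : normc (s *i : R[i]) = s by rewrite /= expr0n add0r sqrtr_sqr ger0_norm.
  have := @cterm_tail R 1 k _ p hr k10 p2; rewrite !addn1 /eis_term expr1 !normcM ns normcXV.
  move/(ler_wpM2l ks0); move: (_ ^- k.+1) (_ ^- 10) (kap R ^- 11) => a b c.
  by move: (normc _) (k%:R) => d e; lra.
have := tail_height A0 hs hb.
rewrite big_split /= (small_pairs_scale (-1)) !small_sum_lin //.
by rewrite mulN1r -mulrBr.
Qed.

(** The derivative vanishes at [rho] as well, so its full series may be added at no cost and the
    tail error becomes quadratic in [s]. *)
Lemma eis_line_diff2 (R : realType) (s : R) k : 0 <= s -> (10 <= k)%N -> ~~ odd k ->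
  (k %% 3 = 2)%N ->
  normc (2 * eisenstein k (line_pt s) - (2 * (main_terms k (line_pt s) - main_terms k (rho R)) +
     k%:R * s *i * (2 * (rho R ^- k.+1 + (rho R + 1) ^- k.+1 + (rho R - 1) ^- k.+1))))
    <= 'C(k.+1, 2)%:R * s ^+ 2 * kap R ^- 12 / 100.
Proof.
move=> s0 k10 hk k3; have hd := line_pt_in_dom s0; have hr := rho_in_dom R.
have hs := has_sum_add (has_sum_add (eis_sum hd k10) (has_sum_scale (-1) (eis_sum hr k10)))
  (has_sum_scale (k%:R * s *i) (@eis_deriv_rho0 R k k10 k3)).
rewrite eis_rho0 ?k3 // !mulr0 !addr0 in hs.
have c0 : 0 <= 'C(k.+1, 2)%:R * s ^+ 2 by rewrite mulr_ge0 ?sqr_ge0.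
have A0 : 0 <= 'C(k.+1, 2)%:R * s ^+ 2 * kap R ^- 12 by rewrite mulr_ge0 ?kapV_ge0.
have hb p : (2 <= height p)%N -> normc (lin (line_pt s) p ^- k + -1 * lin (rho R) p ^- k +
    k%:R * s *i * eis_term 1 k.+1 (rho R) p) <=
    'C(k.+1, 2)%:R * s ^+ 2 * kap R ^- 12 * (height p)%:R ^- 10.
  move=> p2; rewrite mulN1r.
  have := inv_pow_taylor2 (lin_gt0 p hr) (line_lin_mono p s0) (lexx _) k.
  have -> : lin (line_pt s) p - lin (rho R) p = (val p).1%:~R * s *i.
    by rewrite /lin /line_pt; ring.
  have -> : k%:R * ((val p).1%:~R * s *i) * lin (rho R) p ^- k.+1 =
     k%:R * s *i * eis_term 1 k.+1 (rho R) p by rewrite /eis_term expr1; ring.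
  move=> h1; apply: (le_trans h1).
  have ns : normc (s *i : R[i]) = s by rewrite /= expr0n add0r sqrtr_sqr ger0_norm.
  have := @cterm_tail R 2 k _ p hr k10 p2; rewrite !addn2 /eis_term normcM normcX normcXV normcM ns.
  move/(ler_wpM2l c0); rewrite exprMn; move: (_ ^- k.+2) (_ ^- 10) (kap R ^- 12) => a b c.
  by move: (normc _ ^+ 2) ('C(k.+1, 2)%:R : R) (s ^+ 2) => d e f; lra.
have := tail_height A0 hs hb.
rewrite big_split /= big_split /= (small_pairs_scale (-1)) (small_pairs_scale (k%:R * _)).
rewrite !small_sum_lin // small_sum_deriv //.
by rewrite mulN1r -mulrBr.
Qed.

Lemma rho_line (R : realType) : line_pt (0 : R) = rho R.
Proof. by rewrite /line_pt; apply: eq_ReIm; rewrite /= addr0. Qed.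

Lemma rho_conj (R : realType) : conjc (rho R) = -1 - rho R.
Proof. by rewrite -rho_line line_conj. Qed.

Lemma rhoV2 (R : realType) : rho R ^- 2 = rho R.
Proof. by rewrite rho_sqr -rhoV invrK. Qed.

Lemma rhoVk_Re (R : realType) k : (k %% 3 != 0)%N -> complex.Re (rho R ^- k) = - 2^-1.
Proof.
rewrite rho_exp; have : (k %% 3 < 3)%N by rewrite ltn_mod.
case: (k %% 3)%N => [|[|[|//]]] // _ _.
  by rewrite expr1 rhoV /=; lra.
by rewrite rhoV2.
Qed.

Lemma line_m1_diff1 (R : realType) (s : R) k : 0 <= s -> (10 <= k)%N ->
  `|complex.Re ((line_pt s - 1) ^- k - (rho R - 1) ^- k)| <=
    k%:R * s * (173 / 100) ^- 11.
Proof.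
move=> s0 k10; apply: (le_trans (Re_normc _)).
have m0 : 0 < 173 / 100 :> R by lra.
have mr : 173 / 100 <= normc (rho R - 1) by rewrite -rho_line line_m1.
apply: (le_trans (inv_pow_taylor1 m0 (line_m1 s0) mr k)).
have -> : line_pt s - 1 - (rho R - 1) = s *i by rewrite /line_pt; ring.
have -> : normc (s *i : R[i]) = s by rewrite /= expr0n add0r sqrtr_sqr ger0_norm.
rewrite ler_wpM2l ?mulr_ge0 // (@inv_pow_le10 R) //; lra.
Qed.

Lemma line_m1_diff2 (R : realType) (s : R) k : 0 <= s -> (10 <= k)%N ->
  `|complex.Re ((line_pt s - 1) ^- k - (rho R - 1) ^- k +
     k%:R * s *i * (rho R - 1) ^- k.+1)| <=
    'C(k.+1, 2)%:R * s ^+ 2 * (173 / 100) ^- 12.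
Proof.
move=> s0 k10; apply: (le_trans (Re_normc _)).
have m0 : 0 < 173 / 100 :> R by lra.
have mr : 173 / 100 <= normc (rho R - 1) by rewrite -rho_line line_m1.
have := inv_pow_taylor2 m0 (line_m1 s0) mr k.
have -> : line_pt s - 1 - (rho R - 1) = s *i by rewrite /line_pt; ring.
have -> : normc (s *i : R[i]) = s by rewrite /= expr0n add0r sqrtr_sqr ger0_norm.
move=> h; apply: (le_trans h).
rewrite ler_wpM2l ?mulr_ge0 ?sqr_ge0 // (@inv_pow_le10 R) //; lra.
Qed.

Lemma line_norm_pow (R : realType) (s : R) n : 0 <= s ->
  1 + Num.sqrt 3 * (n%:R * s) <= normc (line_pt s) ^+ (2 * n).
Proof.
move=> s0; have h : Num.sqrt 3 ^+ 2 = 3 :> R by rewrite sqr_sqrtr.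
have q0 : 0 <= Num.sqrt 3 * s by rewrite mulr_ge0 ?sqrtr_ge0.
rewrite exprM normc_sqr /=.
have -> : (- 2^-1 + 0) ^+ 2 + (Num.sqrt 3 / 2 + s) ^+ 2 =
    1 / 4 + Num.sqrt 3 ^+ 2 / 4 + Num.sqrt 3 * s + s ^+ 2 by field.
rewrite h mulrCA; apply: (le_trans (bernoulli1 n q0)).
by apply: lerXn2r; rewrite ?nnegrE; have := sqr_ge0 s; lra.
Qed.

(** Here [|t|^k >= 1 + sqrt 3 * 69 / 100 >= 219 / 100], so two terms of norm [|t|^-k] cannot cancel
    the constant 1. *)
Lemma line_pos_far (R : realType) (s : R) k : 0 < s -> (10 <= k)%N -> ~~ odd k ->
  69 / 100 <= (k./2)%:R * s -> 0 < complex.Re (eisenstein k (line_pt s)).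
Proof.
move=> s0 k10 hk hX; have kE : k = (2 * k./2)%N by lia.
apply: lt_le_trans (eis_line_approx (ltW s0) k10 hk).
have /andP[h1 _] := sqrt3_bounds R.
have hP := line_norm_pow k./2 (ltW s0).
have := Re_normc (line_pt s ^- k); rewrite normcXV ler_norml => /andP[h2 _].
have : normc (line_pt s) ^- k <= 100 / 219.
  rewrite -[leRHS]invf_div {1}kE lef_pV2 ?posrE; [|nra|lra].
  by apply: le_trans hP; nra.
by move: h2; move: (complex.Re _) (normc _ ^- k) => a b; clear hP; lra.
Qed.

Lemma unit_Re_le1 (R : realType) (Om : R[i]) : normc Om = 1 -> complex.Re Om <= 1.
Proof. by move=> h; rewrite -h (le_trans (ler_norm _)) ?Re_normc. Qed.

Lemma line_pos_near0 (R : realType) (s : R) k : 0 < s -> (10 <= k)%N -> ~~ odd k ->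
  (k %% 3 = 0)%N -> (k./2)%:R * s < 69 / 100 ->
  0 < complex.Re (eisenstein k (line_pt s)).
Proof.
move=> s0 k10 hk k3 hX; have kE : k = (2 * k./2)%N by lia.
have hX1 : (k./2)%:R * s < 1 by lra.
have [Om [P [hp O1 Od OI hP]]] := line_pow s0 hX1.
apply: lt_le_trans (eis_line_approx (ltW s0) k10 hk).
rewrite -kE rho_exp k3 expr0 invr1 mul1r in hp.
rewrite hp cReM cReC cImC mulr0 subr0.
have : 0 <= complex.Re Om.
  by have := le_trans (Re_normc _) Od; rewrite cReD cReN /= ler_norml; lra.
have P0 : 0 <= P^-1.
  rewrite invr_ge0 (le_trans _ hP) //.
  have X0 : 0 <= (k./2)%:R * s by rewrite mulr_ge0 // ltW.
  have c0 : 0 <= 3 * 'C(k./2, 2)%:R * s ^+ 2 by rewrite mulr_ge0 ?sqr_ge0 // mulr_ge0 ?ler0n.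
  have d0 : 0 <= Num.sqrt 3 * ((k./2)%:R * s) by rewrite mulr_ge0 ?sqrtr_ge0.
  by rewrite !addr_ge0.
by move=> h; have := mulr_ge0 h P0; move: (_ * P^-1) => u; lra.
Qed.

(** In the application [X = k s / 2], [q = P^-1], [r] is the real part of [rho^-k Om], and [u], [v]
    are [kap^-11] and [(173 / 100)^-11]. The gain [1 - q] exceeds [60 / 1000 X], the losses are at
    most [55 / 1000 X]. *)
Lemma near1_real (R : realType) (r q P X u v : R) : 0 < X -> X < 69 / 100 ->
  - 2^-1 <= r -> 0 < q -> q * P = 1 -> 1 + 173 / 100 * X <= P ->
  u <= 5 -> v <= 25 / 10000 ->
  0 < 1 + 2 * (r * q) - 2 * (X * v) - X * u / 100.
Proof.
move=> X0 X1 hr q0 qP P1 u5 v5.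
have uX : X * u <= X * 5 by rewrite ler_wpM2l // ltW.
have vX : X * v <= X * (25 / 10000) by rewrite ler_wpM2l // ltW.
have rq : - 2^-1 * q <= r * q by rewrite ler_wpM2r // ltW.
have qX : q * (1 + 173 / 100 * X) <= q * P by rewrite ler_wpM2l // ltW.
have : 0 < 1 - q - 6 / 100 * X by clear uX vX rq hr u5 v5; nra.
clear qX qP P1 hr u5 v5; move: (X * u) (X * v) (r * q) uX vX rq => *; lra.
Qed.

Lemma line_sqrt3_le (R : realType) (X c P : R) : 0 <= X -> 0 <= c ->
  1 + Num.sqrt 3 * X + c <= P -> 1 + 173 / 100 * X <= P.
Proof. by move=> X0 c0; have /andP[q1 _] := sqrt3_bounds R; nra. Qed.

Lemma kap11 (R : realType) : kap R ^- 11 <= 5.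
Proof. by rewrite kap.unlock; lra. Qed.

Lemma kap12 (R : realType) : kap R ^- 12 <= 57 / 10.
Proof. by rewrite kap.unlock; lra. Qed.

Lemma pow173_11 (R : realType) : (173 / 100 : R) ^- 11 <= 25 / 10000.
Proof. by lra. Qed.

Lemma pow173_12 (R : realType) : (173 / 100 : R) ^- 12 <= 15 / 10000.
Proof. by lra. Qed.

Lemma line_pos_near1 (R : realType) (s : R) k : 0 < s -> (10 <= k)%N -> ~~ odd k ->
  (k %% 3 = 1)%N -> (k./2)%:R * s < 69 / 100 ->
  0 < complex.Re (eisenstein k (line_pt s)).
Proof.
move=> s0 k10 hk k3 hX; have n0 : (0 < k./2)%N by lia.
have kE : k = (2 * k./2)%N by lia.
have X0 : 0 < (k./2)%:R * s by rewrite mulr_gt0 // ltr0n.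
have kR : k%:R = 2 * (k./2)%:R :> R by rewrite {1}kE natrM.
have hX1 : (k./2)%:R * s < 1 by lra.
have [Om [P [hp O1 Od OI hP]]] := line_pow s0 hX1.
rewrite -kE rho_exp k3 expr1 rhoV in hp.
have c0 : 0 <= 3 * 'C(k./2, 2)%:R * s ^+ 2 by rewrite mulr_ge0 ?sqr_ge0 // mulr_ge0 ?ler0n.
have P1 := line_sqrt3_le (ltW X0) c0 hP.
have P0 : 0 < P.
  apply: lt_le_trans P1; apply: ltr_wpDr => //; apply: mulr_ge0; last exact: ltW.
  by clear; lra.
have q0 : 0 < P^-1 by rewrite invr_gt0.
have qP : P^-1 * P = 1 by rewrite mulVf // gt_eqF.
have hO : - 2^-1 <= complex.Re ((-1 - rho R) * Om).
  have := unit_Re_le1 O1; rewrite cReM cReD cReN cImD cImN /= => h.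
  have : 0 <= Num.sqrt 3 / 2 * complex.Im Om by rewrite mulr_ge0 // divr_ge0 ?sqrtr_ge0.
  by clear -h; move: (complex.Im Om) (complex.Re Om) h (Num.sqrt 3) => i r h q; lra.
have := near1_real X0 hX hO q0 qP P1 (kap11 R) (pow173_11 R).
have k30 : (k %% 3 != 0)%N by rewrite k3.
have := eis_line_diff1 (ltW s0) k10 hk (eis_rho0 R k10 k30).
rewrite -mulrBr normcM (normc_nat R 2).
have := line_m1_diff1 (ltW s0) k10.
have -> : k%:R * s = 2 * ((k./2)%:R * s) by rewrite kR mulrA.
move: (line_conj s) (rho_conj R) (rhoVk_Re R k30) hp hk; clear.
move: (line_pt s) (rho R) => t r0 tE hr hrk hp hk.
have := Re_normc (eisenstein k t - (main_terms k t - main_terms k r0)).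
rewrite [complex.Re (_ ^- k - _)]cReD cReN.
rewrite [complex.Re (eisenstein _ _ - _)]cReD cReN [complex.Re (main_terms _ _ - _)]cReD cReN.
rewrite (line_main hk tE) (line_main hk hr) hrk hp.
rewrite [complex.Re (_ * (P^-1)%:C)]cReM cReC cImC mulr0 subr0.
move: (complex.Re ((t - 1) ^- k)) (complex.Re ((r0 - 1) ^- k)).
move: (complex.Re (eisenstein _ _)) (complex.Re (_ * Om)) P^-1 (normc _).
move: ((k./2)%:R * s) (kap R ^- 11) (_ ^- 11) => X u v e r q n a b.
rewrite !ler_norml => /andP[h1 _] /andP[h2 _] h3 h4.
have h5 : n <= X * u / 100 by lra.
by lra.
Qed.

(** The first-order effects cancel: twice the drop of [r] is [q3 X], which equals the linear growth
    of [P]. What remains is the gain from [12 / 10 X^2]; it exceeds [66 / 1000 X^2], which bounds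
    the losses. *)
Lemma near2_real (R : realType) (r q q3 X c u v : R) : 0 < X -> X < 69 / 100 ->
  0 <= q3 -> q3 <= 1733 / 1000 -> - (2^-1 + q3 / 2 * X) <= r -> 0 < q ->
  q * (1 + q3 * X + 12 / 10 * X ^+ 2) <= 1 ->
  c <= 22 / 10 * X ^+ 2 -> 0 <= u -> 0 <= v -> u <= 57 / 10 -> v <= 15 / 10000 ->
  0 < 1 + 2 * (r * q) - c * v - c * u / 200.
Proof.
move=> X0 X1 a0 a1 hr q0 qP hc u0 v0 u5 v5.
have cu : c * u <= 22 / 10 * X ^+ 2 * (57 / 10).
  apply: (@le_trans _ _ (22 / 10 * X ^+ 2 * u)); first by rewrite ler_wpM2r.
  by rewrite ler_wpM2l // mulr_ge0 ?sqr_ge0.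
have cv : c * v <= 22 / 10 * X ^+ 2 * (15 / 10000).
  apply: (@le_trans _ _ (22 / 10 * X ^+ 2 * v)); first by rewrite ler_wpM2r.
  by rewrite ler_wpM2l // mulr_ge0 ?sqr_ge0.
have rq : - (2^-1 + q3 / 2 * X) * q <= r * q by rewrite ler_wpM2r // ltW.
have aX : q3 * X <= 1733 / 1000 * (69 / 100) by apply: ler_pM => //; exact: ltW.
clear hr hc u0 v0 u5 v5.
have X20 : 0 < X ^+ 2 by rewrite exprn_gt0.
have X21 : X ^+ 2 <= 1 / 2 by clear -X0 X1; nra.
have : 66 / 1000 * X ^+ 2 < 1 - q * (1 + q3 * X).
  clear cu cv rq; move: (q3 * X) (X ^+ 2) X20 X21 aX q0 qP; clear => a z z0 z1 az q0 qP.
  have a2 : 1 + a <= 22 / 10 by lra.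
  rewrite ltNge; apply/negP => h.
  have h1 : q * z <= 55 / 1000 * z by nra.
  have h2 : q <= 55 / 1000 by move: h1; rewrite ler_pM2r.
  by clear h1; nra.
move: rq cu cv; clear; move: (c * u) (c * v) (r * q) (X ^+ 2) => *; lra.
Qed.

Lemma line_pos_near2 (R : realType) (s : R) k : 0 < s -> (10 <= k)%N -> ~~ odd k ->
  (k %% 3 = 2)%N -> (k./2)%:R * s < 69 / 100 ->
  0 < complex.Re (eisenstein k (line_pt s)).
Proof.
move=> s0 k10 hk k3 hX; have n5 : (5 <= k./2)%N by lia.
have kE : k = (2 * k./2)%N by lia.
have X0 : 0 < (k./2)%:R * s by rewrite mulr_gt0 // ltr0n; apply: leq_trans n5.
have hX1 : (k./2)%:R * s < 1 by lra.
(* For [n = k / 2 >= 5], [n (n - 1) >= 4/5 n^2] and [n (2 n + 1) <= 11/5 n^2]; these give the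
   constants [12 / 10] and [22 / 10]. *)
have sX : 5 * s <= (k./2)%:R * s by rewrite ler_wpM2r ?(ltW s0) // (ler_nat R 5).
have binE n : 'C(n, 2)%:R * 2 = n%:R * n%:R - n%:R :> R.
  by elim: n => [|n IH]; rewrite ?mul0r ?subr0 // binS bin1 natrD -natr1; lra.
have [Om [P [hp O1 Od OI hP]]] := line_pow s0 hX1.
rewrite -kE rho_exp k3 rhoV2 in hp.
have c1 : 12 / 10 * ((k./2)%:R * s) ^+ 2 <= 3 * 'C(k./2, 2)%:R * s ^+ 2.
  have -> : 3 * 'C(k./2, 2)%:R * s ^+ 2 = 3 / 2 * ('C(k./2, 2)%:R * 2 * s ^+ 2) by field.
  rewrite binE; move: ((k./2)%:R : R) X0 sX s0; clear => n X0 sX s0; nra.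
have c2 : 'C(k.+1, 2)%:R * s ^+ 2 <= 22 / 10 * ((k./2)%:R * s) ^+ 2.
  have -> : 'C(k.+1, 2)%:R * s ^+ 2 = 1 / 2 * ('C(k.+1, 2)%:R * 2 * s ^+ 2) by field.
  have kR : k.+1%:R = 2 * (k./2)%:R + 1 :> R by rewrite -natr1 {1}kE natrM.
  rewrite binE kR.
  move: ((k./2)%:R : R) X0 sX s0; clear => n X0 sX s0; nra.
have /andP[_ q32] := sqrt3_bounds R; have q30 : 0 <= Num.sqrt 3 :> R by exact: sqrtr_ge0.
have c0 : 0 <= 3 * 'C(k./2, 2)%:R * s ^+ 2 by rewrite mulr_ge0 ?sqr_ge0 // mulr_ge0 ?ler0n.
have P0 : 0 < P.
  apply: lt_le_trans hP; apply: ltr_wpDr => //; apply: ltr_wpDr => //.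
  by apply: mulr_ge0 => //; exact: ltW.
have q0 : 0 < P^-1 by rewrite invr_gt0.
have qP : P^-1 * (1 + Num.sqrt 3 * ((k./2)%:R * s) + 12 / 10 * ((k./2)%:R * s) ^+ 2) <= 1.
  rewrite -[leRHS](mulVf (lt0r_neq0 P0)); apply: ler_wpM2l; first exact: ltW.
  by apply: le_trans hP; rewrite lerD2l.
have hO : - (2^-1 + Num.sqrt 3 / 2 * ((k./2)%:R * s)) <= complex.Re (rho R * Om).
  have := unit_Re_le1 O1; rewrite cReM /= => h.
  have h2 : complex.Im Om <= (k./2)%:R * s.
    apply: le_trans Od; apply: le_trans (Im_normc _).
    by rewrite cImD cImN /= oppr0 addr0 ler_norm.
  have : Num.sqrt 3 / 2 * complex.Im Om <= Num.sqrt 3 / 2 * ((k./2)%:R * s).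
    by rewrite ler_wpM2l // divr_ge0.
  clear -h; move: (_ * s) (Num.sqrt 3) (complex.Im Om) (complex.Re Om) h.
  by move=> X q i r h; lra.
have u0 : 0 <= kap R ^- 12 by exact: kapV_ge0.
have v0 : 0 <= (173 / 100 : R) ^- 12 by clear; lra.
have := near2_real X0 hX q30 q32 hO q0 qP c2 u0 v0 (kap12 R) (pow173_12 R).
have k30 : (k %% 3 != 0)%N by rewrite k3.
have := eis_line_diff2 (ltW s0) k10 hk k3.
have lin0 : rho R ^- k.+1 + (rho R + 1) ^- k.+1 = 0.
  have e1 : rho R ^- k.+1 = 1 by rewrite rho_exp -addn1 -modnDml k3 /= expr0 invr1.
  have e2 : rho R + 1 = - (rho R)^-1 by rewrite rhoV; ring.
  rewrite e1 e2 exprNn -signr_odd /= hk expr1 mulN1r invrN exprVn invrK.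
  by rewrite -[rho R ^+ _]invrK e1 invr1 subrr.
rewrite lin0 add0r.
have -> : k%:R * s *i * (2 * (rho R - 1) ^- k.+1) = 2 * (k%:R * s *i * (rho R - 1) ^- k.+1).
  by move: (k%:R) (s *i) (_ ^- k.+1) => *; ring.
rewrite -mulrDr -mulrBr normcM (normc_nat R 2).
have := line_m1_diff2 (ltW s0) k10.
move: (line_conj s) (rho_conj R) (rhoVk_Re R k30) hp hk; clear.
move: (line_pt s) (rho R) (k%:R * s *i) => t r0 w tE hr hrk hp hk.
have := Re_normc (eisenstein k t - (main_terms k t - main_terms k r0 + w * (r0 - 1) ^- k.+1)).
rewrite [complex.Re (_ ^- k - _ + _)]cReD [complex.Re (_ ^- k - _)]cReD cReN.
rewrite [complex.Re (eisenstein _ _ - _)]cReD cReN [complex.Re (main_terms _ _ - _ + _)]cReD.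
rewrite [complex.Re (main_terms _ _ - _)]cReD cReN.
rewrite (line_main hk tE) (line_main hk hr) hrk hp.
rewrite [complex.Re (_ * (P^-1)%:C)]cReM cReC cImC mulr0 subr0.
move: (complex.Re ((t - 1) ^- k)) (complex.Re ((r0 - 1) ^- k)) (complex.Re (w * _)).
move: (complex.Re (eisenstein _ _)) (complex.Re (_ * Om)) P^-1 (normc _).
move: ('C(k.+1, 2)%:R * s ^+ 2) (kap R ^- 12) (_ ^- 12) => X u v e r q n a b d.
rewrite !ler_norml => /andP[h1 _] /andP[h2 _] h3 h4.
have h5 : n <= X * u / 200 by lra.
by lra.
Qed.

Lemma eis_line_pos (R : realType) (s : R) k : 0 < s -> (10 <= k)%N -> ~~ odd k ->
  0 < complex.Re (eisenstein k (line_pt s)).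
Proof.
move=> s0 k10 hk; case: (lerP (69 / 100) ((k./2)%:R * s)) => hX.
  exact: line_pos_far.
have : (k %% 3 < 3)%N by rewrite ltn_mod.
case e : (k %% 3)%N => [|[|[|//]]] _.
- exact: line_pos_near0.
- exact: line_pos_near1.
- exact: line_pos_near2.
Qed.

(** * The unit circle *)

Lemma circle_conj (R : realType) (t : R[i]) : normc t = 1 -> conjc t * t = 1.
Proof.
move=> t1; have := normc_sqr t; rewrite t1 => h.
apply: eq_ReIm; rewrite ?cReM ?cImM cReJ cImJ /=; last by ring.
move: h; rewrite expr1n; move: (complex.Re t) (complex.Im t) => x y h.
by nra.
Qed.

Lemma circle_inv (R : realType) (t : R[i]) : normc t = 1 -> t^-1 = conjc t.
Proof.
move=> t1; have t0 : t != 0 by rewrite -normc_gt0 t1.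
by apply: (mulIf t0); rewrite mulVf // circle_conj.
Qed.

Lemma eis_circle_real (R : realType) (n : nat) (t : R[i]) : in_dom t ->
  normc t = 1 -> (10 <= 2 * n)%N -> complex.Im (t ^+ n * eisenstein (2 * n) t) = 0.
Proof.
move=> hd t1 n10.
suff : conjc (t ^+ n * eisenstein (2 * n) t) = t ^+ n * eisenstein (2 * n) t.
  by move/(congr1 (@complex.Im R)); rewrite cImJ; lra.
rewrite rmorphM rmorphXn /= (eis_circle hd n10 (circle_conj t1)).
by rewrite mul2n -addnn exprD !mulrA -exprMn circle_conj // expr1n mul1r.
Qed.

Lemma circle_add1 (R : realType) (n : nat) (t : R[i]) : normc t = 1 ->
  t ^+ n * (t + 1) ^- (2 * n) = ((2 + 2 * complex.Re t) ^- n)%:C.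
Proof.
move=> t1; have t0 : t != 0 by rewrite -normc_gt0 t1.
have e : (t + 1) ^+ 2 = t * (2 + 2 * complex.Re t)%:C.
  have -> : (2 + 2 * complex.Re t)%:C = 2 + (t + conjc t).
    by rewrite addcJ rmorphD rmorphM /= !(rmorph_nat (real_complex R)).
  have := circle_conj t1; move: (conjc t) => c h.
  have -> : t * (2 + (t + c)) = t ^+ 2 + 2 * t + c * t by ring.
  by rewrite h; ring.
by rewrite exprM e exprMn invfM mulrA mulfV ?expf_neq0 // mul1r fmorphV rmorphXn.
Qed.

(** After multiplication by [t^n] the terms 1 and [t^(-2n)] become conjugate and the term in [t + 1]
    real. The error covers [22 / 1000] and the term in [t - 1], at most [32^-1] because
    [|t - 1|^2 >= 2] when [Re t <= 0]. *)
Lemma arc_eis (R : realType) (n : nat) (t : R[i]) : in_dom t -> normc t = 1 ->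
  complex.Re t <= 0 -> (5 <= n)%N ->
  `|complex.Re (t ^+ n * eisenstein (2 * n) t) -
    (2 * complex.Re (t ^+ n) + (2 + 2 * complex.Re t) ^- n)| <= 54 / 1000.
Proof.
move=> hd t1 hx n5.
have k10 : (10 <= 2 * n)%N by lia.
have hk : ~~ odd (2 * n) by rewrite mul2n odd_double.
have t0 : t != 0 by rewrite -normc_gt0 t1.
have hm : complex.Re (t ^+ n * main_terms (2 * n) t) = 2 * complex.Re (t ^+ n) +
    (2 + 2 * complex.Re t) ^- n + complex.Re (t ^+ n * (t - 1) ^- (2 * n)).
  have -> : t ^+ n * main_terms (2 * n) t = t ^+ n + t ^+ n * t ^- (2 * n) +
     t ^+ n * (t + 1) ^- (2 * n) + t ^+ n * (t - 1) ^- (2 * n).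
    by rewrite /main_terms !mulrDr mulr1.
  have -> : t ^+ n * t ^- (2 * n) = conjc (t ^+ n).
    rewrite mul2n -addnn exprD invfM mulrA mulfV ?expf_neq0 // mul1r.
    by rewrite -exprVn circle_inv // rmorphXn.
  rewrite circle_add1 // !cReD cReJ cReC.
  by move: (complex.Re (t ^+ n)) (_ ^- n) (complex.Re (_ * _)) => a b c; ring.
have h1 : normc (t - 1) ^- (2 * n) <= 32^-1.
  have h2 : 2 <= normc (t - 1) ^+ 2.
    rewrite normc_sqr cReD cImD cReN cImN /=.
    by have := normc_sqr t; rewrite t1 => h; nra.
  rewrite exprM; apply: (le_trans (inv_pow_le10 _ h2 n5)); lra.
have := le_trans (Re_normc _) (_ : normc (t ^+ n * (eisenstein (2 * n) t - main_terms (2 * n) t)) <= 22 / 1000).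
rewrite normcM normcX t1 expr1n mul1r => /(_ (eis_approx hd k10 hk)).
rewrite mulrBr cReD cReN hm.
have := le_trans (Re_normc (t ^+ n * (t - 1) ^- (2 * n))) (_ : _ <= 32^-1).
rewrite normcM normcX t1 expr1n mul1r normcXV => /(_ h1).
clear; move: (complex.Re _) (complex.Re _) (complex.Re _) (_ ^- n) => a b c d.
by rewrite !ler_norml; lra.
Qed.

Lemma rho_dist_real (R : realType) (x y q : R) : q ^+ 2 = 3 -> 0 <= q ->
  - 2^-1 <= x -> x <= 0 -> 0 < y -> x ^+ 2 + y ^+ 2 = 1 ->
  3 * ((x + 2^-1) ^+ 2 + (y - q / 2) ^+ 2) <= (1 + 2 * x) ^+ 2.
Proof.
move=> q2 q0 x1 x0 y0 h.
have yq : q / 2 <= y.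
  rewrite -ler_sqr ?nnegrE ?(ltW y0) ?divr_ge0 // exprMn q2; nra.
have e : (y - q / 2) * (y + q / 2) = (2^-1 - x) * (2^-1 + x).
  have -> : (y - q / 2) * (y + q / 2) = y ^+ 2 - q ^+ 2 / 4 by field.
  have -> : (2^-1 - x) * (2^-1 + x) = 4^-1 - x ^+ 2 by field.
  by rewrite q2; move: h; move: (x ^+ 2) (y ^+ 2) => a b h; lra.
have d0 : 0 <= y - q / 2 by lra.
have dq : (y - q / 2) * q <= 2^-1 + x.
  apply: (@le_trans _ _ ((y - q / 2) * (y + q / 2))); first by rewrite ler_wpM2l //; lra.
  by rewrite e ler_piMl; lra.
have : ((y - q / 2) * q) ^+ 2 <= (2^-1 + x) ^+ 2.
  by apply: lerXn2r; rewrite ?nnegrE ?mulr_ge0 //; lra.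
rewrite exprMn q2; move: ((y - q / 2) ^+ 2) => d hd.
have -> : (1 + 2 * x) ^+ 2 = 4 * (2^-1 + x) ^+ 2 by field.
by rewrite (addrC x); move: ((2^-1 + x) ^+ 2) hd => *; lra.
Qed.

(** It ties the rotation of [t^n] away from [rho^n] to the decay of [(2 + 2 Re t)^-n], which
    [arc_gap] needs. *)
Lemma rho_dist (R : realType) (t : R[i]) : in_dom t -> normc t = 1 ->
  complex.Re t <= 0 -> 173 / 100 * normc (t - rho R) <= 1 + 2 * complex.Re t.
Proof.
move=> [/andP[x1 _] y0 _] t1 x0; have := normc_sqr t; rewrite t1 expr1n => /esym h.
have q2 : Num.sqrt 3 ^+ 2 = 3 :> R by rewrite sqr_sqrtr.
have := rho_dist_real q2 (sqrtr_ge0 _) x1 x0 y0 h.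
have -> : (complex.Re t + 2^-1) ^+ 2 + (complex.Im t - Num.sqrt 3 / 2) ^+ 2 =
    normc (t - rho R) ^+ 2 by rewrite normc_sqr cReD cImD cReN cImN /= opprK.
move=> h3; rewrite -ler_sqr ?nnegrE ?mulr_ge0 ?normc_ge0 //; last first.
  by move: x1; lra.
apply: le_trans h3; rewrite exprMn ler_wpM2r ?sqr_ge0 //; lra.
Qed.

Lemma rho_opp_dist (R : realType) n : 1 <= normc (1 + rho R ^+ n).
Proof.
have -> : rho R ^+ n = rho R ^+ (n %% 3).
  by rewrite {1}(divn_eq n 3) exprD mulnC exprM rho3 expr1n mul1r.
have : (n %% 3 < 3)%N by rewrite ltn_mod.
case: (n %% 3)%N => [|[|[|//]]] // _.
- by rewrite expr0 (normc_nat R 2) ler1n.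
- have -> : 1 + rho R ^+ 1 = - rho R ^+ 2 by rewrite rho_sqr expr1; ring.
  by rewrite normcN normcX rho_norm expr1n.
- have -> : 1 + rho R ^+ 2 = - rho R by rewrite rho_sqr; ring.
  by rewrite normcN rho_norm.
Qed.

(** A [t^n] near -1 is far from the cube root of unity [rho^n], so [n |t - rho| >= 98 / 100]; then
    [rho_dist] and Bernoulli give [(2 + 2 Re t)^n >= 25 / 10]. *)
Lemma arc_gap (R : realType) (t : R[i]) (n : nat) : in_dom t -> normc t = 1 ->
  complex.Re t <= 0 -> normc (t ^+ n + 1) <= 2 / 100 ->
  (2 + 2 * complex.Re t) ^- n <= 4 / 10.
Proof.
move=> hd t1 x0 h.
have hr := rho_dist hd t1 x0.
have h1 := unit_pow_dist n t1 (rho_norm R).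
have h2 : 98 / 100 <= normc (t ^+ n - rho R ^+ n).
  have := rho_opp_dist R n.
  have -> : 1 + rho R ^+ n = (t ^+ n + 1) - (t ^+ n - rho R ^+ n) by ring.
  have := le_normcD (t ^+ n + 1) (- (t ^+ n - rho R ^+ n)); rewrite normcN.
  by move: h; clear; move: (normc _) (normc _) (normc _) => a b c; lra.
have d0 : 0 <= 1 + 2 * complex.Re t by case: hd => /andP[] ? ? _ _; lra.
have h3 := bernoulli1 n d0.
have h4 : n%:R * (173 / 100 * normc (t - rho R)) <= n%:R * (1 + 2 * complex.Re t).
  by rewrite ler_wpM2l.
have h5 : 25 / 10 <= (2 + 2 * complex.Re t) ^+ n.
  have -> : 2 + 2 * complex.Re t = 1 + (1 + 2 * complex.Re t) by ring.
  move: h1 h2 h3 h4; clear; move: (normc (t ^+ n - _)) (normc (t - rho R)) => a b.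
  by move: (1 + 2 * complex.Re t) => d; move: ((1 + d) ^+ n) (n%:R : R) => *; lra.
rewrite -[leRHS]invrK lef_pV2 ?posrE; [|lra|lra].
by apply: le_trans h5; lra.
Qed.

(** [A], [A'] are the parts of [t^K], [C], [S] those of [t^(K+L)], [X] and [Y] the powers of
    [2 + 2 Re t]. For [C] near 1, [Re t^L] is near [A], and completing the square bounds the main
    term [(2 A + X) (2 A + Y) + 2 + X Y] below by 1. *)
Lemma arc_pos_real (R : realType) (A A' X Y C S e1 e2 e3 : R) :
  0 <= X <= 1 -> 0 <= Y <= 1 -> A ^+ 2 <= 1 -> `|A'| <= 1 -> `|S| <= 1 / 100 ->
  9999 / 10000 <= C <= 1 ->
  `|e1 - (2 * A + X)| <= 54 / 1000 ->
  `|e2 - (2 * (C * A + S * A') + Y)| <= 54 / 1000 ->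
  `|e3 - (2 * C + X * Y)| <= 54 / 1000 -> 1 / 10 <= e1 * e2 + e3.
Proof.
move=> /andP[X0 X1] /andP[Y0 Y1] A1 A'1 S1 /andP[C0 C1] h1 h2 h3.
have Ab : `|A| <= 1 by rewrite -ler_sqr ?nnegrE // real_normK ?num_real // expr1n.
have SA : `|S * A'| <= 1 / 100 by rewrite normrM -[leRHS]mulr1 ler_pM.
have CA : `|(1 - C) * A| <= 1 / 10000.
  by rewrite normrM -[leRHS]mulr1 ler_pM // ler_norml; move: C0 C1; clear; lra.
have h2' : `|e2 - (2 * A + Y)| <= 75 / 1000.
  by move: h2 SA CA; clear; rewrite !ler_norml; move: (S * A') => u; lra.
have h3' : 2 + X * Y - 55 / 1000 <= e3.
  by move: h3 C0; clear; rewrite ler_norml; move: (X * Y) => u; lra.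
have p1 : `|2 * A + X| <= 3 by move: Ab X0 X1 Y0 Y1; clear; rewrite !ler_norml; lra.
have p2 : `|2 * A + Y| <= 3 by move: Ab X0 X1 Y0 Y1; clear; rewrite !ler_norml; lra.
have key : 1 <= (2 * A + X) * (2 * A + Y) + 2 + X * Y.
  have -> : (2 * A + X) * (2 * A + Y) + 2 + X * Y =
    (2 * A + (X + Y) / 2) ^+ 2 + 2 + 2 * (X * Y) - ((X + Y) / 2) ^+ 2 by field.
  have : ((X + Y) / 2) ^+ 2 <= 1 by move: X0 X1 Y0 Y1; clear => *; rewrite expr_le1 //; lra.
  have := sqr_ge0 (2 * A + (X + Y) / 2); have := mulr_ge0 X0 Y0.
  by clear; move: (_ ^+ 2) (_ ^+ 2) (X * Y) => *; lra.
have -> : e1 * e2 + e3 = (2 * A + X) * (2 * A + Y) + e3 +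
  (2 * A + X) * (e2 - (2 * A + Y)) + (e1 - (2 * A + X)) * (2 * A + Y) +
  (e1 - (2 * A + X)) * (e2 - (2 * A + Y)) by ring.
have q1 : `|(2 * A + X) * (e2 - (2 * A + Y))| <= 3 * (75 / 1000).
  by rewrite normrM ler_pM.
have q2 : `|(e1 - (2 * A + X)) * (2 * A + Y)| <= 54 / 1000 * 3.
  by rewrite normrM ler_pM.
have q3 : `|(e1 - (2 * A + X)) * (e2 - (2 * A + Y))| <= 54 / 1000 * (75 / 1000).
  by rewrite normrM ler_pM.
move: q1 q2 q3 key h3'; rewrite !ler_norml; clear.
move: (_ * (e2 - _)) (_ * (2 * A + Y)) (_ * (e2 - _)) (_ * (2 * A + Y)) (X * Y).
by move=> *; lra.
Qed.

(** For [C] near -1, [Re t^L] is near [- A]. The bound on [X * Y], supplied by [arc_gap], is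
    decisive: at [A = 0], [X = Y = 1] the main term [(2 A + X) (Y - 2 A) + X Y - 2] would vanish. *)
Lemma arc_neg_real (R : realType) (A A' X Y C S e1 e2 e3 : R) :
  0 <= X <= 1 -> 0 <= Y <= 1 -> X * Y <= 4 / 10 ->
  A ^+ 2 <= 1 -> `|A'| <= 1 -> `|S| <= 1 / 100 ->
  - 1 <= C <= - (9999 / 10000) ->
  `|e1 - (2 * A + X)| <= 54 / 1000 ->
  `|e2 - (2 * (C * A + S * A') + Y)| <= 54 / 1000 ->
  `|e3 - (2 * C + X * Y)| <= 54 / 1000 -> e1 * e2 + e3 <= - (1 / 10).
Proof.
move=> /andP[X0 X1] /andP[Y0 Y1] XY A1 A'1 S1 /andP[C0 C1] h1 h2 h3.
have Ab : `|A| <= 1 by rewrite -ler_sqr ?nnegrE // real_normK ?num_real // expr1n.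
have SA : `|S * A'| <= 1 / 100 by rewrite normrM -[leRHS]mulr1 ler_pM.
have CA : `|(1 + C) * A| <= 1 / 10000.
  by rewrite normrM -[leRHS]mulr1 ler_pM // ler_norml; move: C0 C1; clear; lra.
have h2' : `|e2 - (Y - 2 * A)| <= 75 / 1000.
  by move: h2 SA CA; clear; rewrite !ler_norml; move: (S * A') => u; lra.
have h3' : e3 <= X * Y - 2 + 55 / 1000.
  by move: h3 C1; clear; rewrite ler_norml; move: (X * Y) => u; lra.
have p1 : `|2 * A + X| <= 3 by move: Ab X0 X1 Y0 Y1; clear; rewrite !ler_norml; lra.
have p2 : `|Y - 2 * A| <= 3 by move: Ab X0 X1 Y0 Y1; clear; rewrite !ler_norml; lra.
have key : (2 * A + X) * (Y - 2 * A) + X * Y - 2 <= - (95 / 100).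
  have -> : (2 * A + X) * (Y - 2 * A) + X * Y - 2 =
    2 * (X * Y) - 2 + ((X - Y) / 2) ^+ 2 - (2 * A + (X - Y) / 2) ^+ 2 by field.
  have : ((X - Y) / 2) ^+ 2 <= 1 / 4.
    have : `|(X - Y) / 2| <= 1 / 2.
      by move: X0 X1 Y0 Y1; clear => *; rewrite ler_norml; lra.
    move=> h; have := ler_pM (normr_ge0 _) (normr_ge0 _) h h.
    by rewrite -expr2 real_normK ?num_real //; clear; move: (_ ^+ 2) => *; lra.
  have := sqr_ge0 (2 * A + (X - Y) / 2).
  by move: XY; clear; move: (_ ^+ 2) (_ ^+ 2) (X * Y) => *; lra.
have -> : e1 * e2 + e3 = (2 * A + X) * (Y - 2 * A) + e3 +
  (2 * A + X) * (e2 - (Y - 2 * A)) + (e1 - (2 * A + X)) * (Y - 2 * A) +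
  (e1 - (2 * A + X)) * (e2 - (Y - 2 * A)) by ring.
have q1 : `|(2 * A + X) * (e2 - (Y - 2 * A))| <= 3 * (75 / 1000).
  by rewrite normrM ler_pM.
have q2 : `|(e1 - (2 * A + X)) * (Y - 2 * A)| <= 54 / 1000 * 3.
  by rewrite normrM ler_pM.
have q3 : `|(e1 - (2 * A + X)) * (e2 - (Y - 2 * A))| <= 54 / 1000 * (75 / 1000).
  by rewrite normrM ler_pM.
move: q1 q2 q3 key h3'; rewrite !ler_norml; clear.
move: (_ * (e2 - _)) (_ * (Y - 2 * A)) (_ * (e2 - _)) (_ * (Y - 2 * A)) (X * Y).
by move=> *; lra.
Qed.

Definition eis_comb (R : realType) (K L : nat) (t : R[i]) : R[i] :=
  eisenstein (2 * K) t * eisenstein (2 * L) t + eisenstein (2 * (K + L)) t.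

Lemma eis_comb_circle (R : realType) (K L : nat) (t : R[i]) : in_dom t ->
  normc t = 1 -> (5 <= K)%N -> (5 <= L)%N ->
  complex.Im (t ^+ (K + L) * eis_comb K L t) = 0 /\
  complex.Re (t ^+ (K + L) * eis_comb K L t) =
    complex.Re (t ^+ K * eisenstein (2 * K) t) * complex.Re (t ^+ L * eisenstein (2 * L) t)
    + complex.Re (t ^+ (K + L) * eisenstein (2 * (K + L)) t).
Proof.
move=> hd t1 K5 L5.
have -> : t ^+ (K + L) * eis_comb K L t =
   (t ^+ K * eisenstein (2 * K) t) * (t ^+ L * eisenstein (2 * L) t) +
   t ^+ (K + L) * eisenstein (2 * (K + L)) t.
  by rewrite /eis_comb mulrDr exprD mulrACA.
have hK : (10 <= 2 * K)%N by lia.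
have hL : (10 <= 2 * L)%N by lia.
have hM : (10 <= 2 * (K + L))%N by lia.
rewrite cReD cImD (cReM (t ^+ K * _) (t ^+ L * _)) (cImM (t ^+ K * _) (t ^+ L * _)).
by rewrite !eis_circle_real // !mulr0 !mul0r subr0 !addr0.
Qed.

(** Because [t^L = t^(K+L) conjc (t^K)], when [t^(K+L)] is near 1 or -1 the leading parts of the two
    factors agree up to sign, and one of the two preceding real estimates applies. *)
Lemma arc_sign (R : realType) (K L : nat) (t : R[i]) : in_dom t -> normc t = 1 ->
  complex.Re t <= 0 -> (5 <= K)%N -> (5 <= L)%N ->
  `|complex.Im (t ^+ (K + L))| <= 1 / 100 ->
  9 / 100 <= complex.Re (t ^+ (K + L) * eis_comb K L t) * complex.Re (t ^+ (K + L)).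
Proof.
move=> hd t1 x0 K5 L5 S1; have t0 : t != 0 by rewrite -normc_gt0 t1.
rewrite (eis_comb_circle hd t1 K5 L5).2.
have M5 : (5 <= K + L)%N by lia.
have h1 := arc_eis hd t1 x0 K5; have h2 := arc_eis hd t1 x0 L5.
have h3 := arc_eis hd t1 x0 M5.
have q1 : 1 <= 2 + 2 * complex.Re t by case: hd => /andP[] ? ? _ _; lra.
have X01 n : 0 <= (2 + 2 * complex.Re t) ^- n <= 1.
  have n0 : 0 < (2 + 2 * complex.Re t) ^+ n by rewrite exprn_gt0 //; lra.
  by rewrite invr_ge0 (ltW n0) invf_le1 // exprn_ege1.
have nK : complex.Re (t ^+ K) ^+ 2 + complex.Im (t ^+ K) ^+ 2 = 1.
  by rewrite -normc_sqr normcX t1 !expr1n.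
have nM : complex.Re (t ^+ (K + L)) ^+ 2 + complex.Im (t ^+ (K + L)) ^+ 2 = 1.
  by rewrite -normc_sqr normcX t1 !expr1n.
have tL : complex.Re (t ^+ L) = complex.Re (t ^+ (K + L)) * complex.Re (t ^+ K) +
    complex.Im (t ^+ (K + L)) * complex.Im (t ^+ K).
  have -> : t ^+ L = t ^+ (K + L) * conjc (t ^+ K).
    rewrite rmorphXn /= -circle_inv // exprVn exprD mulrAC mulfV ?mul1r //.
    by rewrite expf_neq0.
  by rewrite cReM cReJ cImJ; ring.
have XX : (2 + 2 * complex.Re t) ^- (K + L) =
    (2 + 2 * complex.Re t) ^- K * (2 + 2 * complex.Re t) ^- L by rewrite exprD invfM.
rewrite tL in h2; rewrite XX in h3.
have A1 : complex.Re (t ^+ K) ^+ 2 <= 1 by rewrite -nK lerDl sqr_ge0.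
have A2 : `|complex.Im (t ^+ K)| <= 1.
  rewrite -(@ler_sqr _ _ 1) ?nnegrE // real_normK ?num_real // expr1n.
  by rewrite -nK lerDr sqr_ge0.
have XY := @arc_gap R t (K + L) hd t1 x0; rewrite XX in XY.
have S2 : complex.Im (t ^+ (K + L)) ^+ 2 <= 1 / 10000.
  have := ler_pM (normr_ge0 _) (normr_ge0 _) S1 S1.
  by rewrite -expr2 real_normK ?num_real //; clear; move: (_ ^+ 2) => *; lra.
have gap : complex.Re (t ^+ (K + L)) <= - (9999 / 10000) ->
    normc (t ^+ (K + L) + 1) <= 2 / 100.
  move=> C1; apply: normc_le; first by clear; lra.
  rewrite cReD cImD /=; move: nM S2 C1; clear.
  by move: (complex.Re _) (complex.Im _) => C S *; nra.
have Cb : complex.Re (t ^+ (K + L)) ^+ 2 <= 1 by rewrite -nM lerDl sqr_ge0.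
have Cc : 9999 / 10000 <= complex.Re (t ^+ (K + L)) ^+ 2.
  by move: nM S2; clear; move: (_ ^+ 2) (_ ^+ 2) => *; lra.
case: (lerP 0 (complex.Re (t ^+ (K + L)))) => C0.
  have CC : 9999 / 10000 <= complex.Re (t ^+ (K + L)) <= 1.
    move: C0 Cb Cc; clear; move: (complex.Re _) => C C0 Cb Cc; apply/andP; split; nra.
  have := arc_pos_real (X01 K) (X01 L) A1 A2 S1 CC h1 h2 h3.
  case/andP: CC; clear; move: (complex.Re (t ^+ _)) (_ + _) => C u C0 _ hu.
  by nra.
have CC : - 1 <= complex.Re (t ^+ (K + L)) <= - (9999 / 10000).
  move: C0 Cb Cc; clear; move: (complex.Re _) => C C0 Cb Cc; apply/andP; split; nra.
have XY' := XY (gap (andP CC).2).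
have := arc_neg_real (X01 K) (X01 L) XY' A1 A2 S1 CC h1 h2 h3.
case/andP: CC; clear; move: (complex.Re (t ^+ _)) (_ + _) => C u _ C0 hu.
by nra.
Qed.

Lemma eis_comb_lipschitz (R : realType) (K L : nat) : (5 <= K)%N -> (5 <= L)%N ->
  exists2 A : R, 1 <= A & forall t t' : R[i], in_dom t -> in_dom t' ->
    normc (eis_comb K L t) <= A /\
    normc (eis_comb K L t - eis_comb K L t') <= A * normc (t - t').
Proof.
move=> K5 L5.
have hK : (10 <= 2 * K)%N by lia.
have hL : (10 <= 2 * L)%N by lia.
have hM : (10 <= 2 * (K + L))%N by lia.
have [a1 a10 Ha1] := @eis_lipschitz R _ hK; have [b1 b10 Hb1] := @eis_bounded R _ hK.
have [a2 a20 Ha2] := @eis_lipschitz R _ hL; have [b2 b20 Hb2] := @eis_bounded R _ hL.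
have [a3 a30 Ha3] := @eis_lipschitz R _ hM; have [b3 b30 Hb3] := @eis_bounded R _ hM.
exists (1 + (b1 * b2 + b3) + (a1 * b2 + b1 * a2 + a3)).
  by rewrite -addrA lerDl !addr_ge0 ?mulr_ge0.
move=> t t' dt dt'; rewrite /eis_comb; split.
  rewrite (le_trans (le_normcD _ _)) // normcM.
  apply: (@le_trans _ _ (b1 * b2 + b3)).
    by apply: lerD (Hb3 _ dt); apply: ler_pM (Hb1 _ dt) (Hb2 _ dt); rewrite normc_ge0.
  have : 0 <= a1 * b2 + b1 * a2 + a3 by rewrite !addr_ge0 ?mulr_ge0.
  by clear; move: (_ + b3) (_ + a3) => *; lra.
set e1 := eisenstein _ t; set e2 := eisenstein _ t; set e3 := eisenstein _ t.
set f1 := eisenstein _ t'; set f2 := eisenstein _ t'; set f3 := eisenstein _ t'.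
have -> : e1 * e2 + e3 - (f1 * f2 + f3) = (e1 - f1) * e2 + f1 * (e2 - f2) + (e3 - f3).
  by ring.
have n0 := normc_ge0 (t - t').
apply: (@le_trans _ _ ((a1 * b2 + b1 * a2 + a3) * normc (t - t'))); last first.
  rewrite ler_wpM2r // lerDr !addr_ge0 ?mulr_ge0 //.
apply: le_trans (le_normcD _ _) _; rewrite [leRHS]mulrDl.
apply: lerD; last exact: Ha3.
apply: le_trans (le_normcD _ _) _; rewrite [leRHS]mulrDl; apply: lerD.
  rewrite (normcM (e1 - f1)) [leRHS]mulrAC; apply: ler_pM; rewrite ?normc_ge0 //.
    exact: Ha1.
  exact: Hb2.
rewrite (normcM f1) -[leRHS]mulrA; apply: ler_pM; rewrite ?normc_ge0 //.
  exact: Hb1.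
exact: Ha2.
Qed.

(** * The quotient by [sig] near the circle *)

Definition sig (R : realType) (M : nat) (t : R[i]) : R[i] := 1 - t ^- (2 * M).

Lemma sig_neq0 (R : realType) (M : nat) (t : R[i]) : (0 < M)%N -> 1 < normc t ->
  sig M t != 0.
Proof.
move=> M0 t1; rewrite subr_eq0; apply/eqP => h.
have := congr1 (@normc R) h; rewrite normc1 normcXV => /esym.
apply/eqP; rewrite lt_eqF // invf_lt1; last by rewrite exprn_gt0; lra.
by rewrite exprn_egt1 //; lia.
Qed.

Lemma pow_lipschitz (R : realType) (x : R) n : 1 <= x -> x <= 2 ->
  x ^+ n <= 1 + n%:R * 2 ^+ n * (x - 1).
Proof.
move=> x1 x2; elim: n => [|n IH]; first by rewrite expr0 !mul0r addr0.
have p1 : x ^+ n <= 2 ^+ n by apply: lerXn2r; rewrite ?nnegrE; lra.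
have -> : x ^+ n.+1 = x ^+ n + (x - 1) * x ^+ n by rewrite exprS; ring.
have h : (x - 1) * x ^+ n <= (x - 1) * 2 ^+ n by rewrite ler_wpM2l // subr_ge0.
have h2 : 0 <= n%:R * 2 ^+ n * (x - 1) by rewrite !mulr_ge0 ?subr_ge0 ?exprn_ge0.
have h3 : 0 <= 2 ^+ n * (x - 1) by rewrite mulr_ge0 ?subr_ge0 ?exprn_ge0.
rewrite exprS -natr1; move: IH h h2 h3; clear.
by move: (x ^+ n) (2 ^+ n) (n%:R : R) => *; lra.
Qed.

(** Multiplying [sig] by [P g] gives [P g - conjc g / P], with real part [al C] and imaginary part
    [be S]. As [r] tends to 1, [al] tends to 0 and [be] to 2. *)
Lemma polar_quotient (R : realType) (M : nat) (t f : R[i]) (r : R) : 0 < r ->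
  normc t = 1 ->
  let g := t ^+ M in let P := r ^+ M in
  let u := complex.Re (g * f) in let w := complex.Im (g * f) in
  let C := complex.Re g in let S := complex.Im g in
  let al := P - P^-1 in let be := P + P^-1 in
  complex.Re (f / sig M (r%:C * t)) =
    P * (u * (al * C) + w * (be * S)) / ((al * C) ^+ 2 + (be * S) ^+ 2).
Proof.
move=> r0 t1 g P u w C S al be.
have P0 : 0 < P by rewrite exprn_gt0.
have t0 : t != 0 by rewrite -normc_gt0 t1.
have g0 : g != 0 by rewrite expf_neq0.
have PC0 : (P%:C : R[i]) != 0 by rewrite (eq_complex P%:C 0) /= eqxx andbT gt_eqF.
have gV : g^-1 = conjc g.
  by rewrite /g rmorphXn /= -circle_inv // exprVn.
have -> : sig M (r%:C * t) = ((al * C) +i* (be * S)) / (P%:C * g).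
  have -> : (al * C) +i* (be * S) = P%:C * g - (P^-1)%:C * conjc g.
    by apply: eq_ReIm; rewrite ?cReD ?cImD ?cReN ?cImN ?cReM ?cImM ?cReJ ?cImJ /= -/C -/S /al /be; ring.
  rewrite /sig mul2n -addnn exprD !exprMn -rmorphXn -/P -/g -gV fmorphV.
  by field; rewrite g0.
rewrite invf_div.
have -> : f * (P%:C * g / ((al * C) +i* (be * S))) =
    P%:C * (g * f / ((al * C) +i* (be * S))) by rewrite !mulrA (mulrC f) (mulrAC _ f g).
rewrite cReM cImC mul0r subr0 cReC -[RHS]mulrA; congr (_ * _).
by rewrite cReM -/u -/w /=; ring.
Qed.

(** [x] is [r - 1], [F] the value of [u] on the circle, and [w] is of order [x] since it vanishes
    there. If [|S|] is at most [(100 A T)^-1], then [al u C >= 4/100 x] outweighs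
    [|w be S| <= 2/100 x]. Otherwise the denominator is bounded below while the numerator is of
    order [x]. *)
Lemma arc_lim_real (R : realType) (A T N d u w F C S P x : R) :
  1 <= A -> 1 <= T -> 0 <= N -> 0 < d -> 0 < x ->
  1 + x <= P -> P <= 1 + N * T * x -> P <= T ->
  `|C| <= 1 -> `|S| <= 1 -> `|u| <= A -> `|w| <= A * x -> `|u - F| <= A * x ->
  (`|S| <= 1 / 100 -> 9 / 100 <= F * C) ->
  A * x <= 1 / 20 ->
  2 * A * T ^+ 2 * (N + 1) * x <= d * (100 * A * T) ^- 2 ->
  - d <= P * (u * ((P - P^-1) * C) + w * ((P + P^-1) * S)) /
     (((P - P^-1) * C) ^+ 2 + ((P + P^-1) * S) ^+ 2).
Proof.
move=> A1 T1 N0 d0 x0 P1 P2 PT C1 S1 uA wA uF FC Ax dx.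
have P0 : 0 < P by lra.
have PV1 : P^-1 <= 1 by rewrite invf_le1 //; lra.
have PV0 : 0 < P^-1 by rewrite invr_gt0.
have PV2 : 1 - P^-1 <= P - 1.
  have e : P * P^-1 = 1 by rewrite mulfV // gt_eqF.
  by move: e P1 PV0 PV1 x0; clear; move: (P^-1) => q *; nra.
have al0 : x <= P - P^-1 by lra.
have al1 : P - P^-1 <= 2 * N * T * x by lra.
have be1 : P + P^-1 <= 2 * T by lra.
have be0 : 1 <= P + P^-1 by lra.
move: (P - P^-1) (P + P^-1) al0 al1 be0 be1 => al be al0 al1 be0 be1.
clear PV1 PV0 PV2 P2 P1.
have s0 : 0 < (100 * A * T)^-1 by rewrite invr_gt0 !mulr_gt0 //; lra.
have den0 : 0 <= (al * C) ^+ 2 + (be * S) ^+ 2 by rewrite addr_ge0 ?sqr_ge0.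
have AT1 : 1 <= A * T by rewrite mulr_ege1.
have wb : `|w * be| <= A * x * (2 * T).
  rewrite normrM ler_pM // ger0_norm //; lra.
case: (lerP `|S| (100 * A * T)^-1) => hS.
  apply: (@le_trans _ _ 0); first by rewrite oppr_le0 ltW.
  apply: divr_ge0 => //; apply: mulr_ge0; first exact: ltW.
  have S100 : `|S| <= 1 / 100.
    apply: (le_trans hS); rewrite div1r lef_pV2 ?posrE ?mulr_gt0 //; lra.
  have hFC := FC S100.
  have h1 : `|(u - F) * C| <= 1 / 20.
    by rewrite normrM -[leRHS]mulr1 ler_pM // (le_trans uF).
  have h2 : 4 / 100 <= u * C.
    by move: h1 hFC; clear; rewrite ler_norml mulrBl; move: (F * C) (u * C) => *; lra.
  have h3 : `|w * be * S| <= x * (2 / 100).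
    rewrite normrM (@le_trans _ _ (A * x * (2 * T) * (100 * A * T)^-1)) //.
      by rewrite ler_pM.
    have -> : A * x * (2 * T) * (100 * A * T)^-1 = x * (2 / 100); last exact.
    by field; rewrite !gt_eqF //; lra.
  have h4 : al * (4 / 100) <= al * (u * C) by rewrite ler_wpM2l //; lra.
  have -> : u * (al * C) + w * (be * S) = al * (u * C) + w * be * S by ring.
  move: h3 h4 al0 x0; clear; rewrite ler_norml; move: (w * be * S) (al * (u * C)).
  by move=> *; lra.
have den1 : (100 * A * T) ^- 2 <= (al * C) ^+ 2 + (be * S) ^+ 2.
  have h1 : (100 * A * T)^-1 ^+ 2 <= `|be * S| ^+ 2.
    apply: lerXn2r; rewrite ?nnegrE ?(ltW s0) //.
    rewrite normrM (le_trans (ltW hS)) // ler_peMl // ger0_norm //; lra.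
  rewrite -exprVn (le_trans h1) // real_normK ?num_real // lerDr sqr_ge0 //.
have s20 : 0 < (100 * A * T) ^- 2 by rewrite -exprVn exprn_gt0.
have den2 := lt_le_trans s20 den1.
rewrite ler_pdivlMr //.
have num : - (A * (2 * N * T * x) + A * x * (2 * T)) <= u * (al * C) + w * (be * S).
  have h1 : `|u * al * C| <= A * (2 * N * T * x).
    rewrite normrM -[leRHS]mulr1 ler_pM // normrM ler_pM // ger0_norm //; lra.
  have h2 : `|w * be * S| <= A * x * (2 * T).
    by rewrite normrM -[leRHS]mulr1 ler_pM.
  have -> : u * (al * C) + w * (be * S) = u * al * C + w * be * S by ring.
  move: h1 h2; clear; rewrite !ler_norml; move: (u * al * C) (w * be * S).
  by move: (A * (2 * N * T * x)) (A * x * (2 * T)) => *; lra.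
have num2 : - (T * (A * (2 * N * T * x) + A * x * (2 * T))) <=
    P * (u * (al * C) + w * (be * S)).
  apply: (@le_trans _ _ (P * - (A * (2 * N * T * x) + A * x * (2 * T)))).
    rewrite mulrN lerN2 ler_wpM2r // addr_ge0 ?mulr_ge0 //; lra.
  by rewrite ler_wpM2l // ltW.
apply: le_trans num2; rewrite mulNr lerN2.
apply: (@le_trans _ _ (d * (100 * A * T) ^- 2)); last by rewrite ler_wpM2l // ltW.
apply: le_trans dx.
by have -> : T * (A * (2 * N * T * x) + A * x * (2 * T)) =
  2 * A * T ^+ 2 * (N + 1) * x by ring.
Qed.

Lemma Im_dist (R : realType) (a b : R[i]) (x : R) :
  normc (a - b) <= x -> complex.Im b = 0 -> `|complex.Im a| <= x.
Proof.
move=> h b0; have := le_trans (Im_normc _) h.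
by rewrite cImD cImN b0 oppr0 addr0.
Qed.

Lemma Re_dist (R : realType) (a b : R[i]) (x : R) :
  normc (a - b) <= x -> `|complex.Re a - complex.Re b| <= x.
Proof. by move=> h; have := le_trans (Re_normc _) h; rewrite cReD cReN. Qed.

Lemma arc_lim (R : realType) (K L : nat) (d : R) : (5 <= K)%N -> (5 <= L)%N -> 0 < d ->
  exists2 e : R, 0 < e & forall tau : R[i], in_dom tau -> complex.Re tau <= 0 ->
    1 < normc tau -> normc tau <= 1 + e ->
    - d <= complex.Re (eis_comb K L tau / sig (K + L) tau).
Proof.
move=> K5 L5 d0; have [A A1 HA] := @eis_comb_lipschitz R K L K5 L5.
set M := (K + L)%N; pose T : R := 2 ^+ M.
have M0 : (0 < M)%N by rewrite /M; lia.
have T1 : 1 <= T by rewrite exprn_ege1 // ler1n.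
pose D := d * (100 * A * T) ^- 2 / (2 * A * T ^+ 2 * (M%:R + 1)).
have A0 : 0 < A by lra.
have T0 : 0 < T by lra.
have c0 : 0 < 2 * A * T ^+ 2 * (M%:R + 1).
  by rewrite !mulr_gt0 ?exprn_gt0 // ltr_wpDl.
have D0 : 0 < D by rewrite divr_gt0 // mulr_gt0 // -exprVn exprn_gt0 // invr_gt0 !mulr_gt0.
(* The last two bounds are the final hypotheses of [arc_lim_real] solved for [x]. *)
exists (Order.min 1 (Order.min (1 / 20 / A) D)).
  by rewrite !lt_min ltr01 D0 !divr_gt0.
move=> tau hd x0 r1 re.
set r := normc tau in r1 re *.
have r0 : 0 < r by lra.
(* The radial projection to the circle stays in [in_dom], as it only moves the real part towards
   0. *)
pose t : R[i] := (r^-1)%:C * tau.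
have tE : tau = r%:C * t.
  by rewrite /t mulrA -rmorphM mulfV ?mul1r // gt_eqF.
have t1 : normc t = 1.
  rewrite /t normcM normc_real ger0_norm ?invr_ge0 ?(ltW r0) //.
  by rewrite -/r mulVf // gt_eqF.
have tx : complex.Re t = r^-1 * complex.Re tau by rewrite /t cReM cReC cImC mul0r subr0.
have ty : complex.Im t = r^-1 * complex.Im tau by rewrite /t cImM cReC cImC mul0r addr0.
have rV0 : 0 < r^-1 by rewrite invr_gt0.
have rV1 : r^-1 <= 1 by rewrite invf_le1 // ltW.
have tD : in_dom t.
  case: (hd) => /andP[h1 h2] h3 _; split.
  - by rewrite tx; move: h1 h2 x0 rV0 rV1; clear => *; apply/andP; split; nra.
  - by rewrite ty mulr_gt0.
  - by rewrite -normc_sqr t1 expr1n.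
have tx0 : complex.Re t <= 0 by rewrite tx pmulr_rle0.
have dt : normc (tau - t) = r - 1.
  have -> : tau - t = (r - 1)%:C * t by rewrite {1}tE rmorphB mulrBl mul1r.
  by rewrite normcM t1 mulr1 normc_real ger0_norm // subr_ge0 ltW.
have [fA fL] := HA tau t hd tD; rewrite dt in fL.
rewrite [in sig _ _]tE polar_quotient //.
have g1 : normc (t ^+ M) = 1 by rewrite normcX t1 expr1n.
have [im0 _] := eis_comb_circle tD t1 K5 L5.
have hs := @arc_sign R K L t tD t1 tx0 K5 L5.
rewrite -/M in im0 hs.
have diff : normc (t ^+ M * eis_comb K L tau - t ^+ M * eis_comb K L t) <= A * (r - 1).
  by rewrite -mulrBr normcM g1 mul1r.
move: re; rewrite -lerBlDl !le_min => /and3P[re re1 re2].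
apply: (@arc_lim_real R A T M%:R d _ _ (complex.Re (t ^+ M * eis_comb K L t)) _ _ _ (r - 1)) => //.
- by rewrite subr_gt0.
- by rewrite addrC subrK ler_eXnr // ltW.
- by apply: pow_lipschitz; [exact: ltW | lra].
- by apply: lerXn2r; rewrite ?nnegrE ?(ltW r0) //; lra.
- by rewrite (le_trans (Re_normc _)) // g1.
- by rewrite (le_trans (Im_normc _)) // g1.
- by rewrite (le_trans (Re_normc _)) // normcM g1 mul1r.
- exact: Im_dist diff im0.
- exact: Re_dist diff.
- by rewrite mulrC -ler_pdivlMr.
- by rewrite mulrC -ler_pdivlMr.
Qed.

(** * The quotient on the vertical lines and for large imaginary part *)

Lemma cReV (R : realType) (z : R[i]) : complex.Re z^-1 = complex.Re z / normc z ^+ 2.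
Proof. by rewrite normc_sqr; case: z. Qed.

Lemma quot_reflect (R : realType) (K L : nat) (t : R[i]) : in_dom t ->
  (5 <= K)%N -> (5 <= L)%N ->
  complex.Re (eis_comb K L (- conjc t) / sig (K + L) (- conjc t)) =
  complex.Re (eis_comb K L t / sig (K + L) t).
Proof.
move=> hd K5 L5.
have hK : (10 <= 2 * K)%N by lia.
have hL : (10 <= 2 * L)%N by lia.
have hM : (10 <= 2 * (K + L))%N by lia.
have -> : eis_comb K L (- conjc t) = conjc (eis_comb K L t).
  rewrite /eis_comb !eis_reflect //.
  by move: (eisenstein _ _) (eisenstein _ _) (eisenstein _ _) => a b c; rewrite rmorphD rmorphM.
have -> : sig (K + L) (- conjc t) = conjc (sig (K + L) t).
  rewrite /sig even_powN ?mul2n ?odd_double // -conjc_invX.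
  by move: (t ^- _) => u; rewrite rmorphB rmorph1.
move: (eis_comb K L t) (sig _ _) => a b.
by rewrite -fmorphV -rmorphM cReJ.
Qed.

Lemma comb_line (R : realType) (K L : nat) (s : R) : 0 < s ->
  (5 <= K)%N -> (5 <= L)%N ->
  0 < complex.Re (eis_comb K L (line_pt s)) /\ complex.Im (eis_comb K L (line_pt s)) = 0.
Proof.
move=> s0 K5 L5; have hd := line_pt_in_dom (ltW s0).
have p n : (5 <= n)%N -> 0 < complex.Re (eisenstein (2 * n) (line_pt s)) /\
     complex.Im (eisenstein (2 * n) (line_pt s)) = 0.
  move=> n5; have n10 : (10 <= 2 * n)%N by lia.
  split; first by apply: eis_line_pos => //; rewrite mul2n odd_double.
  by apply: eis_line => //; exact: line_conj.
have M5 : (5 <= K + L)%N by lia.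
have [a1 b1] := p K K5; have [a2 b2] := p L L5; have [a3 b3] := p _ M5.
rewrite /eis_comb; move: a1 b1 a2 b2 a3 b3.
move: (eisenstein _ _) (eisenstein _ _) (eisenstein _ _) => x y z a1 b1 a2 b2 a3 b3.
rewrite cReD cImD cReM cImM b1 b2 b3 !mulr0 !mul0r subr0 !addr0; split => //.
by rewrite addr_gt0 ?mulr_gt0.
Qed.

(** The lower bound is stated with [1 - |t|^-2], independent of [M], since the same quantity
    measures closeness to the circle in [barrier_line]. *)
Lemma sig_bounds (R : realType) (M : nat) (t : R[i]) : (0 < M)%N -> 1 < normc t ->
  1 - normc t ^- 2 <= complex.Re (sig M t) /\ normc (sig M t) <= 2.
Proof.
move=> M0 t1.
have h : normc (t ^- (2 * M)) <= normc t ^- 2.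
  rewrite normcXV lef_pV2 ?posrE ?exprn_gt0 //; try lra.
  by apply: ler_weXn2l; [exact: ltW | lia].
have h1 : normc t ^- 2 <= 1 by rewrite invf_le1 ?exprn_gt0 ?exprn_ege1 ?ltW //; lra.
split.
  rewrite /sig; move: h; move: (t ^- _) => u h.
  rewrite cReD cReN (_ : complex.Re 1 = 1) // lerD2l lerN2.
  by rewrite (le_trans _ h) // (le_trans (ler_norm _)) ?Re_normc.
rewrite /sig (le_trans (le_normcD _ _)) // normcN normc1.
by move: h h1; clear; move: (normc _) (_ ^- 2) => *; lra.
Qed.

(** The numerator is real on the line, so the real part is the numerator times [Re sig / |sig|^2],
    and [|sig|^2 <= 4]. *)
Lemma line_quot (R : realType) (K L : nat) (s c : R) : 0 < s ->
  (5 <= K)%N -> (5 <= L)%N -> 1 < normc (line_pt s) ->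
  0 <= c -> c <= complex.Re (eis_comb K L (line_pt s)) ->
  c * (1 - normc (line_pt s) ^- 2) / 4 <=
    complex.Re (eis_comb K L (line_pt s) / sig (K + L) (line_pt s)).
Proof.
move=> s0 K5 L5 n1 c0 hc; have [f0 i0] := comb_line s0 K5 L5.
have M0 : (0 < K + L)%N by lia.
have [h1 h2] := sig_bounds M0 n1; have sn := sig_neq0 M0 n1.
have h3 : 0 <= 1 - normc (line_pt s) ^- 2.
  rewrite subr_ge0 invf_le1 ?exprn_gt0 ?exprn_ege1 ?ltW //; lra.
rewrite cReM i0 mul0r subr0 cReV -mulrA.
apply: ler_pM => //; first by rewrite divr_ge0.
apply: ler_pM => //.
have n0 : 0 < normc (sig (K + L) (line_pt s)) by rewrite normc_gt0.
rewrite lef_pV2 ?posrE ?exprn_gt0 //.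
have := ler_pM (normc_ge0 _) (normc_ge0 _) h2 h2; rewrite -expr2.
by move: (normc _ ^+ 2) => u; clear; lra.
Qed.

(** Compactness of the segment is enough: away from the corner no explicit bound is needed. *)
Lemma line_lower (R : realType) (K L : nat) (s1 : R) : (5 <= K)%N -> (5 <= L)%N ->
  0 < s1 -> exists2 c : R, 0 < c & forall s, s1 <= s <= 2 ->
    c <= complex.Re (eis_comb K L (line_pt s)).
Proof.
move=> K5 L5 s10; have [A A1 HA] := @eis_comb_lipschitz R K L K5 L5.
case: (lerP s1 2) => s12; last first.
  by exists 1 => // s /andP[a b]; move: (le_lt_trans (le_trans a b) s12); rewrite ltxx.
have A0 : 0 < A by lra.
have cf : {within `[s1, 2], continuous (fun s : R => complex.Re (eis_comb K L (line_pt s)))}.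
  apply/subspace_continuousP => s; rewrite /= in_itv /= => /andP[s1s _].
  apply/cvgrPdist_le => e e0; rewrite near_withinE.
  exists (e / A) => /=; first by rewrite divr_gt0.
  move=> s' /= hs; rewrite in_itv /= => /andP[s1s' _].
  have d1 := line_pt_in_dom (le_trans (ltW s10) s1s).
  have d2 := line_pt_in_dom (le_trans (ltW s10) s1s').
  apply: (le_trans (Re_dist (HA _ _ d1 d2).2)).
  have -> : line_pt s - line_pt s' = (s - s') *i.
    by apply: eq_ReIm; rewrite /=; ring.
  rewrite /= expr0n add0r sqrtr_sqr mulrC -ler_pdivlMr //.
  exact: ltW.
have [c hc hm] := EVT_min s12 cf.
exists (complex.Re (eis_comb K L (line_pt c))).
  apply: (comb_line _ K5 L5).1; move: hc; rewrite in_itv /= => /andP[h _].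
  exact: lt_le_trans h.
by move=> s hs; apply: hm; rewrite in_itv.
Qed.

Lemma normc_ge_Im (R : realType) (z : R[i]) : complex.Im z <= normc z.
Proof. exact: le_trans (ler_norm _) (Im_normc z). Qed.

(** Each series is within [22 / 1000 + 3 / 1024] of 1 and [sig] within [1 / 1024] of 1, so the
    quotient is close to 2. *)
Lemma top_quot (R : realType) (K L : nat) (t : R[i]) : in_dom t -> 2 <= complex.Im t ->
  (5 <= K)%N -> (5 <= L)%N ->
  1 <= complex.Re (eis_comb K L t / sig (K + L) t).
Proof.
move=> hd y2 K5 L5.
have pw (z : R[i]) k : (10 <= k)%N -> complex.Im z = complex.Im t -> normc (z ^- k) <= 1024^-1.
  move=> k10 hz; rewrite normcXV (le_trans (inv_pow_le10 (x := 2) _ _ k10)) //.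
  - by lra.
  - by rewrite (le_trans y2) // -hz normc_ge_Im.
  - by lra.
have E n : (5 <= n)%N -> normc (eisenstein (2 * n) t - 1) <= 26 / 1000.
  move=> n5; have n10 : (10 <= 2 * n)%N by lia.
  have hk : ~~ odd (2 * n) by rewrite mul2n odd_double.
  have h := eis_approx hd n10 hk.
  have h1 := pw t _ n10 erefl.
  have h2 := pw (t + 1) _ n10 (_ : _ = _); rewrite cImD addr0 in h2.
  have h3 := pw (t - 1) _ n10 (_ : _ = _); rewrite cImD cImN /= oppr0 addr0 in h3.
  move: (h2 erefl) (h3 erefl) h1 h => {}h2 {}h3.
  rewrite /main_terms; move: (eisenstein _ _) (t ^- _) ((t + 1) ^- _) ((t - 1) ^- _) h2 h3.
  move=> e a b c h2 h3 h1 h.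
  have -> : e - 1 = (e - (1 + a + b + c)) + (a + b + c) by ring.
  rewrite (le_trans (le_normcD _ _)) //.
  have := le_normcD (a + b) c; have := le_normcD a b; move: h h1 h2 h3; clear.
  by move: (normc _) (normc _) (normc _) (normc _) (normc _) (normc _) => *; lra.
have M5 : (5 <= K + L)%N by lia.
have s1 : normc (sig (K + L) t - 1) <= 1024^-1.
  have M10 : (10 <= 2 * (K + L))%N by lia.
  have := pw t _ M10 erefl; rewrite /sig; move: (t ^- _) => u.
  have -> : 1 - u - 1 = - u by ring.
  by rewrite normcN.
move: (E _ K5) (E _ L5) (E _ M5) s1; rewrite /eis_comb; clear.
move: (eisenstein _ _) (eisenstein _ _) (eisenstein _ _) (sig _ _) => z y x w hx hy hz hw.
have hf : normc (x * y + z - 2) <= 8 / 100.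
  have -> : x * y + z - 2 = (x - 1) * (y - 1) + (x - 1) + (y - 1) + (z - 1) by ring.
  rewrite (le_trans (le_normcD _ _)) //.
  have := le_normcD ((x - 1) * (y - 1) + (x - 1)) (y - 1).
  have := le_normcD ((x - 1) * (y - 1)) (x - 1); rewrite normcM.
  have := ler_pM (normc_ge0 _) (normc_ge0 _) hx hy; move: hx hy hz.
  move: (normc (x - 1)) (normc (y - 1)) (normc (z - 1)) => a b c; clear.
  by move: (a * b) (normc _) (normc _) => *; lra.
move: (x * y + z) hf => f hf.
have w1 : 1 / 2 <= normc w.
  have := le_normcD w (- (w - 1)); have -> : w - (w - 1) = 1 by ring.
  by rewrite normcN normc1; move: hw; clear; move: (normc _) (normc _) => *; lra.
have w0 : w != 0 by rewrite -normc_gt0; lra.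
have h : normc (f / w - 2) <= 1 / 2.
  have -> : f / w - 2 = ((f - 2) - 2 * (w - 1)) / w by field.
  rewrite normcM normcV ler_pdivrMr; last by lra.
  rewrite (le_trans (le_normcD _ _)) // normcN normcM (normc_nat R 2).
  by move: hf hw w1; clear; move: (normc _) (normc _) (normc _) => *; lra.
have := le_trans (Re_normc _) h; rewrite cReD cReN (_ : complex.Re 2 = 2) //.
by rewrite ler_norml; clear; move: (complex.Re _) => *; lra.
Qed.

(** * The barrier *)

(** [t + t^-1] is the Joukowski map: it sends the part of the upper half plane outside the unit
    circle onto the upper half plane, the circle into the real axis and [rho] to -1. The cubic is
    odd and real there, hence its imaginary part vanishes on the circle. *)
Definition barrier (R : realType) (lam : R) (t : R[i]) : R[i] :=
  lam%:C * (t + t^-1) - (t + t^-1) ^+ 3.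

(* [barrier_xi] and [barrier_eta] are the real and imaginary parts of [t + t^-1]. *)
Definition barrier_xi (R : realType) (t : R[i]) : R :=
  complex.Re t * (1 + normc t ^- 2).

Definition barrier_eta (R : realType) (t : R[i]) : R :=
  complex.Im t * (1 - normc t ^- 2).

Lemma barrier_Im (R : realType) (lam : R) (t : R[i]) :
  complex.Im (barrier lam t) = barrier_eta t *
    (lam - 3 * barrier_xi t ^+ 2 + barrier_eta t ^+ 2).
Proof.
have e : t + t^-1 = barrier_xi t +i* barrier_eta t.
  apply: eq_ReIm; rewrite ?cReD ?cImD /barrier_xi /barrier_eta normc_sqr;
    by case: t => x y /=; ring.
rewrite /barrier e; move: (barrier_xi t) (barrier_eta t) => a b.
by rewrite cImD cImN cImM cReC cImC exprS expr2 !cImM !cReM /=; ring.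
Qed.

Lemma normc_gt1_inv (R : realType) (t : R[i]) : 1 < normc t -> 0 < normc t ^- 2 < 1.
Proof.
move=> t1; have h : 1 < normc t ^+ 2 by rewrite exprn_egt1.
by rewrite invr_gt0 invf_lt1 ?h; lra.
Qed.

Lemma barrier_eta_bounds (R : realType) (t : R[i]) : in_dom t -> 1 < normc t ->
  complex.Im t <= 2 -> 0 < barrier_eta t <= 2.
Proof.
move=> [_ y0 _] /normc_gt1_inv /andP[q0 q1] y2; rewrite /barrier_eta.
by move: q0 q1 y0 y2; clear; move: (_ ^- 2) (complex.Im t) => q y *; apply/andP; split; nra.
Qed.

(** The factor 7 is [3 + 2^2], from [lam <= 3] and [barrier_eta t <= 2]. *)
Lemma barrier_le (R : realType) (lam : R) (t : R[i]) : in_dom t -> 1 < normc t ->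
  complex.Im t <= 2 -> lam <= 3 ->
  complex.Im (barrier lam t) <= 7 * barrier_eta t.
Proof.
move=> hd t1 y2 l3; have /andP[e0 e2] := barrier_eta_bounds hd t1 y2.
rewrite barrier_Im; move: e0 e2 l3 (sqr_ge0 (barrier_xi t)); clear.
move: (barrier_eta t) (barrier_xi t ^+ 2) => e z e0 e2 l3 z0.
rewrite mulrC ler_wpM2r //; [exact: ltW | nra].
Qed.

(** From [|Re t| < 1/2] and [1 + |t|^-2 < 2] one gets [|barrier_xi t| < 1], so for [lam = 3] the
    second factor of [barrier_Im] is positive; half of it is given up as [mu]. *)
Lemma barrier_gt0 (R : realType) (t : R[i]) : in_dom t -> 1 < normc t ->
  complex.Im t <= 2 -> `|complex.Re t| < 2^-1 ->
  exists2 mu : R, 0 < mu & 0 < complex.Im (barrier (3 - mu) t).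
Proof.
move=> hd t1 y2 x2; have /andP[e0 _] := barrier_eta_bounds hd t1 y2.
have /andP[q0 q1] := normc_gt1_inv t1.
have xi1 : barrier_xi t ^+ 2 < 1.
  have : `|barrier_xi t| < 1.
    rewrite /barrier_xi normrM [X in _ * X]ger0_norm; last by lra.
    move: x2 q0 q1 (normr_ge0 (complex.Re t)); clear.
    by move: `|_| (_ ^- 2) => x q *; nra.
  move=> h; rewrite -real_normK ?num_real // expr_lt1 //.
pose mu := (3 - 3 * barrier_xi t ^+ 2 + barrier_eta t ^+ 2) / 2.
have mu0 : 0 < mu.
  rewrite /mu; have := sqr_ge0 (barrier_eta t); move: xi1; clear.
  by move: (_ ^+ 2) (_ ^+ 2) => *; lra.
exists mu => //; rewrite barrier_Im mulr_gt0 //.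
have -> : 3 - mu - 3 * barrier_xi t ^+ 2 + barrier_eta t ^+ 2 = mu; last exact.
by rewrite /mu; field.
Qed.

(** With [delta = 1 - |t|^-2], the square of [barrier_xi t] is [(1 - delta / 2)^2] and that of
    [barrier_eta t] at most [4 delta^2]. The second factor of [barrier_Im] is then at most
    [- mu + 3 delta + 13/4 delta^2], hence at most [- mu + 5 delta]. *)
Lemma barrier_line (R : realType) (mu : R) (t : R[i]) : in_dom t -> 1 < normc t ->
  complex.Im t <= 2 -> complex.Re t ^+ 2 = 4^-1 -> 0 < mu ->
  1 - normc t ^- 2 <= 1 / 2 -> 5 * (1 - normc t ^- 2) <= mu ->
  complex.Im (barrier (3 - mu) t) <= 0.
Proof.
move=> hd t1 y2 x2 mu0 h1 h2; have /andP[e0 e2] := barrier_eta_bounds hd t1 y2.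
have /andP[q0 q1] := normc_gt1_inv t1.
rewrite barrier_Im pmulr_rle0 // /barrier_xi /barrier_eta !exprMn x2.
have y4 : complex.Im t ^+ 2 <= 4.
  case: hd => _ y0 _; have := ler_pM (ltW y0) (ltW y0) y2 y2.
  by rewrite -expr2; clear; move: (_ ^+ 2) => *; lra.
have y0 := sqr_ge0 (complex.Im t).
move: h1 h2 q0 q1 y4 y0; clear; move: (_ ^- 2) (complex.Im t ^+ 2) => q y h1 h2 q0 q1 y4 y0.
have : y * (1 - q) ^+ 2 <= 4 * (1 - q) ^+ 2 by rewrite ler_wpM2r ?sqr_ge0.
by nra.
Qed.

Lemma line_coord (R : realType) (t : R[i]) : in_dom t -> 1 < normc t ->
  complex.Re t = - 2^-1 -> complex.Im t <= 2 ->
  exists s : R, [/\ 0 < s, s <= 2, t = line_pt s & 1 - normc t ^- 2 <= 4 * s].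
Proof.
move=> [_ y0 _] t1 x2 y2; have /andP[q1 q2] := sqrt3_bounds R.
have q3 : Num.sqrt 3 ^+ 2 = 3 :> R by rewrite sqr_sqrtr.
have n2 : 1 < normc t ^+ 2 by rewrite exprn_egt1.
have e := normc_sqr t; rewrite x2 in e.
exists (complex.Im t - Num.sqrt 3 / 2).
have tE : t = line_pt (complex.Im t - Num.sqrt 3 / 2).
  by apply: eq_ReIm; rewrite /= ?x2; ring.
have s0 : 0 < complex.Im t - Num.sqrt 3 / 2.
  rewrite subr_gt0 -ltr_sqr ?nnegrE ?(ltW y0) ?divr_ge0 ?sqrtr_ge0 //.
  rewrite exprMn q3; move: n2; rewrite e; move: (complex.Im t ^+ 2); clear => *; lra.
have s2 : complex.Im t - Num.sqrt 3 / 2 <= 2 by lra.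
split => //.
have N1 : normc t ^+ 2 - 1 <= 4 * (complex.Im t - Num.sqrt 3 / 2).
  have -> : normc t ^+ 2 - 1 = (complex.Im t - Num.sqrt 3 / 2) *
      (complex.Im t + Num.sqrt 3 / 2) + (Num.sqrt 3 ^+ 2 - 3) / 4 by rewrite e; field.
  rewrite q3 subrr mul0r addr0 mulrC ler_wpM2r //; first exact: ltW.
  by lra.
apply: le_trans N1; move: n2; clear; move: (normc t ^+ 2) => N N1.
have N0 : 0 < N by lra.
have e : N * N^-1 = 1 by rewrite mulfV // gt_eqF.
have i0 : 0 < N^-1 by rewrite invr_gt0.
by move: e i0; move: (N^-1) => i *; nra.
Qed.

(** * The minimum principle on the truncated domain *)

(** The bound [0 <= p.2] is closed for the sake of compactness; for [rad > 1] it is never attained,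
    so only the two lines, the top and the circle bound the region. *)
Definition region (R : realType) (rad : R) : set (R * R) :=
  [set p | [/\ - 2^-1 <= p.1 <= 2^-1, 0 <= p.2 <= 2 & rad ^+ 2 <= p.1 ^+ 2 + p.2 ^+ 2]].

Lemma region_compact (R : realType) (rad : R) : compact (region rad).
Proof.
have -> : region rad = (`[- 2^-1, 2^-1] `*` `[0, 2]) `&`
    ((fun p : R * R => p.1 ^+ 2 + p.2 ^+ 2) @^-1` [set x | rad ^+ 2 <= x]).
  apply/seteqP; split => p /=; rewrite ?in_itv /=.
    by case=> h1 h2 h3; split.
  by case=> [[]]; rewrite ?in_itv /= => h1 h2 h3; split.
apply: compact_closedI.
  by apply: compact_setX; exact: segment_compact.
apply: preimage_closed; last exact: closed_ge.
move=> p _; apply: cvgD.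
  apply: (@cvg_comp _ _ _ (@fst R R) (fun x => x ^+ 2) _ (nbhs p.1)).
    exact: cvg_fst.
  exact: exprn_continuous.
apply: (@cvg_comp _ _ _ (@snd R R) (fun x => x ^+ 2) _ (nbhs p.2)).
  exact: cvg_snd.
exact: exprn_continuous.
Qed.

Lemma region_in_dom (R : realType) (rad : R) p : 1 < rad -> region rad p ->
  [/\ in_dom (pt p), rad <= normc (pt p) & p.1 ^+ 2 + p.2 ^+ 2 <= 5].
Proof.
case: p => x y r1 [/= /andP[x1 x2] /andP[y1 y2] h].
have hr : 1 < rad ^+ 2 by rewrite exprn_egt1.
have xx : x ^+ 2 <= 1 / 4 by nra.
have y0 : 0 < y.
  rewrite lt_neqAle y1 andbT; apply/eqP => e.
  by move: h; rewrite -e expr0n /= addr0; lra.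
split.
- split => /=; first by apply/andP.
    by [].
  by apply: le_trans h; exact: ltW.
- by apply: (@normc_lower R (pt (x, y))) => //; lra.
- by nra.
Qed.

Lemma region_interior (R : realType) (rad : R) p : 1 < rad -> region rad p ->
  [\/ p.1 = - 2^-1, p.1 = 2^-1, p.2 = 2 | normc (pt p) = rad] \/
  exists2 d, 0 < d & forall h, normc h <= d -> in_dom (pt p + h) /\
    region rad (complex.Re (pt p + h), complex.Im (pt p + h)).
Proof.
move=> r1 Kp; have [hd hn _] := region_in_dom r1 Kp.
case: p Kp hd hn => x y [/= /andP[x1 x2] /andP[y1 y2] h] hd hn.
have [e|nx1] := eqVneq x (- 2^-1); first by left; constructor 1.
have [e|nx2] := eqVneq x (2^-1); first by left; constructor 2.
have [e|ny] := eqVneq y 2; first by left; constructor 3.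
have [e|nr] := eqVneq (normc (pt (x, y))) rad; first by left; constructor 4.
right.
have l1 : 0 < x + 2^-1 by rewrite -[2^-1]opprK subr_gt0 lt_neqAle eq_sym nx1.
have l2 : 0 < 2^-1 - x by rewrite subr_gt0 lt_neqAle nx2.
have l3 : 0 < 2 - y by rewrite subr_gt0 lt_neqAle ny.
have l4 : 0 < normc (pt (x, y)) - rad by rewrite subr_gt0 lt_neqAle eq_sym nr.
exists (Order.min (x + 2^-1) (Order.min (2^-1 - x) (Order.min (2 - y)
   (normc (pt (x, y)) - rad)))); first by rewrite !lt_min l1 l2 l3 l4.
move=> k; rewrite !le_min => /and4P[k1 k2 k3 k4].
have := Re_normc k; have := Im_normc k; rewrite !ler_norml => /andP[i1 i2] /andP[r2 r3].
have K2 : region rad (complex.Re (pt (x, y) + k), complex.Im (pt (x, y) + k)).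
  have y34 : 1 / 2 <= y.
    have hr : 1 < rad ^+ 2 by rewrite exprn_egt1.
    have xx : x ^+ 2 <= 1 / 4 by nra.
    by rewrite -ler_sqr ?nnegrE //; nra.
  have e1 : complex.Re (pt (x, y) + k) = x + complex.Re k by rewrite cReD.
  have e2 : complex.Im (pt (x, y) + k) = y + complex.Im k by rewrite cImD.
  split; rewrite ?[(_, _).1]/= ?[(_, _).2]/=.
  - by rewrite e1; apply/andP; split; lra.
  - by rewrite e2; apply/andP; split; lra.
  - rewrite -normc_sqr; apply: lerXn2r; rewrite ?nnegrE ?normc_ge0 //; first lra.
    have := le_normcD (pt (x, y) + k) (- k); rewrite addrK normcN; lra.
split => //; have [] := region_in_dom r1 K2.
by rewrite /pt /=; case: (_ + k).
Qed.

Lemma line_quot_coord (R : realType) (K L : nat) (t : R[i]) : in_dom t ->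
  (5 <= K)%N -> (5 <= L)%N -> 1 < normc t -> complex.Re t = - 2^-1 \/ complex.Re t = 2^-1 ->
  complex.Im t <= 2 -> exists s : R, [/\ 0 < s, s <= 2, 1 - normc t ^- 2 <= 4 * s &
    forall c, 0 <= c -> c <= complex.Re (eis_comb K L (line_pt s)) ->
      c * (1 - normc t ^- 2) / 4 <= complex.Re (eis_comb K L t / sig (K + L) t)].
Proof.
move=> hd K5 L5 t1 [x2|x2] y2.
  have [s [s0 s2 tE h]] := line_coord hd t1 x2 y2.
  exists s; split => // c c0 hc; rewrite tE; apply: line_quot => //.
  by rewrite -tE.
have nE : normc (- conjc t) = normc t by rewrite normcN normc_conj.
have [||||s [s0 s2 tE h]] := @line_coord R (- conjc t).
- exact: in_dom_reflect.
- by rewrite nE.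
- by rewrite cReN cReJ x2.
- by rewrite cImN cImJ opprK.
rewrite nE in h; exists s; split => // c c0 hc.
rewrite -quot_reflect // -nE tE; apply: line_quot => //.
by rewrite -tE nE.
Qed.

(** The factor ['i] makes subtracting [h] times the imaginary part of the barrier the real part of a
    function that itself has expansions, as [min_principle] requires. *)
Lemma quot_jet (R : realType) (K L : nat) (h lam : R) (t : R[i]) : in_dom t ->
  1 < normc t -> (5 <= K)%N -> (5 <= L)%N ->
  jet (fun w => eis_comb K L w / sig (K + L) w + (h%:C * 'i%C) * barrier lam w) t.
Proof.
move=> hd t1 K5 L5.
have hK : (10 <= 2 * K)%N by lia.
have hL : (10 <= 2 * L)%N by lia.
have hM : (10 <= 2 * (K + L))%N by lia.
have M0 : (0 < K + L)%N by lia.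
have t0 : t != 0 by rewrite -normc_gt0; lra.
have jV : jet (fun w => w^-1) t by apply: (@jet_inv R (fun w => w)) => //; exact: jet_id.
have jz : jet (fun w => w + w^-1) t by apply: jet_add => //; exact: jet_id.
have jN (g : R[i] -> R[i]) : jet g t -> jet (fun w => - g w) t.
  move=> jg; apply: (@jet_ext R (fun w => -1 * g w)) => //.
    by move=> w _; rewrite mulN1r.
  by apply: jet_mul => //; exact: jet_cst.
apply: jet_add; first apply: jet_mul.
- by apply: jet_add; [apply: jet_mul|]; exact: eis_jet.
- apply: jet_inv; first exact: sig_neq0.
  apply: jet_add; first exact: jet_cst.
  apply: jN; apply: (@jet_inv R (fun w => w ^+ _)); first by rewrite expf_neq0.
  by apply: jet_exp; exact: jet_id.
apply: jet_mul; first exact: jet_cst.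
apply: jet_add; first by apply: jet_mul => //; exact: jet_cst.
by apply: jN; apply: jet_exp.
Qed.

Lemma arc_lim_sym (R : realType) (K L : nat) (d : R) : (5 <= K)%N -> (5 <= L)%N ->
  0 < d -> exists2 e : R, 0 < e & forall t : R[i], in_dom t ->
    1 < normc t -> normc t <= 1 + e ->
    - d <= complex.Re (eis_comb K L t / sig (K + L) t).
Proof.
move=> K5 L5 d0; have [e e0 he] := arc_lim K5 L5 d0; exists e => // t hd t1 te.
case: (lerP (complex.Re t) 0) => hx; first exact: he.
rewrite -quot_reflect //; apply: he; rewrite ?normcN ?normc_conj //.
  exact: in_dom_reflect.
by rewrite cReN cReJ oppr_le0 ltW.
Qed.

Lemma inv_sq_gap (R : realType) (x : R) : 0 < x -> 1 - (1 + x) ^- 2 <= 2 * x.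
Proof.
move=> x0; have y0 : 0 < (1 + x) ^+ 2 by rewrite exprn_gt0 //; lra.
rewrite lerBlDl -lerBlDr -[_ ^- 2]mul1r ler_pdivlMr //.
by have := exprn_gt0 3 x0; have := exprn_gt0 2 x0; nra.
Qed.

Lemma eis_comb_neq0 (R : realType) (K L : nat) (t0 : R[i]) : in_dom t0 ->
  (5 <= K)%N -> (5 <= L)%N -> 1 < normc t0 -> `|complex.Re t0| < 2^-1 ->
  complex.Im t0 < 2 -> eis_comb K L t0 != 0.
Proof.
move=> hd0 K5 L5 n0 x0 y0; apply/eqP => f0.
have [mu mu0 v0] := barrier_gt0 hd0 n0 (ltW y0) x0.
(* On the lines, [barrier_line] applies where [1 - |t|^-2 <= k0]; elsewhere the height [s] above the
   corner is at least [k0 / 4], and [line_lower] provides [c]. *)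
pose k0 : R := Order.min (1 / 2) (mu / 5).
have k00 : 0 < k0 by rewrite lt_min !divr_gt0.
have k04 : 0 < k0 / 4 by rewrite divr_gt0.
have [c c0 hc] := line_lower K5 L5 k04.
(* The barrier is at most 14 on the region, so [h] times it stays below the lower bound 1 at the top
   and [c * k0 / 4] on the far part of the lines. *)
pose h : R := Order.min 1 (c * k0 / 4) / 14.
have h0 : 0 < h by rewrite divr_gt0 // lt_min ltr01 !divr_gt0 ?mulr_gt0.
have h14 : 14 * h <= 1 /\ 14 * h <= c * k0 / 4.
  have -> : 14 * h = Order.min 1 (c * k0 / 4) by rewrite /h; field.
  by rewrite !ge_min !lexx orbT.
(* At the zero [t0] the real part of [G] is [- 4 d], whereas the boundary gives at least [- 2 d]: on
   the circle, [- d] from the quotient and [- d] from the barrier. *)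
pose d := h * complex.Im (barrier (3 - mu) t0) / 4.
have d0 : 0 < d by rewrite divr_gt0 // mulr_gt0.
have [e e0 he] := arc_lim_sym K5 L5 d0.
(* The second bound keeps [t0] in the region. The third gives [7 * (4 * ep) * h <= d] for the
   barrier on the inner circle, where [barrier_eta] is at most [4 * ep]. *)
pose ep := Order.min e (Order.min ((normc t0 - 1) / 2) (d / (28 * h))).
have n00 : 0 < normc t0 - 1 by rewrite subr_gt0.
have h280 : 0 < 28 * h by rewrite mulr_gt0.
have ep0 : 0 < ep by rewrite !lt_min e0 (divr_gt0 n00) // (divr_gt0 d0).
have [ep1 ep2 ep3] : [/\ ep <= e, ep <= (normc t0 - 1) / 2 & ep <= d / (28 * h)].
  by rewrite /ep !ge_min !lexx !orbT.
have rad1 : 1 < 1 + ep by rewrite ltrDl.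
pose G := fun w : R[i] => eis_comb K L w / sig (K + L) w +
   (h%:C * 'i%C) * barrier (3 - mu) w.
have GE w : complex.Re (G w) = complex.Re (eis_comb K L w / sig (K + L) w) -
    h * complex.Im (barrier (3 - mu) w).
  rewrite /G; move: (_ / _) (barrier _ _) => a b.
  by case: a b => a1 a2 [b1 b2] /=; ring.
have l3 : 3 - mu <= 3 by rewrite gerBl ltW.
have Gb p : region (1 + ep) p -> - (2 * d) <= complex.Re (G (pt p)) \/
   exists2 d, 0 < d & forall h, normc h <= d -> in_dom (pt p + h) /\
    region (1 + ep) (complex.Re (pt p + h), complex.Im (pt p + h)).
  move=> Kp; have [hd hn _] := region_in_dom rad1 Kp.
  have n1 : 1 < normc (pt p) by exact: lt_le_trans hn.
  have y2 : complex.Im (pt p) <= 2 by case: Kp => _ /andP[_].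
  have /andP[et0 et2] := barrier_eta_bounds hd n1 y2.
  have bl := barrier_le hd n1 y2 l3.
  have /andP[q0 q1] := normc_gt1_inv n1.
  have hb14 : h * complex.Im (barrier (3 - mu) (pt p)) <= 14 * h.
    rewrite mulrC ler_wpM2r ?(ltW h0) //; apply: (le_trans bl).
    by move: et2; clear; move: (barrier_eta _) => u; lra.
  have d2 : - (2 * d) <= 0 by rewrite oppr_le0 mulr_ge0 // ltW.
  have [bd|] := region_interior rad1 Kp; last by right.
  left; rewrite GE.
  have line_case : complex.Re (pt p) = - 2^-1 \/ complex.Re (pt p) = 2^-1 ->
      - (2 * d) <= complex.Re (eis_comb K L (pt p) / sig (K + L) (pt p)) -
        h * complex.Im (barrier (3 - mu) (pt p)).
    move=> xE; apply: (le_trans d2); rewrite subr_ge0.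
    have [s [s0 s2 hs hq]] := line_quot_coord hd K5 L5 n1 xE y2.
    case: (lerP (1 - normc (pt p) ^- 2) k0) => hk.
      apply: (@le_trans _ _ 0).
        rewrite pmulr_rle0 //; apply: barrier_line => //.
        - by case: xE => ->; field.
        - by apply: (le_trans hk); rewrite ge_min lexx.
        - rewrite mulrC -ler_pdivlMr //; apply: (le_trans hk).
          by rewrite ge_min lexx orbT.
      have := hq 0 (lexx _); rewrite !mul0r; apply.
      exact: ltW (comb_line s0 K5 L5).1.
    apply: (le_trans hb14); apply: (le_trans h14.2).
    apply: le_trans (hq c (ltW c0) _).
      by rewrite ler_pM2r // ler_pM2l // ltW.
    apply: hc; rewrite s2 andbT ler_pdivrMr // mulrC.
    by rewrite (le_trans (ltW hk)).
  case: bd => [x1|x1|y1|nE].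
  - by apply: line_case; left.
  - by apply: line_case; right.
  - apply: (le_trans d2); rewrite subr_ge0 (le_trans hb14) // (le_trans h14.1) //.
    by apply: top_quot => //; rewrite /pt /= y1.
  have u0 : - d <= complex.Re (eis_comb K L (pt p) / sig (K + L) (pt p)).
    by apply: he => //; rewrite nE lerD2l.
  have et4 : barrier_eta (pt p) <= 4 * ep.
    have q2 : 1 - normc (pt p) ^- 2 <= 2 * ep.
      by rewrite nE; exact: inv_sq_gap.
    have yy : 0 < complex.Im (pt p) by case: hd.
    apply: (@le_trans _ _ (complex.Im (pt p) * (2 * ep))).
      by rewrite /barrier_eta ler_wpM2l // ltW.
    apply: (@le_trans _ _ (2 * (2 * ep))); last by rewrite mulrA; lra.
    by rewrite ler_wpM2r // mulr_ge0 // ltW.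
  have hb : h * complex.Im (barrier (3 - mu) (pt p)) <= d.
    apply: (@le_trans _ _ (h * (28 * ep))).
      rewrite ler_wpM2l ?(ltW h0) //; apply: (le_trans bl).
      by move: et4; clear; move: (barrier_eta _) => *; lra.
    have -> : h * (28 * ep) = ep * (28 * h) by move: (h) (ep) => u z; ring.
    by rewrite -ler_pdivlMr.
  by move: u0 hb; clear; move: (complex.Re _) (h * _) => *; lra.
have Kt0 : region (1 + ep) (complex.Re t0, complex.Im t0).
  case: (hd0) => x1 y1 _; split => //=.
    by rewrite !ltW.
  rewrite -normc_sqr; apply: lerXn2r; rewrite ?nnegrE ?normc_ge0 //; first lra.
  by move: ep2 n0; clear; move: (ep) => *; lra.
have Kin p : region (1 + ep) p -> in_dom (pt p).
  by move=> Kp; have [] := region_in_dom rad1 Kp.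
have KB p : region (1 + ep) p -> p.1 ^+ 2 + p.2 ^+ 2 <= 5.
  by move=> Kp; have [] := region_in_dom rad1 Kp.
have Kj p : region (1 + ep) p -> jet G (pt p).
  move=> Kp; have [hd hn _] := region_in_dom rad1 Kp.
  exact: quot_jet hd (lt_le_trans rad1 hn) K5 L5.
have := min_principle (@region_compact R (1 + ep)) Kin KB Kj Gb Kt0.
have -> : pt (complex.Re t0, complex.Im t0) = t0 by rewrite /pt; case: (t0).
rewrite GE f0 mul0r sub0r lerN2.
have -> : h * complex.Im (barrier (3 - mu) t0) = 4 * d by rewrite /d; field.
by move: (d) d0; clear => d d0; lra.
Qed.

(** * Parametrization of the arc and conclusion *)

(** For [a = pi / 3], the triple angle formula and [cos (3 a) = -1] give
    [(cos a + 1) (2 cos a - 1)^2 = 0]. *)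
Lemma cos_2pi3 (R : realType) : cos (2 * pi / 3) = - 2^-1 :> R.
Proof.
have p0 := pi_gt0 R.
set a : R := pi / 3.
have -> : 2 * pi / 3 = a + a by rewrite /a; field.
have c0 : 0 < cos a by apply: cos_gt0_pihalf; rewrite /a; apply/andP; split; lra.
have : cos (a + (a + a)) = -1 by rewrite -cospi; congr cos; rewrite /a; field.
rewrite cosD sinD !cosD.
have e := cos2Dsin2 a.
have -> : cos a * (cos a * cos a - sin a * sin a) -
   sin a * (sin a * cos a + cos a * sin a) =
   4 * cos a ^+ 3 - 3 * cos a * (cos a ^+ 2 + sin a ^+ 2) by ring.
rewrite e => h.
have : (cos a + 1) * (2 * cos a - 1) ^+ 2 = 0.
  transitivity (4 * cos a ^+ 3 - 3 * cos a * 1 + 1); first by ring.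
  by rewrite h addNr.
move/eqP; rewrite mulf_eq0 gt_eqF ?addr_gt0 //= sqrf_eq0 => /eqP c2.
have ce : cos a = 2^-1 by lra.
by have := e; rewrite ce !expr2 => e'; lra.
Qed.

Lemma arc_of_unit (R : realType) (t : R[i]) : normc t = 1 -> 0 < complex.Im t ->
  - 2^-1 <= complex.Re t <= 0 -> unit_circle_arc t.
Proof.
case: t => x y n1 /= y0 /andP[x1 x2].
have : normc (x +i* y) ^+ 2 = x ^+ 2 + y ^+ 2 by exact: normc_sqr.
rewrite n1 expr1n => e.
have xI : -1 <= x <= 1 by apply/andP; split; lra.
have p0 := pi_gt0 R.
have aI : acos x \in `[0, pi] by rewrite in_itv /= acos_ge0 ?acos_lepi.
have h2 : (pi / 2 : R) \in `[0, pi] by rewrite in_itv /=; apply/andP; split; lra.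
have h3 : (2 * pi / 3 : R) \in `[0, pi] by rewrite in_itv /=; apply/andP; split; lra.
exists (acos x).
  apply/andP; split; rewrite leNgt -ltr_cos // -leNgt acosK ?in_itv //=.
    by rewrite cos_pihalf.
  by rewrite cos_2pi3.
rewrite /expi acosK ?in_itv //= sin_acos //; congr (_ +i* _).
have -> : 1 - x ^+ 2 = y ^+ 2 by rewrite e addrAC subrr add0r.
by rewrite sqrtr_sqr ger0_norm // ltW.
Qed.

Theorem theorem1p2 (R : realType) (k l : nat)
  (hk : ~~ odd k) (hl : ~~ odd l) (hlk : (l < k)%N) (hl10 : (10 <= l)%N)
  (tau : R[i]) (htau : fundamental_domain tau)
  (hzero : eisenstein k tau * eisenstein l tau + eisenstein (k + l) tau = 0) :
  unit_circle_arc tau.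
Proof.
have [K kE] : exists K, k = (2 * K)%N by exists (k./2); lia.
have [L lE] : exists L, l = (2 * L)%N by exists (l./2); lia.
have K5 : (5 <= K)%N by lia.
have L5 : (5 <= L)%N by lia.
have f0 : eis_comb K L tau = 0 by rewrite /eis_comb mulnDr -kE -lE.
have [y0 n1 xI] : [/\ 0 < complex.Im tau, 1 <= normc tau &
    - 2^-1 <= complex.Re tau <= 0 \/
    1 < normc tau /\ 0 < complex.Re tau < 2^-1].
  case: htau => [[y0 [n1 xI]]|[y0 [n1 xI]]]; move: n1; rewrite normrcE ?ltcR ?lecR => n1.
    by split; [|exact: ltW|right].
  by split=> //; left.
have hd : in_dom tau.
  split=> //; last by rewrite -normc_sqr exprn_ege1.
  by case: xI => [|[_]] /andP[x1 x2]; apply/andP; split; lra.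
move: n1; rewrite le_eqVlt => /orP[/eqP n1|n1].
  case: xI => [xI|[]]; last by rewrite -n1 ltxx.
  exact: arc_of_unit.
have [y2|y2] := leP 2 (complex.Im tau).
  by have := top_quot hd y2 K5 L5; rewrite f0 mul0r ler10.
(* The left line belongs to the fundamental domain but not to the open strip of [eis_comb_neq0];
   positivity on the line settles it directly. *)
have [x2|x2] := eqVneq (complex.Re tau) (- 2^-1).
  have [s [s0 _ ts _]] := line_coord hd n1 x2 (ltW y2).
  by have [] := comb_line s0 K5 L5; rewrite -ts f0 ltxx.
have hx : `|complex.Re tau| < 2^-1.
  rewrite ltr_norml; case: xI => [|[_]] /andP[x0 x1].
    by rewrite lt_neqAle eq_sym x2 x0 /=; lra.
  by rewrite x1 andbT; lra.
by move: (eis_comb_neq0 hd K5 L5 n1 hx y2); rewrite f0 eqxx.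
Qed.
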